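(* Let $\Omega\subset\mathbb{R}^d$ be a compact set with Lipschitz boundary satisfying an interior cone condition. Let $\Psi,\Phi$ be correlation functions on $\mathbb{R}^d$ with spectral densities $f_\Psi,f_\Phi$ such that, for some constants $c_2\ge c_1>0$, $c_4\ge c_3>0$ and $\nu_0,\nu>0$, for all $\omega\in\mathbb{R}^d$, $$c_1(1+\|\omega\|^2)^{-(\nu_0+d/2)}\le f_\Psi(\omega)\le c_2(1+\|\omega\|^2)^{-(\nu_0+d/2)},\qquad c_3(1+\|\omega\|^2)^{-(\nu+d/2)}\le f_\Phi(\omega)\le c_4(1+\|\omega\|^2)^{-(\nu+d/2)}.$$ Let $Z$ be a stationary Gaussian process on $\mathbb{R}^d$ with mean zero and covariance $\mathrm{Cov}(Z(x),Z(x'))=\sigma^2\Psi(x-x')$, $\sigma^2>0$. Then there exist constants $C_1,C_2>0$ such that for any design $X\subset\Omega$ with $h_{X,\Omega}<1$ and $\mathrm{card}(X)=n$, and any $t>0$, with probability at least $1-\exp\{-t^2/(2C_1\sigma^2A)\}$, $$\sup_{x\in\Omega}|Z(x)-\mathcal{I}_{\Phi,X}Z(x)|\ge C_2\,\sigma\, n^{-\nu_0/d}\sqrt{\log n}-t,$$ where $A=h_{X,\Omega}^{2\nu}$ if $\nu\le\nu_0$, and $A=h_{X,\Omega}^{2\nu_0}\rho_{X,\Omega}^{2(\nu-\nu_0)}$ if $\nu>\nu_0$. Here the constants $C_1,C_2$ depend only on $\Omega,\Phi$ and $\Psi$ (including $\nu$ and $\nu_0$).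
   Context: A correlation function is a continuous, integrable, symmetric, positive definite function $\Psi$ on $\mathbb{R}^d$ (i.e. $(x,x')\mapsto\Psi(x-x')$ is a positive definite kernel) with $\Psi(0)=1$; its spectral density $f_\Psi$ is the function with $\Psi(x)=\int_{\mathbb{R}^d}e^{i\omega^Tx}f_\Psi(\omega)\,d\omega$. $\|\cdot\|$ is the Euclidean norm. The Gaussian process $Z$ is taken with almost surely continuous sample paths. A set $\Omega$ satisfies an interior cone condition if there exist an angle $\alpha\in(0,\pi/2)$ and a radius $R>0$ such that for every $x\in\Omega$ there is a unit vector $\xi(x)$ such that the cone $\{x+\lambda y:y\in\mathbb{R}^d,\|y\|=1,y^T\xi(x)\ge\cos\alpha,\lambda\in[0,R]\}$ is contained in $\Omega$. A design is a finite set $X=\{x_1,\ldots,x_n\}\subset\Omega$ of distinct points ($n\ge2$, so that $q_X$ is defined). Fill distance: $h_{X,\Omega}=\sup_{x\in\Omega}\inf_{x_j\in X}\|x-x_j\|$. Separation radius: $q_X=\min_{1\le j\ne k\le n}\|x_j-x_k\|/2$. Mesh ratio: $\rho_{X,\Omega}=h_{X,\Omega}/q_X$. The kriging interpolant with imposed correlation $\Phi$ is $\mathcal{I}_{\Phi,X}Z(x)=r_\Phi^T(x)K_\Phi^{-1}Y$, where $r_\Phi(x)=(\Phi(x-x_1),\ldots,\Phi(x-x_n))^T$, $K_\Phi=(\Phi(x_j-x_k))_{jk}$ and $Y=(Z(x_1),\ldots,Z(x_n))^T$. *)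

(* Defs.v *)
From HB Require Import structures.
From mathcomp Require Import all_boot all_order all_algebra.
From mathcomp Require Import all_classical all_reals all_analysis.

Set Implicit Arguments.
Unset Strict Implicit.
Unset Printing Implicit Defensive.

Import Order.TTheory GRing.Theory Num.Theory.
Import numFieldNormedType.Exports.

Local Open Scope classical_set_scope.
Local Open Scope ring_scope.

(* Points of R^d are row vectors. The library norm on 'rV[R]_d is the sup norm,
   which gives the right topology but not the Euclidean distances used here. *)

Definition edot (R : realType) (d : nat) (x y : 'rV[R]_d) : R :=
  \sum_(i < d) x ord0 i * y ord0 i.

Definition enorm (R : realType) (d : nat) (x : 'rV[R]_d) : R :=
  Num.sqrt (edot x x).

(* Lebesgue measure on R^n, on the Borel sets of n.-tuple R: the image of the
   product of the measures on R^(n-1) and on R under (t, a) |-> a :: t. *)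

Definition tuple_cons (R : realType) (n : nat)
    (p : n.-tuple (measurableTypeR R) * measurableTypeR R) :
  n.+1.-tuple (measurableTypeR R) := [tuple of p.2 :: p.1].

Lemma measurable_tuple_cons (R : realType) (n : nat) :
  measurable_fun setT (@tuple_cons R n).
Proof. exact: measurable_cons. Qed.

Definition lebesgue_tupleS (R : realType) (n : nat)
    (mu : {measure set (n.-tuple (measurableTypeR R)) -> \bar R}) :
  {measure set (n.+1.-tuple (measurableTypeR R)) -> \bar R} :=
  measure_function_pushforward__canonical__measure_function_Measure
    (mu \x @lebesgue_measure R)%E (measurable_tuple_cons (n := n)).

Lemma lebesgue_tupleSE (R : realType) (n : nat)
    (mu : {measure set (n.-tuple (measurableTypeR R)) -> \bar R}) :
  lebesgue_tupleS mu =
  pushforward (mu \x @lebesgue_measure R)%E (@tuple_cons R n) :> (set _ -> _).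
Proof. by []. Qed.

Fixpoint lebesgue_tuple (R : realType) (n : nat) :
    {measure set (n.-tuple (measurableTypeR R)) -> \bar R} :=
  match n with
  | 0 => dirac [tuple]
  | m.+1 => lebesgue_tupleS (lebesgue_tuple R m)
  end.

Lemma lebesgue_tuple_cylinder (R : realType) (n : nat)
    (A : set (measurableTypeR R)) (B : set (n.-tuple (measurableTypeR R))) :
  measurable A -> measurable B ->
  lebesgue_tuple R n.+1 [set t | A (thead t) /\ B [tuple of behead t]] =
  (lebesgue_measure A * lebesgue_tuple R n B)%E.
Proof.
move=> mA mB; rewrite /= lebesgue_tupleSE /pushforward.
rewrite (_ : _ @^-1` _ = B `*` A); first by rewrite product_measure1E// muleC.
apply/seteqP; split => -[t a]; rewrite /preimage/= /tuple_cons/= theadE.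
  by move=> [? H]; split => //=; move: H; congr B; apply/val_inj.
by move=> [H ?]; split => //=; move: H; congr B; apply/val_inj.
Qed.

Definition row_of_tuple (R : realType) (d : nat)
    (t : d.-tuple (measurableTypeR R)) : 'rV[R]_d :=
  \row_(i < d) (tnth t i : R).

Definition lebesgue_integrable (R : realType) (d : nat) (f : 'rV[R]_d -> R) :=
  (lebesgue_tuple R d).-integrable setT (EFin \o f \o @row_of_tuple R d).

Definition lebesgue_integral_rV (R : realType) (d : nat)
    (f : 'rV[R]_d -> R) : R :=
  \int[lebesgue_tuple R d]_(t in setT) f (row_of_tuple t).

Definition interior_cone_condition (R : realType) (d : nat)
    (Omega : set 'rV[R]_d) : Prop :=
  exists alpha radius : R, [/\ 0 < alpha, alpha < pi / 2, 0 < radius &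
    forall x, Omega x -> exists xi : 'rV[R]_d, enorm xi = 1 /\
      forall (y : 'rV[R]_d) (lambda : R), enorm y = 1 ->
        cos alpha <= edot y xi -> 0 <= lambda <= radius ->
        Omega (x + lambda *: y)].

(* Near each boundary point, in the orthonormal coordinates y *m Q, the set is
   the closed epigraph of a Lipschitz function of all coordinates but the i-th.
   The epigraph is closed because the sets considered are compact. *)
Definition lipschitz_boundary (R : realType) (d : nat)
    (Omega : set 'rV[R]_d) : Prop :=
  forall x, (closure Omega `\` interior Omega) x ->
  exists (r L : R) (Q : 'M[R]_d) (i : 'I_d) (g : 'rV[R]_d.-1 -> R),
    [/\ 0 < r, Q *m Q^T = 1%:M,
        forall u v, `|g u - g v| <= L * enorm (u - v) &
        forall y, enorm (y - x) < r ->
          (Omega y <-> g (col' i (y *m Q)) <= (y *m Q) ord0 i)].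

(* Positive definiteness is taken in the weak (Bochner) sense. Together with a
   positive spectral density it makes all kernel matrices at distinct points
   invertible. *)
Definition positive_definite_kernel (R : realType) (T : Type)
    (k : T -> T -> R) : Prop :=
  forall (n : nat) (x : 'I_n -> T) (a : 'I_n -> R),
    0 <= \sum_(i < n) \sum_(j < n) a i * a j * k (x i) (x j).

Definition correlation_function (R : realType) (d : nat)
    (Psi : 'rV[R]_d -> R) : Prop :=
  [/\ continuous Psi /\ lebesgue_integrable Psi,
      forall x, Psi (- x) = Psi x,
      positive_definite_kernel (fun x x' => Psi (x - x')) &
      Psi 0 = 1].

(* Real and imaginary parts of Psi x = \int exp(i omega^T x) f(omega) d omega. *)
Definition spectral_density (R : realType) (d : nat)
    (Psi f : 'rV[R]_d -> R) : Prop :=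
  lebesgue_integrable f /\
  forall x,
    lebesgue_integral_rV (fun omega => cos (edot omega x) * f omega) = Psi x /\
    lebesgue_integral_rV (fun omega => sin (edot omega x) * f omega) = 0.

Definition spectral_decay (R : realType) (d : nat) (f : 'rV[R]_d -> R)
    (nu c c' : R) : Prop :=
  forall omega,
    c * (1 + enorm omega ^+ 2) `^ (- (nu + d%:R / 2)) <= f omega /\
    f omega <= c' * (1 + enorm omega ^+ 2) `^ (- (nu + d%:R / 2)).

(* The library's normal_prob m s is the normal law with mean m and standard
   deviation s only for s != 0; the degenerate law is a Dirac mass. *)
Definition gaussian_law (R : realType) (dT : measure_display)
    (T : measurableType dT) (P : probability T R) (X : T -> R) : Prop :=
  (exists m s : R, 0 < s /\ forall A : set (measurableTypeR R),
     measurable A -> P (X @^-1` A) = normal_prob m s A) \/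
  (exists m : R, forall A : set (measurableTypeR R),
     measurable A -> P (X @^-1` A) = dirac m A).

(* Joint normality of all finite-dimensional marginals, in the form that every
   finite linear combination is a normal variable. *)
Definition gaussian_process (R : realType) (dT : measure_display)
    (T : measurableType dT) (P : probability T R) (I : Type)
    (Z : I -> {RV P >-> R}) : Prop :=
  forall (n : nat) (x : 'I_n -> I) (a : 'I_n -> R),
    gaussian_law P (fun w => \sum_(j < n) a j * Z (x j) w).

Definition fill_distance (R : realType) (d n : nat) (Omega : set 'rV[R]_d)
    (x : 'I_n -> 'rV[R]_d) : R :=
  sup [set inf [set enorm (y - x j) | j in setT] | y in Omega].

Definition separation_radius (R : realType) (d n : nat)
    (x : 'I_n -> 'rV[R]_d) : R :=
  inf [set enorm (x jk.1 - x jk.2) / 2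
      | jk in [set jk : 'I_n * 'I_n | jk.1 != jk.2]].

Definition mesh_ratio (R : realType) (d n : nat) (Omega : set 'rV[R]_d)
    (x : 'I_n -> 'rV[R]_d) : R :=
  fill_distance Omega x / separation_radius x.

Definition kriging_interpolant (R : realType) (d n : nat)
    (Phi : 'rV[R]_d -> R) (x : 'I_n -> 'rV[R]_d) (f : 'rV[R]_d -> R)
    (y : 'rV[R]_d) : R :=
  ((\row_(j < n) Phi (y - x j)) *m
   invmx (\matrix_(j < n, k < n) Phi (x j - x k)) *m
   (\col_(j < n) f (x j))) ord0 ord0.

Definition variance_rate (R : realType) (d n : nat) (Omega : set 'rV[R]_d)
    (x : 'I_n -> 'rV[R]_d) (nu nu0 : R) : R :=
  if nu <= nu0 then fill_distance Omega x `^ (2 * nu)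
  else fill_distance Omega x `^ (2 * nu0) *
       mesh_ratio Omega x `^ (2 * (nu - nu0)).

(* Main.v *)
From HB Require Import structures.
Require Import Defs.
From mathcomp Require Import all_boot all_order all_algebra.
From mathcomp Require Import all_classical all_reals all_analysis.
From mathcomp Require Import measurable_realfun ring lra zify.

Set Implicit Arguments.
Unset Strict Implicit.
Unset Printing Implicit Defensive.

Import Order.TTheory GRing.Theory Num.Theory.
Import numFieldNormedType.Exports.

(** The lower bound already holds for the values of the error at [n] suitable
    points of [Omega], and for every interpolant that is linear in the data.

    Points. By the cone condition [Omega] contains a cube. A grid in the cube with
    at least [2 n] nodes has [n] nodes [y_1, ..., y_n] at distance at least
    [delta], of order [n ^ (- 1 / d)], from each other and from the design
    ([cone_contains_cube], [separated_points]).

    Variance. A combination of the variables [Z y_i] and [Z x_j] with coefficient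
    one at [Z y_i] has variance at least a constant times
    [sigma ^ 2 * delta ^ (2 nu0)] ([variance_lower_bound]). Indeed the spectral
    density dominates a multiple of a product of even powers of sinc functions,
    one for each coordinate. The Fourier transform of this product vanishes at
    every point with a coordinate of modulus at least [delta], so that for the
    covariance it defines the isolated variable [Z y_i] is uncorrelated with the
    other ones.

    Small balls. Let [W_i] be the error at [y_i], and [v] the lower bound on the
    variances. The combination of all the variables which is uncorrelated with
    all of them but [Z y_i] ([dual_vector]) is independent of the [W_j] with
    [j != i]. Along it, [W_i] can be shifted by [3 a] or [- 3 a] without changing
    the other errors, at the price of a factor [exp (- 9 a ^ 2 / (2 v))] in the
    probability. Starting from the event that all [|W_i|] are at most [a], the
    [2 n] shifted events are disjoint, so that this event has probability at most
    [exp (9 a ^ 2 / (2 v)) / (2 n)] ([small_ball], [kriging_error_small_ball]).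
    For [a = C2 * sigma * n ^ (- nu0 / d) * sqrt (ln n)] with [C2] small, this is
    less than [n ^ (- 1 / 2)].

    Comparison. The fill distance is at least [delta] and the mesh ratio is bounded
    below, hence [A] is at least a constant times [n ^ (- 2 nu0 / d)]
    ([variance_rate_ge]). So if [t < a] and [C1] is large, the failure probability
    [exp (- t ^ 2 / (2 C1 sigma ^ 2 A))] that is granted exceeds [n ^ (- 1 / 2)].
    If [t >= a] the asserted bound is nonpositive.

    The Gaussian input is the formula [E cos (X + t) = cos t * exp (- E X ^ 2 / 2)]
    for centred combinations [X] of the field ([gaussian_law_charfun]). It yields
    independence because two finite signed laws on the line with the same
    integrals of all functions [cos (s x + t)] give the same mass to intervals
    ([functional_eq_itv]). *)

Local Open Scope classical_set_scope.
Local Open Scope ring_scope.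

(** * Signed laws on the line and their cosine transforms *)

Section elementary_limits.
Variable R : realType.
Implicit Types x y z : R.

Lemma bernoulli_ineq (u : R) (n : nat) : 0 <= u <= 1 -> 1 - n%:R * u <= (1 - u) ^+ n.
Proof.
move=> /andP[u0 u1]; elim: n => [|n IH]; first by rewrite expr0 mul0r subr0.
rewrite exprS; have h : 0 <= 1 - u by rewrite subr_ge0.
have := ler_wpM2l h IH; rewrite -natr1 => H.
apply: le_trans H; have nn : 0 <= n%:R :> R by [].
nra.
Qed.

Lemma le_onem_expn_expR (u : R) (n : nat) : u <= 1 -> (1 - u) ^+ n <= expR (- (n%:R * u)).
Proof.
move=> u1; rewrite -mulrN expRM_natl.
by rewrite lerXn2r ?nnegrE ?subr_ge0 ?expR_ge0// (le_trans _ (expR_ge1Dx _)).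
Qed.

(** With [w = sqrt z], one factor [w ^+ n] absorbs [n] since [w ^- n] grows at
    least linearly, and the other one tends to zero. *)
Lemma cvg_natM_expn z : 0 <= z < 1 -> n%:R * z ^+ n @[n --> \oo] --> (0 : R).
Proof.
move=> /andP[z0 z1].
have [->|zn0] := eqVneq z 0.
  apply: cvg_near_cst; exists 1%N => //= -[//|n] _.
  by rewrite exprS mul0r mulr0.
have zp : 0 < z by rewrite lt_def zn0.
pose w := Num.sqrt z.
have w0 : 0 < w by rewrite sqrtr_gt0.
have w1 : w < 1 by rewrite -sqrtr1 ltr_sqrt.
pose h := w^-1 - 1.
have h0 : 0 < h by rewrite subr_gt0 invf_gt1.
have key n : n%:R * z ^+ n <= h^-1 * w ^+ n.
  have -> : z ^+ n = w ^+ n * w ^+ n by rewrite -expr2 -exprM mulnC exprM sqr_sqrtr.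
  rewrite mulrA; apply: ler_wpM2r; first by rewrite exprn_ge0// ltW.
  have growth : h * n%:R <= w^-1 ^+ n.
    have -> : w^-1 = 1 + h by rewrite /h addrC subrK.
    elim: n => [|n IH]; first by rewrite mulr0.
    rewrite exprS -natr1; have : 1 <= (1 + h) ^+ n by rewrite exprn_ege1// lerDl ltW.
    nra.
  rewrite -(ler_pM2l h0) divff ?gt_eqF// mulrA.
  have := ler_wpM2r (exprn_ge0 n (ltW w0)) growth.
  by rewrite -exprMn mulVf ?gt_eqF// expr1n.
apply: (@squeeze_cvgr _ _ _ _ (cst 0) (fun n => h^-1 * w ^+ n)).
- by apply: nearW => n; rewrite key mulr_ge0// exprn_ge0.
- exact: cvg_cst.
- by rewrite -[X in _ --> X](mulr0 h^-1); apply: cvgM; [exact: cvg_cst|apply: cvg_expr; rewrite ger0_norm ?ltW].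
Qed.

(** By [bernoulli_ineq] and [le_onem_expn_expR] the power is close to one when
    [k * (y * m) ^+ k] is small and to zero when it is large. The factor [k] in the
    exponent makes the limit vanish at the threshold [y = 1 / m] too. *)
Lemma cvg_onem_expn_threshold (y : R) (m : nat) : 0 <= y <= 1 ->
  ((1 - y ^+ k) ^+ (k * m ^ k)%N : R) @[k --> \oo] --> ((y * m%:R < 1)%R%:R : R).
Proof.
move=> /andP[y0 y1]; have yk k : 0 <= y ^+ k <= 1 by rewrite exprn_ge0// exprn_ile1.
case: ltP => ym.
- apply: (@squeeze_cvgr _ _ _ _ (fun k => 1 - k%:R * (y * m%:R) ^+ k) (cst 1)).
  + apply: nearW => k; apply/andP; split.
      apply: le_trans (bernoulli_ineq _ (yk k)).
      by rewrite natrM natrX exprMn -mulrA (mulrC (y ^+ k)).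
    by case/andP: (yk k) => ? ?; rewrite exprn_ile1 ?subr_ge0// lerBlDr lerDl.
  + rewrite -[X in _ --> X]subr0; apply: cvgB; first exact: cvg_cst.
    by apply: cvg_natM_expn; rewrite mulr_ge0.
  + exact: cvg_cst.
- apply: (@squeeze_cvgr _ _ _ _ (cst 0) (fun k => expR (- k%:R))).
  + apply: nearW => k; case/andP: (yk k) => ? ?.
    rewrite exprn_ge0 ?subr_ge0//=.
    apply: (le_trans (le_onem_expn_expR _ _)) => //.
    rewrite ler_expR lerN2 natrM natrX -mulrA ler_peMr// mulrC -exprMn.
    by rewrite exprn_ege1.
  + exact: cvg_cst.
  + by apply: (cvg_comp (fun k : nat => k%:R : R) (fun x => expR (- x)));
      [exact: cvgr_idn|exact: cvgr_expR].
Qed.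

Lemma sin_lt_id x : 0 < x <= 1 -> 0 < sin x < x.
Proof.
move=> /andP[x0 x1]; have pi2 := @pi_ge2 R.
rewrite sin_gt0_pi; last by rewrite x0 (le_lt_trans x1)// (lt_le_trans _ pi2)// ltr1n.
have csin : {within `[0, x], continuous (@sin R)}.
  by apply: continuous_subspaceT => y; exact: continuous_sin.
have [c] := MVT x0 (fun y _ => is_derive_sin y) csin.
rewrite in_itv/= => /andP[c0 cx]; rewrite sin0 !subr0 => ->.
rewrite gtr_pMl// -cos0 ltr_cos//.
- by rewrite in_itv/= lexx pi_ge0.
- by rewrite in_itv/= (ltW c0) (le_trans (ltW cx))// (le_trans x1)// (le_trans _ pi2)// ler1n.
Qed.

Lemma cvg_scaled_sin z : n.+1%:R * sin (z / n.+1%:R) @[n --> \oo] --> z.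
Proof.
have [->|z0] := eqVneq z 0.
  by under eq_fun do rewrite mul0r sin0 mulr0; exact: cvg_cst.
have H : h^-1 *: (sin (h + 0) - sin 0) @[h --> 0^'] --> (1 : R).
  have d := @is_derive_sin R 0; have := @ex_derive _ _ _ _ _ _ _ d.
  rewrite /derivable => /cvg_ex[l Hl].
  have <- : l = 1.
    have := @derive_val _ _ _ _ _ _ _ d; rewrite cos0 => <-; apply/esym/cvg_lim => //.
  by move: Hl; under eq_fun do rewrite /= [_%:A]mulr1.
have -> : (fun n => n.+1%:R * sin (z / n.+1%:R)) =
    (fun n => z * ((z / n.+1%:R)^-1 *: (sin (z / n.+1%:R + 0) - sin 0))).
  apply/funext => n; rewrite sin0 subr0 addr0 invfM invrK /GRing.scale/=.
  by rewrite -mulrA mulVKf.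
rewrite -[X in _ --> X]mulr1; apply: cvgM; first exact: cvg_cst.
move/cvgr_dnbhsP : H; apply; split=> [n|].
  by rewrite mulf_neq0// invr_eq0.
rewrite -[X in _ --> X](mulr0 z); apply: cvgM; [exact: cvg_cst|exact: cvg_harmonic].
Qed.

(** At [`|z| = 1] the strict inequality [sin x < x] keeps all the terms on the
    right side of the threshold, so that the limit is the indicator of the closed
    interval, with no exceptional points. *)
Lemma cvg_sin_threshold z :
  ((sin (z / n.+1%:R) ^+ 2 * (n.+1 ^ 2)%:R < 1)%R%:R : R) @[n --> \oo] -->
  ((`|z| <= 1)%R%:R : R).
Proof.
have eqn n : (sin (z / n.+1%:R) ^+ 2 * (n.+1 ^ 2)%:R < 1) =
    (`|n.+1%:R * sin (z / n.+1%:R)| < 1).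
  by rewrite natrX -exprMn mulrC -real_normK ?num_real// expr_lt1.
under eq_fun do rewrite eqn.
case: leP => z1.
  apply: cvg_near_cst; apply: nearW => n.
  have -> // : `|n.+1%:R * sin (z / n.+1%:R)| < 1.
  have -> : `|n.+1%:R * sin (z / n.+1%:R)| = n.+1%:R * `|sin (`|z| / n.+1%:R)|.
    rewrite normrM ger0_norm//; congr (_ * _).
    have [//|_] := ger0P z.
    by rewrite mulNr sinN normrN.
  have [->|z0] := eqVneq z 0; first by rewrite normr0 mul0r sin0 normr0 mulr0.
  have /andP[s0 s1] : 0 < sin (`|z| / n.+1%:R) < `|z| / n.+1%:R.
    apply: sin_lt_id; rewrite divr_gt0 ?normr_gt0//=.
    by rewrite ler_pdivrMr// mul1r (le_trans z1)// ler1n.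
  rewrite (ger0_norm (ltW s0)) mulrC -ltr_pdivlMr// (lt_le_trans s1)//.
  by rewrite ler_wpM2r.
apply: cvg_near_cst.
have /cvgr_norm_gt/(_ _ z1) := @cvg_scaled_sin z.
by apply: filterS => n h; rewrite ltNge (ltW h).
Qed.

End elementary_limits.

Lemma cosMcos (R : realType) (x y : R) :
  cos x * cos y = 2^-1 * cos (x + y) + 2^-1 * cos (x - y).
Proof. by rewrite cosD cosB; field. Qed.

Section trigonometric_uniqueness.
Variable R : realType.
Implicit Types (h k : R -> R) (L : (R -> R) -> R).

Definition bounded_measurable d (T : measurableType d) (f : T -> R) :=
  measurable_fun setT f /\ exists M, forall x, `|f x| <= M.

(** The functionals meant here are [h |-> \int X * (h \o U) dP] with [X] a
    bounded signed weight, in other words integration against the law of [U]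
    under a finite signed measure, and differences of such functionals. *)
Definition continuous_functional L :=
  (forall a h k, bounded_measurable h -> bounded_measurable k ->
    L (fun x => a * h x + k x) = a * L h + L k) /\
  (forall (h_ : nat -> R -> R) h (M : R), (forall n, measurable_fun setT (h_ n)) ->
    (forall n x, `|h_ n x| <= M) ->
    (forall x, h_ n x @[n --> \oo] --> h x) ->
    L (h_ n) @[n --> \oo] --> L h).

Lemma measurable_cos_affine (s t : R) : measurable_fun setT (fun x => cos (s * x + t)).
Proof.
apply: measurableT_comp; first exact: continuous_measurable_fun (@continuous_cos R).
by apply: measurable_funD => //; exact: measurable_funM.
Qed.

Lemma bounded_measurable_cos (s t : R) : bounded_measurable (fun x => cos (s * x + t)).
Proof. by split; [exact: measurable_cos_affine|exists 1 => x; exact: cos_max]. Qed.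

Lemma bounded_measurableM d (T : measurableType d) (h k : T -> R) :
  bounded_measurable h -> bounded_measurable k ->
  bounded_measurable (fun x => h x * k x).
Proof.
move=> [mh [M hM]] [mk [N kN]]; split; first exact: measurable_funM.
by exists (M * N) => x; rewrite normrM ler_pM.
Qed.

Lemma bounded_measurable_lin d (T : measurableType d) a (h k : T -> R) :
  bounded_measurable h -> bounded_measurable k ->
  bounded_measurable (fun x => a * h x + k x).
Proof.
move=> [mh [M hM]] [mk [N kN]]; split.
  by apply: measurable_funD => //; exact: measurable_funM.
exists (`|a| * M + N) => x; rewrite (le_trans (ler_normD _ _))// lerD//.
by rewrite normrM ler_wpM2l.
Qed.

Section null_class.
Variable L : (R -> R) -> R.
Hypothesis LC : continuous_functional L.
Hypothesis Lcos : forall s t, L (fun x => cos (s * x + t)) = 0.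

(** Asking for a vanishing integral against every cosine, and not only for
    [L h = 0], makes the class stable under multiplication by cosines. *)
Let null h := bounded_measurable h /\
  forall s t, L (fun x => h x * cos (s * x + t)) = 0.

Let null1 : null (cst 1).
Proof.
split; first by split => //; exists 1 => x; rewrite normr1.
by move=> s t; rewrite -[RHS](Lcos s t); congr L; apply/funext => x; rewrite mul1r.
Qed.

Let null_lin a h k : null h -> null k -> null (fun x => a * h x + k x).
Proof.
have [Llin _] := LC.
move=> [bh h0] [bk k0]; split; first exact: bounded_measurable_lin.
move=> s t; have -> : (fun x => (a * h x + k x) * cos (s * x + t)) =
    (fun x => a * (h x * cos (s * x + t)) + k x * cos (s * x + t)).
  by apply/funext => x; rewrite mulrDl mulrA.
rewrite Llin ?h0 ?k0 ?mulr0 ?addr0//; apply: bounded_measurableM => //;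
  exact: bounded_measurable_cos.
Qed.

Let null_cos h u v : null h -> null (fun x => h x * cos (u * x + v)).
Proof.
have [Llin _] := LC.
move=> [bh h0]; split.
  by apply: bounded_measurableM => //; exact: bounded_measurable_cos.
move=> s t; have -> : (fun x => h x * cos (u * x + v) * cos (s * x + t)) =
    (fun x => 2^-1 * (h x * cos ((u + s) * x + (v + t))) +
      (2^-1 * (h x * cos ((u - s) * x + (v - t))) + 0)).
  apply/funext => x.
  have -> : (u + s) * x + (v + t) = (u * x + v) + (s * x + t) by ring.
  have -> : (u - s) * x + (v - t) = (u * x + v) - (s * x + t) by ring.
  by rewrite -mulrA cosMcos; ring.
have b u' v' : bounded_measurable (fun x => h x * cos (u' * x + v')).
  by apply: bounded_measurableM => //; exact: bounded_measurable_cos.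
have b0 : bounded_measurable (fun _ : R => 0 : R).
  by split => //; exists 0 => x; rewrite normr0.
have L00 : L (fun=> 0) = 0.
  rewrite -[RHS](addNr (L (fun=> 0))) -mulN1r -(Llin _ _ _ b0 b0).
  by congr L; apply/funext => x; rewrite mulr0 addr0.
rewrite Llin//; last exact: bounded_measurable_lin.
by rewrite Llin// !h0 L00 !mulr0 !addr0.
Qed.

Let null_cvg (h_ : nat -> R -> R) h : (forall n, null (h_ n)) ->
  (forall n x, 0 <= h_ n x <= 1) -> (forall x, h_ n x @[n --> \oo] --> h x) -> null h.
Proof.
have [_ Lcvg] := LC.
move=> nh hb hc.
have h1 n x : `|h_ n x| <= 1.
  by case/andP: (hb n x) => ? ?; rewrite ger0_norm.
split.
  split; first by apply: (measurable_fun_cvg (fun n => (nh n).1.1)) => x _; exact: hc.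
  exists 1 => x; rewrite -(cvg_lim (@Rhausdorff R) (cvg_norm (hc x))).
  by apply: limr_le; [exact: cvgP (cvg_norm (hc x))|exact: nearW].
move=> s t.
have H := @Lcvg (fun n x => h_ n x * cos (s * x + t)) (fun x => h x * cos (s * x + t)) 1.
have {}H : L (fun x => h_ n x * cos (s * x + t)) @[n --> \oo] -->
    L (fun x => h x * cos (s * x + t)).
  apply: H => [n|n x|x].
  - by apply: measurable_funM; [exact: (nh n).1.1|exact: measurable_cos_affine].
  - by rewrite normrM mulr_ile1 ?normr_ge0 ?cos_max.
  - by apply: cvgM; [exact: hc|exact: cvg_cst].
have <- := cvg_lim (@Rhausdorff R) H.
by under eq_fun do rewrite (nh _).2; rewrite lim_cst.
Qed.

Let null_sinM h w c : null h -> null (fun x => h x * sin (w * (x - c)) ^+ 2).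
Proof.
move=> nh.
have -> : (fun x => h x * sin (w * (x - c)) ^+ 2) =
  (fun x => (- 2^-1) * (h x * cos (2 * w * x + - (2 * w * c))) +
    (2^-1 * h x + (- 1 * h x + h x))).
  apply/funext => x.
  have -> : 2 * w * x + - (2 * w * c) = (w * (x - c)) *+ 2 by ring.
  by rewrite cos_mulr2n cos2sin2; field.
apply: null_lin; first exact: null_cos.
by apply: null_lin => //; exact: null_lin.
Qed.

Let null_onem_sin w c j n :
  null (fun x => (1 - (sin (w * (x - c)) ^+ 2) ^+ j) ^+ n).
Proof.
have nsin h i : null h -> null (fun x => h x * (sin (w * (x - c)) ^+ 2) ^+ i).
  move=> nh; elim: i => [|i IH]; first by under eq_fun do rewrite expr0 mulr1.
  by under eq_fun do rewrite exprSr mulrA; exact: null_sinM.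
elim: n => [|n IH]; first by under eq_fun do rewrite expr0; exact: null1.
have -> : (fun x => (1 - (sin (w * (x - c)) ^+ 2) ^+ j) ^+ n.+1) =
  (fun x => (-1) * ((1 - (sin (w * (x - c)) ^+ 2) ^+ j) ^+ n *
      (sin (w * (x - c)) ^+ 2) ^+ j) + (1 - (sin (w * (x - c)) ^+ 2) ^+ j) ^+ n).
  by apply/funext => x; rewrite exprSr; ring.
by apply: null_lin => //; exact: nsin.
Qed.

(** The null class contains the polynomials in [sin (w (x - c)) ^+ 2]. By
    [cvg_onem_expn_threshold] these converge boundedly to indicators of periodic
    unions of intervals, and stretching the period leaves one of them by
    [cvg_sin_threshold]. *)
Lemma trig_null_itv (c r : R) : 0 < r -> L (\1_`[c - r, c + r]) = 0.
Proof.
move=> r0.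
have nthr n : null (fun x => (sin ((r * n.+1%:R)^-1 * (x - c)) ^+ 2 * (n.+1 ^ 2)%:R < 1)%R%:R).
  have s01 x : 0 <= sin ((r * n.+1%:R)^-1 * (x - c)) ^+ 2 <= 1.
    rewrite sqr_ge0/= -[leRHS](cos2Dsin2 ((r * n.+1%:R)^-1 * (x - c))).
    by rewrite lerDr sqr_ge0.
  apply: (@null_cvg (fun j x =>
    (1 - (sin ((r * n.+1%:R)^-1 * (x - c)) ^+ 2) ^+ j) ^+ (j * (n.+1 ^ 2) ^ j)%N)).
  - by move=> j; exact: null_onem_sin.
  - move=> j x; have /andP[s0 s1] := s01 x.
    have p0 := exprn_ge0 j s0; have p1 := exprn_ile1 j s0 s1.
    by rewrite exprn_ge0 ?subr_ge0//= exprn_ile1 ?subr_ge0// lerBlDr lerDl.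
  - by move=> x; exact: cvg_onem_expn_threshold.
have [_ Hind] : null (\1_`[c - r, c + r]).
  apply: (@null_cvg (fun n x => (sin ((r * n.+1%:R)^-1 * (x - c)) ^+ 2 * (n.+1 ^ 2)%:R < 1)%R%:R)) => //.
  - by move=> n x; case: ltP; rewrite ?ler01 ?lexx.
  - move=> x; have := @cvg_sin_threshold R ((x - c) / r).
    have -> : (`|(x - c) / r| <= 1) = (x \in `[c - r, c + r]).
      rewrite normrM normfV (gtr0_norm r0) ler_pdivrMr// mul1r ler_norml in_itv/=.
      by congr andb; [rewrite lerBrDl|rewrite lerBlDl].
    rewrite indicE mem_setE; move=> H.
    have E n : (r * n.+1%:R)^-1 * (x - c) = (x - c) / r / n.+1%:R.
      by rewrite invfM mulrC mulrA.
    by under eq_fun do rewrite E; exact: H.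
have := Hind 0 0; under eq_fun do rewrite mul0r addr0 cos0 mulr1.
by [].
Qed.

End null_class.

(** The difference of the two functionals is again a continuous functional, and it
    kills all cosines. *)
Lemma functional_eq_itv L1 L2 (c r : R) :
  continuous_functional L1 -> continuous_functional L2 ->
  (forall s t, L1 (fun x => cos (s * x + t)) = L2 (fun x => cos (s * x + t))) ->
  0 < r -> L1 \1_`[c - r, c + r] = L2 \1_`[c - r, c + r].
Proof.
move=> [lin1 cvg1] [lin2 cvg2] eqcos r0.
apply/eqP; rewrite -subr_eq0; apply/eqP.
apply: (@trig_null_itv (fun h => L1 h - L2 h)) => //.
- split=> [a h k bh bk|h_ h M mh hM hc]; first by rewrite lin1// lin2//; ring.
  by apply: cvgB; [exact: cvg1 hM hc|exact: cvg2 hM hc].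
- by move=> s t; rewrite eqcos subrr.
Qed.
End trigonometric_uniqueness.

(** * Normal laws on the line *)

Section normal_characteristic_function.
Variable R : realType.
Notation mu := (@lebesgue_measure R).
Implicit Types (m s t x : R).

Lemma integral_normal_prob m s (f : R -> \bar R) : measurable_fun setT f ->
  (\int[normal_prob m s]_x `|f x| < +oo)%E ->
  (\int[normal_prob m s]_x f x = \int[mu]_x (f x * (normal_pdf m s x)%:E))%E.
Proof.
move=> mf finf.
have dom := normal_prob_dominates m s.
rewrite -(Radon_Nikodym_change_of_variables dom)//=; last first.
  by apply/integrableP; split.
apply: ae_eq_integral => //.
- exact: emeasurable_funM.
- apply: emeasurable_funM => //; apply/measurable_EFinP.
  exact: measurable_normal_pdf.
- apply: ae_eqe_mul2l => /=.
  rewrite Radon_NikodymE.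
  case: cid => /= h [h1 h2 h3].
  apply: integral_ae_eq => //=.
  + by apply/measurableT_comp => //; exact: measurable_normal_pdf.
  + by move=> E E01 mE; rewrite -h3.
Qed.

(** The fundamental theorem of calculus on [[- n - 1, n + 1]], and dominated
    convergence. *)
Lemma Rintegral_derive_eq0 (f F : R -> R) : mu.-integrable setT (EFin \o f) ->
  continuous f -> (forall x, is_derive x 1 F (f x)) ->
  F n%:R @[n --> \oo] --> 0 -> F (- n%:R) @[n --> \oo] --> 0 ->
  \int[mu]_x f x = 0.
Proof.
move=> intf cf dF F1 F2.
pose I (n : nat) := `[- n.+1%:R, n.+1%:R]%classic : set R.
pose f_ n x := f x * \1_(I n) x.
have H : (\int[mu]_x (f_ n x)%:E)%E @[n --> \oo] --> (\int[mu]_x (f x)%:E)%E.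
  apply: (@dominated_cvg _ _ _ mu setT measurableT (fun n x => (f_ n x)%:E) _ (fun x => `|(f x)%:E|%E)).
  - move=> n; apply/measurable_EFinP; apply: measurable_funM.
      by apply/measurable_EFinP; exact: (measurable_int mu).
    by apply: measurable_indic; exact: measurable_itv.
  - move=> x _; apply: cvg_EFin; first exact: nearW.
    apply: cvg_near_cst; near=> n; rewrite /= /f_ indicE mem_set ?mulr1//.
    rewrite /I/= in_itv/= -ler_norml.
    rewrite (@le_trans _ _ n%:R)// ?ler_nat//; near: n; exact: nbhs_infty_ger.
  - by [].
  - exact: integrable_abse.
  - move=> n x _; rewrite /f_ /= normrM lee_fin indicE.
    by case: (_ \in _); rewrite ?normr1 ?normr0 ?mulr1 ?mulr0.
have E n : (\int[mu]_x (f_ n x)%:E)%E = (F n.+1%:R - F (- n.+1%:R))%:E.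
  rewrite EFinB -(@continuous_FTC2 R f F).
  - rewrite [RHS]integral_mkcond; apply: eq_integral => x _.
    by rewrite /f_ patchE indicE; case: (_ \in _); rewrite ?mulr1 ?mulr0.
  - by rewrite -subr_gt0 opprK.
  - exact: continuous_subspaceT.
  - split.
    + by move=> x _; exact: ex_derive.
    + apply: cvg_at_right_filter; apply: differentiable_continuous.
      by apply/derivable1_diffP; exact: ex_derive.
    + apply: cvg_at_left_filter; apply: differentiable_continuous.
      by apply/derivable1_diffP; exact: ex_derive.
  - by move=> x _; rewrite derive1E; exact: derive_val.
have H0 : (F n.+1%:R - F (- n.+1%:R))%:E @[n --> \oo] --> 0%E.
  apply: cvg_EFin; first exact: nearW.
  rewrite -[X in _ --> X](subr0 0); apply: cvgB.
    by rewrite (cvg_shiftS (fun n => F n%:R)).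
  by rewrite (cvg_shiftS (fun n => F (- n%:R))).
rewrite /Rintegral; suff -> : (\int[mu]_x (f x)%:E = 0)%E by [].
apply: cvg_unique H0 => //.
by move: H; under eq_fun do rewrite E.
Unshelve. all: end_near. Qed.

Lemma is_derive_normal_fun m s x : s != 0 ->
  is_derive x 1 (normal_fun m s) (- ((x - m) / s ^+ 2) * normal_fun m s x).
Proof.
move=> s0; rewrite /normal_fun; apply: is_derive_eq.
rewrite /GRing.scale/= ?expr1 -[s ^+ 2 *+ 2]mulr_natr; field.
by rewrite s0.
Qed.

Lemma integrable_normal_fun m s : s != 0 ->
  mu.-integrable setT (EFin \o normal_fun m s).
Proof.
move=> s0; have := integrableZl measurableT (normal_peak s)^-1 (integrable_normal_pdf m s).
apply: eq_integrable => // x _.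
by rewrite normal_pdfE// -EFinM mulKf// gt_eqF// normal_peak_gt0.
Qed.

Lemma continuous_normal_fun m s : continuous (normal_fun m s).
Proof.
move=> x; rewrite /normal_fun; apply: (@continuous_comp _ _ _ (fun x => - (x - m) ^+ 2 / (s ^+ 2 *+ 2)) expR); last exact: continuous_expR.
apply: cvgM; last exact: cvg_cst.
apply: cvgN; apply: (@continuous_comp _ _ _ (fun x => x - m) (fun x => x ^+ 2)); last exact: exprn_continuous.
by apply: cvgB; [exact: cvg_id|exact: cvg_cst].
Qed.

Lemma cvg_normal_fun_pm m s (e : R) : s != 0 -> `|e| = 1 ->
  normal_fun m s (e * n%:R) @[n --> \oo] --> 0.
Proof.
move=> s0 e1; have s2 : 0 < s ^+ 2 by rewrite exprn_even_gt0.
have H : (e * n%:R - m) ^+ 2 / (s ^+ 2 *+ 2) @[n --> \oo] --> +oo.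
  apply/cvgryPge => A; near=> n.
  rewrite ler_pdivlMr; last by rewrite pmulrn_lgt0.
  have nn : 1 + `|A| * (s ^+ 2 *+ 2) + `|m| <= n%:R by near: n; exact: nbhs_infty_ger.
  have h1 : 1 + `|A| * (s ^+ 2 *+ 2) <= `|e * n%:R - m|.
    have := lerB_dist (e * n%:R) m; rewrite normrM e1 mul1r normr_nat; lra.
  have A0 : 0 <= `|A| * (s ^+ 2 *+ 2) by rewrite mulr_ge0// mulrn_wge0// ltW.
  have : A * (s ^+ 2 *+ 2) <= `|A| * (s ^+ 2 *+ 2).
    by rewrite ler_wpM2r ?ler_norm// mulrn_wge0// ltW.
  rewrite -(real_normK (num_real (e * n%:R - m))); nra.
have H2 := @cvg_comp _ _ _ (fun n : nat => (e * n%:R - m) ^+ 2 / (s ^+ 2 *+ 2))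
  (fun y => expR (- y)) _ _ _ H (@cvgr_expR R).
by rewrite /normal_fun; under eq_fun do rewrite mulNr; exact: H2.
Unshelve. all: end_near. Qed.

(** In the variable [u = |x - m| / (2 |s|)] this is [u <= exp (u ^ 2)]: widening
    the Gaussian by [sqrt 2] absorbs the linear factor. *)
Lemma le_normr_normal_fun m s x : s != 0 ->
  `|x - m| * normal_fun m s x <= 2 * `|s| * normal_fun m (Num.sqrt 2 * s) x.
Proof.
move=> s0; have ns0 : 0 < `|s| by rewrite normr_gt0.
pose u := `|x - m| / (2 * `|s|).
have xu : `|x - m| = 2 * `|s| * u by rewrite /u mulrC divfK// mulf_neq0// gt_eqF.
have x2 : (x - m) ^+ 2 = (2 * s * u) ^+ 2.
  rewrite -[LHS]real_normK ?num_real// xu !exprMn (real_normK (num_real s)).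
  by ring.
have -> : normal_fun m s x = expR (- (2 * u ^+ 2)).
  rewrite /normal_fun x2 -[s ^+ 2 *+ 2]mulr_natr; congr expR; field.
  by rewrite s0.
have -> : normal_fun m (Num.sqrt 2 * s) x = expR (- u ^+ 2).
  rewrite /normal_fun x2 [(Num.sqrt 2 * s) ^+ 2]exprMn sqr_sqrtr// -[_ *+ 2]mulr_natr; congr expR; field.
  by rewrite s0.
rewrite xu -mulrA ler_wpM2l ?mulr_ge0//.
have -> : - (2 * u ^+ 2) = - u ^+ 2 - u ^+ 2 by ring.
rewrite expRD mulrA ger_pMl ?expR_gt0// expRN ler_pdivrMr ?expR_gt0// mul1r.
apply: le_trans (expR_ge1Dx _); nra.
Qed.

Lemma integrable_normr_normal_fun m s : s != 0 ->
  mu.-integrable setT (fun x => (`|x - m| * normal_fun m s x)%:E).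
Proof.
move=> s0.
have s20 : Num.sqrt 2 * s != 0 by rewrite mulf_neq0// gt_eqF// sqrtr_gt0.
have := integrableZl measurableT (2 * `|s|) (integrable_normal_fun m s20).
apply: le_integrable => //.
  apply/measurable_EFinP/measurable_funM; last exact: measurable_normal_fun.
  by apply: measurableT_comp => //; exact: measurable_funB.
move=> x _; rewrite lee_fin !normrM normr_id (ger0_norm (normal_fun_ge0 _ _ _)).
rewrite (ger0_norm (normal_fun_ge0 _ _ _)) normr_id (@ger0_norm _ 2)//.
exact: le_normr_normal_fun.
Qed.

Lemma Rintegral_normal_fun m s : s != 0 ->
  \int[mu]_x normal_fun m s x = (normal_peak s)^-1.
Proof.
move=> s0; have p0 : normal_peak s != 0 by rewrite gt_eqF// normal_peak_gt0.
apply: (mulfI p0); rewrite mulfV// -RintegralZl//; last exact: integrable_normal_fun.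
rewrite /Rintegral -[RHS]/(fine 1%E) -(integral_normal_pdf m s); congr fine.
by apply: eq_integral => x _; rewrite normal_pdfE.
Qed.

Section cosine_transform.
Variables (m s a : R) (s0 : s != 0).
Let N := normal_fun m s.
Let phi t := \int[mu]_x (cos (t * (x - m) + a) * N x).

Let measurable_phase (f : R -> R) t : continuous f ->
  measurable_fun setT (fun x => f (t * (x - m) + a)).
Proof.
move=> cf; apply: measurableT_comp; first exact: continuous_measurable_fun.
by apply: measurable_funD => //; apply: measurable_funM => //; exact: measurable_funB.
Qed.

Let integrable_phase (f : R -> R) t : continuous f -> (forall y, `|f y| <= 1) ->
  mu.-integrable setT (fun x => (f (t * (x - m) + a) * N x)%:E).
Proof.
move=> cf f1; apply: le_integrable (integrable_normal_fun m s0) => //.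
  by apply/measurable_EFinP/measurable_funM;
    [exact: measurable_phase|exact: measurable_normal_fun].
by move=> x _; rewrite lee_fin normrM ler_piMl.
Qed.

Let integrable_phaseM (f : R -> R) t : continuous f -> (forall y, `|f y| <= 1) ->
  mu.-integrable setT (fun x => (f (t * (x - m) + a) * (x - m) * N x)%:E).
Proof.
move=> cf f1; apply: le_integrable (integrable_normr_normal_fun m s0) => //.
  apply/measurable_EFinP/measurable_funM; last exact: measurable_normal_fun.
  by apply: measurable_funM; [exact: measurable_phase|exact: measurable_funB].
move=> x _; rewrite lee_fin !normrM normr_id; apply: ler_wpM2r => //.
by rewrite ler_piMl.
Qed.

(** Integrating [x |-> sin (t (x - m) + a) * N x], whose derivative has integral
    zero, trades the factor [x - m] for [s ^+ 2 * t]. *)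
Let Rintegral_sin_phase t :
  \int[mu]_x (sin (t * (x - m) + a) * (x - m) * N x) = s ^+ 2 * t * phi t.
Proof.
have is0 : s ^+ 2 != 0 by rewrite expf_neq0.
have I1 : mu.-integrable setT (fun x => (t * (cos (t * (x - m) + a) * N x))%:E).
  have := integrableZl measurableT t (integrable_phase t (@continuous_cos R) (@cos_max R)).
  exact: eq_integrable.
have I2 : mu.-integrable setT
    (fun x => ((s ^+ 2)^-1 * (sin (t * (x - m) + a) * (x - m) * N x))%:E).
  have := integrableZl measurableT (s ^+ 2)^-1
    (integrable_phaseM t (@continuous_sin R) (@sin_max R)).
  exact: eq_integrable.
have boundary0 (e : R) : `|e| = 1 ->
    sin (t * (e * n%:R - m) + a) * N (e * n%:R) @[n --> \oo] --> 0.
  move=> e1; apply: norm_cvg0.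
  apply: (@squeeze_cvgr _ _ _ _ (cst 0) (fun n => N (e * n%:R))).
  - apply: nearW => n; rewrite normr_ge0/= normrM (ger0_norm (normal_fun_ge0 _ _ _)).
    by rewrite ler_piMl ?normal_fun_ge0 ?sin_max.
  - exact: cvg_cst.
  - exact: cvg_normal_fun_pm.
have : \int[mu]_x (t * (cos (t * (x - m) + a) * N x) -
    (s ^+ 2)^-1 * (sin (t * (x - m) + a) * (x - m) * N x)) = 0.
  apply: (@Rintegral_derive_eq0 _ (fun x => sin (t * (x - m) + a) * N x)).
  - by have := integrableB measurableT I1 I2; exact: eq_integrable.
  - have cN : continuous N by exact: continuous_normal_fun.
    have cx : continuous (fun x : R => x - m).
      by move=> x; apply: cvgB; [exact: cvg_id|exact: cvg_cst].
    have cp : continuous (fun x => t * (x - m) + a).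
      move=> x; apply: cvgD; last exact: cvg_cst.
      by apply: cvgM; [exact: cvg_cst|exact: cx].
    move=> x; apply: cvgB; apply: cvgM; try exact: cvg_cst.
      apply: cvgM; last exact: cN.
      by apply: (@continuous_comp _ _ _ (fun x => t * (x - m) + a) cos);
        [exact: cp|exact: continuous_cos].
    apply: cvgM; last exact: cN.
    apply: cvgM; last exact: cx.
    by apply: (@continuous_comp _ _ _ (fun x => t * (x - m) + a) sin);
      [exact: cp|exact: continuous_sin].
  - move=> x; have dN := is_derive_normal_fun m x s0.
    apply: is_derive_eq; rewrite /GRing.scale/= /N; ring.
  - have := boundary0 1 (normr1 _).
    by under eq_fun do rewrite mul1r.
  - have := boundary0 (-1) (normrN1 _).
    by under eq_fun do rewrite mulN1r.
rewrite RintegralB// !RintegralZl//; last 2 first.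
- exact: integrable_phaseM (@continuous_sin R) (@sin_max R).
- exact: integrable_phase (@continuous_cos R) (@cos_max R).
move/eqP; rewrite subr_eq0 => /eqP e.
by rewrite -mulrA [t * phi t]e mulVKf.
Qed.

Let is_derive_phi t : is_derive t 1 phi (- (s ^+ 2 * t * phi t)).
Proof.
have It : `]t - 1, t + 1[%classic t by rewrite /= in_itv/= gtrBl ltrDl ltr01.
have d1 (x u : R) : is_derive u 1 (fun u => cos (u * (x - m) + a) * N x)
    (- (sin (u * (x - m) + a) * (x - m) * N x)).
  by apply: is_derive_eq; rewrite /GRing.scale/=; ring.
have p1 (x u : R) : partial1of2 (fun u x => cos (u * (x - m) + a) * N x) u x =
    - (sin (u * (x - m) + a) * (x - m) * N x).
  by rewrite partial1of2E; exact: derive_val.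
have int (u : R) : mu.-integrable setT (EFin \o (fun x => cos (u * (x - m) + a) * N x)).
  exact: integrable_phase (@continuous_cos R) (@cos_max R).
have dom (u x : R) : `|partial1of2 (fun u x => cos (u * (x - m) + a) * N x) u x| <=
    `|x - m| * N x.
  rewrite p1 normrN !normrM (ger0_norm (normal_fun_ge0 _ _ _)).
  by rewrite ler_wpM2r ?normal_fun_ge0// ler_piMl ?sin_max.
have G0 x : 0 <= `|x - m| * N x by rewrite mulr_ge0 ?normal_fun_ge0.
have int' (u : R) (_ : `]t - 1, t + 1[%classic u) := int u.
have dom' (u x : R) (_ : `]t - 1, t + 1[%classic u) (_ : setT x) := dom u x.
have der' (u x : R) (_ : `]t - 1, t + 1[%classic u) (_ : setT x) :=
  @ex_derive _ _ _ _ _ _ _ (d1 x u).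
have intG := integrable_normr_normal_fun m s0.
apply: DeriveDef.
  exact: (derivable_under_integral measurableT It int' der' G0 intG dom').
rewrite -derive1E (differentiation_under_integral measurableT It int' der' G0 intG dom').
rewrite -Rintegral_sin_phase -[RHS]mulN1r -RintegralZl//; last first.
  exact: integrable_phaseM (@continuous_sin R) (@sin_max R).
by apply: eq_Rintegral => x _; rewrite p1 mulN1r.
Qed.

(** As a function of [t], the integral solves [phi' = - s ^+ 2 * t * phi], so that
    [phi t * expR (s ^+ 2 * t ^+ 2 / 2)] is constant. *)
Lemma Rintegral_cos_normal_fun t :
  \int[mu]_x (cos (t * (x - m) + a) * normal_fun m s x) =
  cos a * expR (- (s ^+ 2 * t ^+ 2 / 2)) / normal_peak s.
Proof.
pose psi t := phi t * expR (s ^+ 2 * t ^+ 2 / 2).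
have psi_cst : psi t = psi 0.
  apply: is_derive_0_is_cst => u; have dp := is_derive_phi u; apply: is_derive_eq.
  by rewrite /GRing.scale/=; field.
have phi0 : phi 0 = cos a / normal_peak s.
  rewrite /phi -(Rintegral_normal_fun m s0) -RintegralZl//; last exact: integrable_normal_fun.
  by apply: eq_Rintegral => x _; rewrite mul0r add0r.
rewrite -[LHS]/(phi t).
have : phi t * expR (s ^+ 2 * t ^+ 2 / 2) = cos a / normal_peak s.
  by rewrite -/(psi t) psi_cst /psi expr0n/= mulr0 mul0r expR0 mulr1.
by move=> e; rewrite expRN mulrAC -e mulfK// gt_eqF ?expR_gt0.
Qed.
End cosine_transform.

Lemma Rintegral_normal_prob m s (f : R -> R) : s != 0 -> bounded_measurable f ->
  \int[normal_prob m s]_x f x = normal_peak s * \int[mu]_x (f x * normal_fun m s x).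
Proof.
move=> s0 [mf [M fM]].
have mf' : measurable_fun setT (EFin \o f) by exact/measurable_EFinP.
rewrite -RintegralZl//; last first.
  have := integrableZl measurableT M (integrable_normal_fun m s0).
  apply: le_integrable => //.
    by apply/measurable_EFinP/measurable_funM => //; exact: measurable_normal_fun.
  move=> x _; rewrite lee_fin !normrM (ger0_norm (normal_fun_ge0 _ _ _)).
  by rewrite ler_wpM2r ?normal_fun_ge0// (le_trans (fM x))// ler_norm.
rewrite /Rintegral; congr fine; rewrite integral_normal_prob//.
  by apply: eq_integral => x _; rewrite normal_pdfE// -EFinM mulrCA.
apply: (@le_lt_trans _ _ (\int[normal_prob m s]_x (cst M%:E x))%E).
  apply: ge0_le_integral => //.
  - exact: measurableT_comp.
  - by move=> x _; rewrite lee_fin fM.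
by rewrite integral_cst// -[X in (_ * X)%E]/(normal_prob m s setT) probability_setT mule1 ltry.
Qed.

Lemma Rintegral_cos_normal_prob m s t a : s != 0 ->
  \int[normal_prob m s]_x cos (t * x + a) =
  cos (t * m + a) * expR (- (s ^+ 2 * t ^+ 2 / 2)).
Proof.
move=> s0; rewrite Rintegral_normal_prob//; last exact: bounded_measurable_cos.
have E x : t * x + a = t * (x - m) + (t * m + a) by ring.
under eq_Rintegral do rewrite E.
by rewrite Rintegral_cos_normal_fun// mulrC divfK// gt_eqF// normal_peak_gt0.
Qed.

End normal_characteristic_function.

Section normal_shift.
Variable R : realType.
Notation mu := (@lebesgue_measure R).

(** Probability that a centred normal variable, shifted by [r], lies within [a] of
    [c]. *)
Let window (s a r c : R) :=
  \int[normal_prob 0 s]_y (\1_`[c - a, c + a] (r + y) : R).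

Let windowE (s a r c : R) : s != 0 -> 0 < a ->
  window s a r c = normal_peak s * \int[mu]_(u in `[- a, a]) normal_fun 0 s (u + (c - r)).
Proof.
move=> s0 a0; rewrite /window Rintegral_normal_prob//; last first.
  split; last by exists 1 => y; rewrite indicE; case: (_ \in _); rewrite ?normr0 ?normr1.
  apply: measurableT_comp; first by apply: measurable_indic; exact: measurable_itv.
  exact: measurable_funD.
congr (_ * _).
have E y : (\1_`[c - a, c + a] (r + y) : R) = \1_`[- a + (c - r), a + (c - r)] y.
  rewrite !indicE; congr (_%:R); rewrite !mem_setE/= !in_itv/=.
  by congr (nat_of_bool (_ && _)); [rewrite -lerBlDl|rewrite -lerBrDl]; congr (_ <= _); ring.
under eq_Rintegral do rewrite E.
transitivity (\int[mu]_(y in `[- a + (c - r), a + (c - r)]) normal_fun 0 s y).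
  rewrite [RHS]Rintegral_mkcond; apply: eq_Rintegral => y _.
  by rewrite patchE indicE; case: (_ \in _); rewrite ?mul1r ?mul0r.
rewrite /Rintegral; congr fine.
pose F (u : R) := u + (c - r).
have dF : (F^`())%classic = cst 1.
  by apply/funext => u; rewrite derive1E /F deriveD// derive_id derive_cst addr0.
rewrite -/(F (- a)) -/(F a) (@integration_by_substitution_increasing R F (normal_fun 0 s)).
- by apply: eq_integral => u _; rewrite dF /= fctE mulr1.
- by rewrite -subr_ge0 opprK addr_ge0 ?ltW.
- by move=> x y _ _ xy; rewrite /F ltrD2r.
- by rewrite dF => x _; exact: cst_continuous.
- by rewrite dF; exact: is_cvg_cst.
- by rewrite dF; exact: is_cvg_cst.
- split.
  + by move=> x _; exact: derivableD.
  + by apply: cvg_at_right_filter; apply: cvgD; [exact: cvg_id|exact: cvg_cst].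
  + by apply: cvg_at_left_filter; apply: cvgD; [exact: cvg_id|exact: cvg_cst].
- by apply: continuous_subspaceT; exact: continuous_normal_fun.
Qed.

(** Translating a centred normal law by [b] and by [- b] multiplies its density by
    [expR (- b ^+ 2 / (2 * s ^+ 2))] times [expR (- k)] and [expR k], and these
    two factors add up to at least 2. A single one may be small, according to the
    sign of [k]. *)
Lemma le_normal_window (s a b r : R) : s != 0 -> 0 < a ->
  2 * expR (- (b ^+ 2 / (2 * s ^+ 2))) *
    \int[normal_prob 0 s]_y (\1_`[0 - a, 0 + a] (r + y) : R) <=
  \int[normal_prob 0 s]_y (\1_`[b - a, b + a] (r + y) : R) +
  \int[normal_prob 0 s]_y (\1_`[- b - a, - b + a] (r + y) : R).
Proof.
move=> s0 a0; rewrite -!/(window _ _ _ _) !windowE// mulrCA -mulrDr.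
rewrite ler_wpM2l ?normal_peak_ge0//.
have int e : mu.-integrable `[- a, a] (EFin \o (fun u => normal_fun 0 s (u + e))).
  apply: continuous_compact_integrable; first exact: segment_compact.
  apply: continuous_subspaceT => u.
  apply: (@continuous_comp _ _ _ (fun u => u + e) (normal_fun 0 s)).
    by apply: cvgD; [exact: cvg_id|exact: cvg_cst].
  exact: continuous_normal_fun.
have mI : measurable (`[- a, a]%classic : set (measurableTypeR R)) by exact: measurable_itv.
rewrite -RintegralZl// -RintegralD//; apply: le_Rintegral => //.
- have := integrableZl mI (2 * expR (- (b ^+ 2 / (2 * s ^+ 2)))) (int (0 - r)).
  exact: eq_integrable.
- have := integrableD mI (int (b - r)) (int (- b - r)).
  exact: eq_integrable.
move=> u _; set v := u + (0 - r).
have -> : u + (b - r) = v + b by rewrite /v; ring.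
have -> : u + (- b - r) = v - b by rewrite /v; ring.
pose k := v * b / s ^+ 2.
have e1 : normal_fun 0 s (v + b) = expR (- (b ^+ 2 / (2 * s ^+ 2))) * normal_fun 0 s v * expR (- k).
  rewrite /normal_fun -!expRD /k -[s ^+ 2 *+ 2]mulr_natr; congr expR; field.
  by rewrite s0.
have e2 : normal_fun 0 s (v - b) = expR (- (b ^+ 2 / (2 * s ^+ 2))) * normal_fun 0 s v * expR k.
  rewrite /normal_fun -!expRD /k -[s ^+ 2 *+ 2]mulr_natr; congr expR; field.
  by rewrite s0.
rewrite e1 e2 -mulrDr -mulrA mulrC ler_wpM2l//.
  by rewrite mulr_ge0 ?expR_ge0 ?normal_fun_ge0.
have := expR_ge1Dx k; have := expR_ge1Dx (- k); lra.
Qed.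

End normal_shift.

(** * Integrals of bounded functions *)

Lemma bounded_measurable_cst d (T : measurableType d) (R : realType) (c : R) :
  bounded_measurable (fun _ : T => c).
Proof. by split => //; exists `|c|. Qed.

Section bounded_integration.
Context d (T : measurableType d) (R : realType) (mu : {measure set T -> \bar R}).
Hypothesis mufin : (mu setT < +oo)%E.

Lemma bounded_measurable_integrable (f : T -> R) :
  bounded_measurable f -> mu.-integrable setT (EFin \o f).
Proof.
move=> [mf [M fM]]; apply: measurable_bounded_integrable => //.
exists M; split; first exact: num_real.
by move=> x Mx y _; apply: (le_trans (fM y)); exact: ltW.
Qed.

Lemma bounded_measurable_comp (h : R -> R) (U : T -> R) :
  bounded_measurable h -> measurable_fun setT U -> bounded_measurable (h \o U).
Proof.
move=> [mh [M hM]] mU; split; first exact: measurableT_comp.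
by exists M => x; exact: hM.
Qed.

Lemma cvg_Rintegral_bounded (f_ : nat -> T -> R) (f : T -> R) (M : R) :
  (forall n, measurable_fun setT (f_ n)) -> (forall n x, `|f_ n x| <= M) ->
  (forall x, f_ n x @[n --> \oo] --> f x) ->
  \int[mu]_x f_ n x @[n --> \oo] --> \int[mu]_x f x.
Proof.
move=> mf_ f_M f_f.
have mf : measurable_fun setT f.
  by apply: (measurable_fun_cvg mf_) => x _; exact: f_f.
have fM x : `|f x| <= M.
  rewrite -(cvg_lim (@Rhausdorff R) (cvg_norm (f_f x))).
  by apply: limr_le; [exact: cvgP (cvg_norm (f_f x))|exact: nearW].
apply: fine_cvg; rewrite fineK; last first.
  apply: integrable_fin_num => //.
  by apply: bounded_measurable_integrable; split => //; exists M.
apply: (@dominated_cvg _ _ _ mu setT measurableT (fun n x => (f_ n x)%:E) _ (EFin \o cst M)).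
- by move=> n; exact/measurable_EFinP.
- by move=> x _; apply: cvg_EFin; [exact: nearW|exact: f_f].
- by [].
- by apply: bounded_measurable_integrable; split => //; exists `|M|.
- by move=> n x _; rewrite lee_fin f_M.
Qed.

Lemma continuous_functional_weighted (X U : T -> R) :
  bounded_measurable X -> measurable_fun setT U ->
  continuous_functional (fun h => \int[mu]_x (X x * h (U x))).
Proof.
move=> bX mU; split.
- move=> a h k bh bk.
  have bhU := bounded_measurableM bX (bounded_measurable_comp bh mU).
  have bkU := bounded_measurableM bX (bounded_measurable_comp bk mU).
  have ihU := bounded_measurable_integrable bhU.
  have ikU := bounded_measurable_integrable bkU.
  rewrite -RintegralZl// -RintegralD//.
    by apply: eq_Rintegral => x _; rewrite mulrDr mulrCA.
  by have := integrableZl measurableT a ihU; exact: eq_integrable.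
- move=> h_ h M mh hM hc; have [mX [N XN]] := bX.
  apply: (@cvg_Rintegral_bounded _ _ (N * M)).
  + by move=> n; apply: measurable_funM => //; exact: measurableT_comp.
  + by move=> n x; rewrite normrM ler_pM.
  + by move=> x; apply: cvgM; [exact: cvg_cst|exact: hc].
Qed.

End bounded_integration.

Lemma Rintegral_sum d (T : measurableType d) (R : realType)
    (mu : {measure set T -> \bar R}) (I : Type) (s : seq I) (f : I -> T -> R) :
  (forall i, mu.-integrable setT (EFin \o f i)) ->
  mu.-integrable setT (EFin \o (fun x => \sum_(i <- s) f i x)) /\
  \int[mu]_x (\sum_(i <- s) f i x) = \sum_(i <- s) \int[mu]_x f i x.
Proof.
move=> intf; elim: s => [|i s [IH1 IH2]].
  split; last by rewrite big_nil; under eq_Rintegral do rewrite big_nil; rewrite /Rintegral integral0.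
  by apply: eq_integrable (integrable0 mu _) => // x _; rewrite /= big_nil.
have E : (fun x => \sum_(j <- i :: s) f j x) = (fun x => f i x + \sum_(j <- s) f j x).
  by apply/funext => x; rewrite big_cons.
rewrite E; split.
  by have := integrableD measurableT (intf i) IH1; exact: eq_integrable.
by rewrite RintegralD// IH2 big_cons.
Qed.

Lemma probability_setT_lty d (T : measurableType d) (R : realType)
  (P : probability T R) : (P setT < +oo)%E.
Proof. by rewrite probability_setT ltry. Qed.

Section Rintegral_fubini.
Context d1 d2 (T1 : measurableType d1) (T2 : measurableType d2) (R : realType).
Variables (m1 : {sigma_finite_measure set T1 -> \bar R})
  (m2 : {sigma_finite_measure set T2 -> \bar R}) (f : T1 * T2 -> R).
Hypothesis intf : (m1 \x m2)%E.-integrable setT (EFin \o f).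

Lemma Rintegral12_prod :
  (forall x, m2.-integrable setT (fun y => (f (x, y))%:E)) ->
  \int[m1]_x \int[m2]_y f (x, y) = \int[(m1 \x m2)%E]_z f z.
Proof.
move=> int2; rewrite /Rintegral -(integral12_prod_meas1 intf); congr fine.
apply: eq_integral => x _; rewrite fineK//.
exact: integrable_fin_num.
Qed.

Lemma Rintegral21_prod :
  (forall y, m1.-integrable setT (fun x => (f (x, y))%:E)) ->
  \int[m2]_y \int[m1]_x f (x, y) = \int[(m1 \x m2)%E]_z f z.
Proof.
move=> int1; rewrite /Rintegral -(integral21_prod_meas1 intf); congr fine.
apply: eq_integral => y _; rewrite fineK//.
exact: integrable_fin_num.
Qed.

End Rintegral_fubini.

Section bounded_fubini.
Context d1 d2 (T1 : measurableType d1) (T2 : measurableType d2) (R : realType).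
Variables (m1 : probability T1 R) (m2 : probability T2 R) (f : T1 * T2 -> R).
Hypothesis bf : bounded_measurable f.

Lemma prod_probability_setT : ((m1 \x m2)%E setT < +oo)%E.
Proof.
rewrite -setXTT product_measure1E//.
by rewrite [X in (X * _)%E](probability_setT m1) [X in (_ * X)%E](probability_setT m2) mule1 ltry.
Qed.

Lemma bounded_Rintegral12 :
  \int[m1]_x \int[m2]_y f (x, y) = \int[(m1 \x m2)%E]_z f z.
Proof.
apply: Rintegral12_prod.
  by apply: bounded_measurable_integrable => //; exact: prod_probability_setT.
move=> x; apply: (@bounded_measurable_integrable _ _ _ m2 _ (fun y => f (x, y))).
  exact: probability_setT_lty.
have [mf [M fM]] := bf; split; last by exists M.
exact: measurableT_comp.
Qed.

Lemma bounded_Rintegral21 :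
  \int[m2]_y \int[m1]_x f (x, y) = \int[(m1 \x m2)%E]_z f z.
Proof.
apply: Rintegral21_prod.
  by apply: bounded_measurable_integrable => //; exact: prod_probability_setT.
move=> y; apply: (@bounded_measurable_integrable _ _ _ m1 _ (fun x => f (x, y))).
  exact: probability_setT_lty.
have [mf [M fM]] := bf; split; last by exists M.
exact: measurableT_comp.
Qed.

End bounded_fubini.

(** * Small balls of Gaussian families *)

Section gaussian_family.
Context d (T : measurableType d) (R : realType) (P : probability T R).
Variables (m : nat) (Z : 'I_m -> T -> R) (K : 'M[R]_m).
Hypothesis mZ : forall k, measurable_fun setT (Z k).
Hypothesis Ksym : K^T = K.

Definition lin_comb (u : 'rV[R]_m) (w : T) : R := \sum_k u ord0 k * Z k w.

Definition cov_form (u v : 'rV[R]_m) : R := (u *m K *m v^T) ord0 ord0.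

(* Joint normality with covariance matrix [K], in terms of cosine transforms. *)
Hypothesis charfun : forall u t,
  \int[P]_w cos (lin_comb u w + t) = cos t * expR (- (cov_form u u / 2)).

Lemma lin_combD u v w : lin_comb (u + v) w = lin_comb u w + lin_comb v w.
Proof. by rewrite -big_split/=; apply: eq_bigr => k _; rewrite mxE mulrDl. Qed.

Lemma lin_combZ a u w : lin_comb (a *: u) w = a * lin_comb u w.
Proof. by rewrite mulr_sumr; apply: eq_bigr => k _; rewrite mxE mulrA. Qed.

Lemma measurable_lin_comb u : measurable_fun setT (lin_comb u).
Proof. by apply: measurable_sum => k; exact: measurable_funM. Qed.

Lemma cov_formC u v : cov_form u v = cov_form v u.
Proof.
by rewrite /cov_form -[in LHS](trmxK (_ *m v^T)) mxE !trmx_mul trmxK Ksym mulmxA.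
Qed.

Lemma cov_formDr u v v' : cov_form u (v + v') = cov_form u v + cov_form u v'.
Proof. by rewrite /cov_form linearD mulmxDr mxE. Qed.

Lemma cov_formZr a u v : cov_form u (a *: v) = a * cov_form u v.
Proof. by rewrite /cov_form linearZ -scalemxAr mxE. Qed.

Lemma cov_formDl u u' v : cov_form (u + u') v = cov_form u v + cov_form u' v.
Proof. by rewrite cov_formC cov_formDr !(cov_formC v). Qed.

Lemma cov_formZl a u v : cov_form (a *: u) v = a * cov_form u v.
Proof. by rewrite cov_formC cov_formZr cov_formC. Qed.

(** Indicator of the event that all the combinations in [vs] lie in [[- a, a]].
    The bounds are written [0 - a] and [0 + a] to be instances of [c - a] and
    [c + a], the form of the intervals in [functional_eq_itv]. *)
Let boxes (a : R) (vs : seq 'rV[R]_m) (w : T) : R :=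
  \prod_(v <- vs) \1_`[0 - a, 0 + a] (lin_comb v w).

Lemma bounded_measurable_indic_itv (i : interval R) :
  bounded_measurable (\1_[set` i] : R -> R).
Proof.
split; first by apply: measurable_indic; exact: measurable_itv.
by exists 1 => x; rewrite indicE; case: (_ \in _); rewrite ?normr0 ?normr1.
Qed.

Let bounded_measurable_boxes a vs : bounded_measurable (boxes a vs).
Proof.
elim: vs => [|v vs [mb [M bM]]].
  rewrite /boxes; under eq_fun do rewrite big_nil.
  by split => //; exists 1 => w; rewrite normr1.
have := bounded_measurableM (bounded_measurable_comp
  (bounded_measurable_indic_itv `[0 - a, 0 + a]) (measurable_lin_comb v))
  (conj mb (ex_intro _ M bM)).
by rewrite /boxes /=; under [X in _ -> bounded_measurable X]eq_fun do rewrite big_cons.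
Qed.

Let bounded_measurable_cos_comb u (t : R) :
  bounded_measurable (fun w => cos (lin_comb u w + t)).
Proof.
have := bounded_measurable_comp (bounded_measurable_cos 1 t) (measurable_lin_comb u).
by under eq_fun do rewrite /= mul1r.
Qed.

Let integrable_boxes_cos a vs u (t : R) :
  P.-integrable setT (fun w => (boxes a vs w * cos (lin_comb u w + t))%:E).
Proof.
apply: (@bounded_measurable_integrable _ _ _ P _
  (fun w => boxes a vs w * cos (lin_comb u w + t))).
  exact: probability_setT_lty.
exact: bounded_measurableM.
Qed.

Let Rintegral_boxes_cosM a vs u v (t s : R) :
  \int[P]_w (boxes a vs w * cos (lin_comb u w + t) * cos (lin_comb v w + s)) =
  2^-1 * \int[P]_w (boxes a vs w * cos (lin_comb (u + v) w + (t + s))) +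
  2^-1 * \int[P]_w (boxes a vs w * cos (lin_comb (u + (-1) *: v) w + (t - s))).
Proof.
have i1 := integrable_boxes_cos a vs (u + v) (t + s).
have i2 := integrable_boxes_cos a vs (u + (-1) *: v) (t - s).
rewrite -!RintegralZl// -RintegralD//.
- apply: eq_Rintegral => w _; rewrite -mulrA cosMcos !lin_combD lin_combZ.
  have -> : lin_comb u w + lin_comb v w + (t + s) = lin_comb u w + t + (lin_comb v w + s) by ring.
  have -> : lin_comb u w + -1 * lin_comb v w + (t - s) = lin_comb u w + t - (lin_comb v w + s) by ring.
  by ring.
- by have := integrableZl measurableT 2^-1 i1; exact: eq_integrable.
- by have := integrableZl measurableT 2^-1 i2; exact: eq_integrable.
Qed.

(** Independence of [g] from the event defined by [vs] and from [u]. Induction on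
    [vs]: seen as functionals of a function of the next combination [v], the two
    sides agree on cosines, by the induction hypothesis for [u + s *: v] and
    [u - s *: v], hence on indicators of intervals. This is why the free
    combination [u] is carried along. *)
Lemma Rintegral_boxes_indep a vs g u (t : R) : 0 < a ->
  (forall v, v \in vs -> cov_form g v = 0) -> cov_form g u = 0 ->
  \int[P]_w (boxes a vs w * cos (lin_comb (g + u) w + t)) =
  expR (- (cov_form g g / 2)) * \int[P]_w (boxes a vs w * cos (lin_comb u w + t)).
Proof.
move=> a0; elim: vs u t => [|v vs IH] u t orth gu.
  rewrite /boxes; under eq_Rintegral do rewrite big_nil mul1r.
  under [in RHS]eq_Rintegral do rewrite big_nil mul1r.
  rewrite !charfun cov_formDr !cov_formDl (cov_formC u g) gu addr0 add0r.
  by rewrite mulrDl opprD expRD; ring.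
have gv : cov_form g v = 0 by rewrite orth// mem_head.
have orth' v' : v' \in vs -> cov_form g v' = 0.
  by move=> v'vs; rewrite orth// in_cons v'vs orbT.
have boxesE f : \int[P]_w (boxes a (v :: vs) w * f w) =
    \int[P]_w (boxes a vs w * f w * \1_`[0 - a, 0 + a] (lin_comb v w)).
  by apply: eq_Rintegral => w _; rewrite /boxes big_cons; ring.
have bm u' s : bounded_measurable (fun w => boxes a vs w * cos (lin_comb u' w + s)).
  exact: bounded_measurableM.
have int' u' h : bounded_measurable h -> P.-integrable setT
    (fun w => (boxes a vs w * cos (lin_comb u' w + t) * h (lin_comb v w))%:E).
  move=> bh; apply: (@bounded_measurable_integrable _ _ _ P _
    (fun w => boxes a vs w * cos (lin_comb u' w + t) * h (lin_comb v w))).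
    exact: probability_setT_lty.
  apply: bounded_measurableM => //; apply: bounded_measurable_comp => //.
  exact: measurable_lin_comb.
rewrite 2!boxesE.
have mv := measurable_lin_comb v.
have F1 := continuous_functional_weighted (probability_setT_lty P) (bm (g + u) t) mv.
have F2 := continuous_functional_weighted (probability_setT_lty P)
  (bounded_measurableM (bounded_measurable_cst T (expR (- (cov_form g g / 2)))) (bm u t)) mv.
rewrite (functional_eq_itv 0 F1 F2 _ a0).
  rewrite -RintegralZl//; first by apply: eq_Rintegral => w _; ring.
  exact: (int' u _ (bounded_measurable_indic_itv _)).
move=> s r.
have -> : \int[P]_w (expR (- (cov_form g g / 2)) * (boxes a vs w * cos (lin_comb u w + t)) *
      cos (s * lin_comb v w + r)) = expR (- (cov_form g g / 2)) *
   \int[P]_w (boxes a vs w * cos (lin_comb u w + t) * cos (lin_comb (s *: v) w + r)).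
  rewrite -RintegralZl//; first by apply: eq_Rintegral => w _; rewrite lin_combZ; ring.
  have := int' u _ (bounded_measurable_cos s r).
  by apply: eq_integrable => // w _; rewrite /= lin_combZ.
transitivity (\int[P]_w (boxes a vs w * cos (lin_comb (g + u) w + t) *
    cos (lin_comb (s *: v) w + r))).
  by apply: eq_Rintegral => w _; rewrite lin_combZ.
rewrite !Rintegral_boxes_cosM -!addrA !IH//; first ring.
- by rewrite cov_formDr !cov_formZr gv gu !mulr0 addr0.
- by rewrite cov_formDr !cov_formZr gv gu !mulr0 addr0.
Qed.

Let bounded_measurable_prod_boxes a vs r (h : R -> R) : bounded_measurable h ->
  bounded_measurable
    (fun z : T * measurableTypeR R => boxes a vs z.1 * h (lin_comb r z.1 + z.2)).
Proof.
move=> bh; apply: bounded_measurableM.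
  have [mb [M bM]] := bounded_measurable_boxes a vs.
  by split; [exact: measurableT_comp|exists M => z].
apply: bounded_measurable_comp => //; apply: measurable_funD => //.
by apply: measurableT_comp => //; exact: measurable_lin_comb.
Qed.

(** By independence [g] may be replaced by an independent centred normal variable
    [y] of the same variance, integrated first. *)
Lemma Rintegral_boxes_window a vs g r c : 0 < a -> 0 < cov_form g g ->
  (forall v, v \in vs -> cov_form g v = 0) -> cov_form g r = 0 ->
  \int[P]_w (boxes a vs w * \1_`[c - a, c + a] (lin_comb (g + r) w)) =
  \int[P]_w (boxes a vs w * \int[normal_prob 0 (Num.sqrt (cov_form g g))]_y
    (\1_`[c - a, c + a] (lin_comb r w + y) : R)).
Proof.
move=> a0 g0 orth gr; set s := Num.sqrt _.
have s0 : s != 0 by rewrite gt_eqF// sqrtr_gt0.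
pose N : probability (measurableTypeR R) R := normal_prob 0 s.
pose X2 (z : T * measurableTypeR R) := boxes a vs z.1.
pose U2 (z : T * measurableTypeR R) := lin_comb r z.1 + z.2.
have bX2 : bounded_measurable X2.
  have [mb [M bM]] := bounded_measurable_boxes a vs.
  by split; [exact: measurableT_comp|exists M => z; exact: bM].
have mU2 : measurable_fun setT U2.
  apply: measurable_funD => //.
  by apply: measurableT_comp => //; exact: measurable_lin_comb.
have F1 := continuous_functional_weighted (probability_setT_lty P)
  (bounded_measurable_boxes a vs) (measurable_lin_comb (g + r)).
have F2 := continuous_functional_weighted (prod_probability_setT P N) bX2 mU2.
have iter h : bounded_measurable h -> \int[(P \x N)%E]_z (X2 z * h (U2 z)) =
    \int[P]_w (boxes a vs w * \int[N]_y h (lin_comb r w + y)).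
  move=> bh; rewrite -(bounded_Rintegral12 P N (bounded_measurable_prod_boxes a vs r bh)); apply: eq_Rintegral => w _.
  rewrite -RintegralZl//.
  apply: (@bounded_measurable_integrable _ _ _ N _ (fun y => h (lin_comb r w + y))).
    exact: probability_setT_lty.
  by apply: bounded_measurable_comp => //; exact: measurable_funD.
rewrite (functional_eq_itv c F1 F2 _ a0).
  exact: iter (bounded_measurable_indic_itv _).
move=> u t; rewrite (iter (fun x => cos (u * x + t)) (bounded_measurable_cos u t)).
transitivity (\int[P]_w (boxes a vs w * cos (lin_comb (u *: g + u *: r) w + t))).
  by apply: eq_Rintegral => w _; rewrite -scalerDr lin_combZ.
rewrite Rintegral_boxes_indep//; last 2 first.
- by move=> v vvs; rewrite cov_formZl orth// mulr0.
- by rewrite cov_formZr cov_formZl gr !mulr0.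
rewrite cov_formZr cov_formZl -RintegralZl//; last exact: integrable_boxes_cos.
apply: eq_Rintegral => w _.
have E y : u * (lin_comb r w + y) + t = u * y + (lin_comb (u *: r) w + t).
  by rewrite lin_combZ; ring.
under [in RHS]eq_Rintegral do rewrite E.
rewrite Rintegral_cos_normal_prob// mulr0 add0r sqr_sqrtr; last exact: ltW.
have -> : cov_form g g * u ^+ 2 / 2 = u * (u * cov_form g g) / 2 by ring.
by ring.
Qed.

(** [le_normal_window] for the conditional law of [g + r] given [r] and the
    event. *)
Lemma le_boxes_shift a vs g r b : 0 < a -> 0 < cov_form g g ->
  (forall v, v \in vs -> cov_form g v = 0) -> cov_form g r = 0 ->
  2 * expR (- (b ^+ 2 / (2 * cov_form g g))) *
    \int[P]_w (boxes a vs w * \1_`[0 - a, 0 + a] (lin_comb (g + r) w)) <=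
  \int[P]_w (boxes a vs w * (\1_`[b - a, b + a] (lin_comb (g + r) w) +
                             \1_`[- b - a, - b + a] (lin_comb (g + r) w))).
Proof.
move=> a0 g0 orth gr; set s := Num.sqrt (cov_form g g).
have s0 : s != 0 by rewrite gt_eqF// sqrtr_gt0.
pose W c w := \int[normal_prob 0 s]_y (\1_`[c - a, c + a] (lin_comb r w + y) : R).
have int1 c : P.-integrable setT
    (fun w => (boxes a vs w * \1_`[c - a, c + a] (lin_comb (g + r) w))%:E).
  apply: (@bounded_measurable_integrable _ _ _ P _
    (fun w => boxes a vs w * \1_`[c - a, c + a] (lin_comb (g + r) w))).
    exact: probability_setT_lty.
  apply: bounded_measurableM => //; apply: bounded_measurable_comp.
    exact: bounded_measurable_indic_itv.
  exact: measurable_lin_comb.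
have intW c : P.-integrable setT (fun w => (boxes a vs w * W c w)%:E).
  have bN := bounded_measurable_prod_boxes a vs r (bounded_measurable_indic_itv `[c - a, c + a]).
  have intN := bounded_measurable_integrable
    (prod_probability_setT P (normal_prob 0 s : probability (measurableTypeR R) R)) bN.
  have := integrable_fubini_F intN; apply: eq_integrable => // w _.
  rewrite /fubini_F /W -RintegralZl//.
    rewrite /Rintegral fineK//; apply: integrable_fin_num => //.
    apply: (@bounded_measurable_integrable _ _ _ (normal_prob 0 s : probability (measurableTypeR R) R)
      _ (fun y => boxes a vs w * \1_`[c - a, c + a] (lin_comb r w + y))).
      exact: probability_setT_lty.
    apply: bounded_measurableM; first exact: bounded_measurable_cst.
    exact: bounded_measurable_comp (bounded_measurable_indic_itv _) (measurable_funD _ _).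
  apply: (@bounded_measurable_integrable _ _ _ (normal_prob 0 s : probability (measurableTypeR R) R)
    _ (fun y => \1_`[c - a, c + a] (lin_comb r w + y))).
    exact: probability_setT_lty.
  exact: bounded_measurable_comp (bounded_measurable_indic_itv _) (measurable_funD _ _).
have -> : \int[P]_w (boxes a vs w * (\1_`[b - a, b + a] (lin_comb (g + r) w) +
      \1_`[- b - a, - b + a] (lin_comb (g + r) w))) =
    \int[P]_w (boxes a vs w * W b w) + \int[P]_w (boxes a vs w * W (- b) w).
  rewrite -!Rintegral_boxes_window// -RintegralD//; [|exact: int1..].
  by apply: eq_Rintegral => w _; rewrite mulrDr.
have -> := Rintegral_boxes_window 0 a0 g0 orth gr; rewrite -/s.
rewrite -[X in _ * X]/(\int[P]_w (boxes a vs w * W 0 w)).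
rewrite -(RintegralZl _ measurableT (intW 0)).
rewrite -(RintegralD measurableT (intW b) (intW (- b))); apply: le_Rintegral.
- exact: measurableT.
- by have := integrableZl measurableT (2 * expR (- (b ^+ 2 / (2 * cov_form g g)))) (intW 0); exact: eq_integrable.
- by have := integrableD measurableT (intW b) (intW (- b)); exact: eq_integrable.
move=> w _; rewrite mulrCA -mulrDr; apply: ler_wpM2l.
  by apply: prodr_ge0 => v _; rewrite indicE.
have := le_normal_window b (lin_comb r w) s0 a0.
by rewrite sqr_sqrtr// ltW.
Qed.

(** Translate the box [[- a, a] ^ N] by [3 a e_i] and by [- 3 a e_i]: the [2 N]
    boxes obtained are disjoint, and the two with the same [i] have together at
    least [2 * expR (- 9 a ^+ 2 / (2 v))] times the probability of the box, by
    [le_boxes_shift]. The vector [g_ i] is the part of [w_ i] that can be moved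
    independently of the other coordinates and of the rest of [w_ i]. *)
Lemma small_ball (N : nat) (w_ g_ : 'I_N -> 'rV[R]_m) (a v : R) : 0 < a -> 0 < v ->
  (forall i, v <= cov_form (g_ i) (g_ i)) ->
  (forall i j, j != i -> cov_form (g_ i) (w_ j) = 0) ->
  (forall i, cov_form (g_ i) (w_ i - g_ i) = 0) ->
  2 * N%:R * expR (- (9 * a ^+ 2 / (2 * v))) *
    \int[P]_w (\prod_(i < N) \1_`[0 - a, 0 + a] (lin_comb (w_ i) w) : R) <= 1.
Proof.
move=> a0 v0 vg orth orthi.
pose S i := [seq w_ j | j <- enum 'I_N & j != i].
have boxesS i w : boxes a (S i) w = \prod_(j | j != i) \1_`[0 - a, 0 + a] (lin_comb (w_ j) w).
  by rewrite /boxes big_map big_filter big_enum_cond.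
pose X i w : R := boxes a (S i) w * (\1_`[3 * a - a, 3 * a + a] (lin_comb (w_ i) w) +
                                \1_`[- (3 * a) - a, - (3 * a) + a] (lin_comb (w_ i) w)).
have bX i : bounded_measurable (X i).
  apply: bounded_measurableM => //.
  have b c := bounded_measurable_comp (bounded_measurable_indic_itv `[c - a, c + a])
    (measurable_lin_comb (w_ i)).
  have := bounded_measurable_lin 1 (b (3 * a)) (b (- (3 * a))).
  by under [in X in X -> _]eq_fun do rewrite mul1r.
have iX i : P.-integrable setT (fun w => (X i w)%:E).
  by apply: (@bounded_measurable_integrable _ _ _ P _ (X i)) => //; exact: probability_setT_lty.
set q := \int[P]_w _.
have q0 : 0 <= q.
  by apply: Rintegral_ge0 => w _; apply: prodr_ge0 => i _; rewrite indicE.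
have step i : 2 * expR (- (9 * a ^+ 2 / (2 * v))) * q <= \int[P]_w X i w.
  have gi0 := lt_le_trans v0 (vg i).
  have orthS u : u \in S i -> cov_form (g_ i) u = 0.
    by move=> /mapP[j]; rewrite mem_filter => /andP[ji _] ->; exact: orth.
  have := le_boxes_shift (3 * a) a0 gi0 orthS (orthi i).
  rewrite [g_ i + _]addrC subrK; apply: le_trans.
  have -> : q = \int[P]_w (boxes a (S i) w * \1_`[0 - a, 0 + a] (lin_comb (w_ i) w)).
    by apply: eq_Rintegral => w _; rewrite boxesS (bigD1 i)//= mulrC.
  apply: ler_wpM2r.
    by apply: Rintegral_ge0 => w _; rewrite mulr_ge0 ?indicE//; apply: prodr_ge0 => j _; rewrite indicE.
  rewrite ler_wpM2l// ler_expR lerN2.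
  have -> : (3 * a) ^+ 2 = 9 * a ^+ 2 by ring.
  apply: ler_wpM2l; first by rewrite mulr_ge0// exprn_ge0// ltW.
  by rewrite lef_pV2 ?posrE ?mulr_gt0// ler_wpM2l.
have sumX : \sum_(i < N) \int[P]_w X i w <= 1.
  have [intX <-] := Rintegral_sum (index_enum 'I_N) iX.
  have <- : \int[P]_w (cst 1 w) = 1.
    by rewrite Rintegral_cst// mul1r [X in fine X](probability_setT P).
  apply: le_Rintegral => //.
    apply: (@bounded_measurable_integrable _ _ _ P _ (fun=> 1)); last exact: bounded_measurable_cst.
    exact: probability_setT_lty.
  move=> w _; rewrite /cst.
  pose k i : R := \1_`[0 - a, 0 + a] (lin_comb (w_ i) w).
  pose t i : R := \1_`[3 * a - a, 3 * a + a] (lin_comb (w_ i) w) +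
                  \1_`[- (3 * a) - a, - (3 * a) + a] (lin_comb (w_ i) w).
  have XE i : X i w = (\prod_(j | j != i) k j) * t i by rewrite /X boxesS.
    (* [t i] is the indicator of two windows disjoint from each other and from the
     window of [k i], because [2 a > a]. *)
have [t1 kt] : (forall i, t i <= 1) /\ (forall i, k i != 0 -> t i = 0).
    split=> i; rewrite /t /k !indicE !mem_setE !in_itv/=; set x := lin_comb _ _.
      by case: andP => [[h1 h2]|_]; case: andP => [[h3 h4]|_]; rewrite ?addr0 ?add0r//; lra.
    have [/andP[h1 h2] _|_] := boolP (0 - a <= x <= 0 + a); last by rewrite eqxx.
    by case: andP => [[h3 h4]|_]; case: andP => [[h5 h6]|_]; rewrite ?addr0//; lra.
  have k01 i : 0 <= k i <= 1.
    by rewrite /k indicE; case: (_ \in _); rewrite ?lexx ?ler01.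
  have [[i ki]|allk] := pselect (exists i, k i = 0).
    rewrite (bigD1 i)//= big1 ?addr0 => [|j ji].
      rewrite XE; apply: le_trans (t1 i); rewrite ler_piMl//.
        by rewrite /t !indicE addr_ge0.
      by apply: prodr_ile1 => j _; exact: k01.
    by rewrite XE (bigD1 i) 1?eq_sym//= ki !mul0r.
  rewrite big1 ?ler01// => i _; rewrite XE kt ?mulr0//.
  by apply/eqP => ki; apply: allk; exists i.
apply: le_trans sumX.
have -> : 2 * N%:R * expR (- (9 * a ^+ 2 / (2 * v))) * q =
    \sum_(i < N) (2 * expR (- (9 * a ^+ 2 / (2 * v))) * q).
  by rewrite sumr_const card_ord -mulr_natr; ring.
exact: ler_sum.
Qed.

End gaussian_family.

(** * Characteristic function of a Gaussian variable in terms of its moments *)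

Section gaussian_law_characteristic_function.
Context d (T : measurableType d) (R : realType) (P : probability T R).

(** The cosine form of the normal law of mean [m] and standard deviation [s],
    which includes the Dirac masses as the case [s = 0]. *)
Let cos_law (X : T -> R) (m s : R) := forall u t : R,
  \int[P]_w cos (u * X w + t) = cos (u * m + t) * expR (- (s ^+ 2 * u ^+ 2 / 2)).

(** Change of variables, for a law known through its values on measurable sets. *)
Lemma Rintegral_law (X : T -> R) (Q : {measure set (measurableTypeR R) -> \bar R}) (h : R -> R) :
  measurable_fun setT X -> bounded_measurable h ->
  (forall A : set (measurableTypeR R), measurable A -> P (X @^-1` A) = Q A) ->
  \int[P]_w h (X w) = \int[Q]_y h y.
Proof.
move=> mX bh law; rewrite /Rintegral; congr fine.
have mX' : measurable_fun setT (X : T -> measurableTypeR R) := mX.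
have mh : measurable_fun setT (EFin \o h : measurableTypeR R -> \bar R).
  by apply/measurable_EFinP; exact: bh.1.
have intX : P.-integrable (X @^-1` setT) ((EFin \o h) \o X).
  rewrite preimage_setT.
  exact: (bounded_measurable_integrable (probability_setT_lty P) (bounded_measurable_comp bh mX)).
rewrite -[LHS](integral_pushforward mX' mh intX measurableT).
by apply: eq_measure_integral => A mA _; exact: law.
Qed.

Lemma gaussian_law_cos (X : T -> R) : measurable_fun setT X -> gaussian_law P X ->
  exists m s : R, cos_law X m s.
Proof.
move=> mX [[m [s [s0 law]]]|[m law]].
  exists m, s => u t.
  rewrite (Rintegral_law mX (bounded_measurable_cos u t) law).
  by rewrite Rintegral_cos_normal_prob// gt_eqF.
exists m, 0 => u t.
rewrite (Rintegral_law (Q := @dirac _ (measurableTypeR R) m R) mX (bounded_measurable_cos u t) law).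
rewrite /Rintegral integral_dirac//; last by apply/measurable_EFinP; exact: measurable_cos_affine.
by rewrite diracT mul1e/= expr0n/= !mul0r oppr0 expR0 mulr1.
Qed.

Lemma cvg_scaled_onem_expR (c : R) : 0 <= c ->
  n.+1%:R ^+ 2 * (1 - expR (- (c / n.+1%:R ^+ 2))) @[n --> \oo] --> c.
Proof.
move=> c0.
have inv0 : (n.+1%:R ^+ 2)^-1 @[n --> \oo] --> (0 : R).
  rewrite -[X in _ --> X](mulr0 0); under eq_fun do rewrite -exprVn expr2.
  by apply: cvgM; exact: cvg_harmonic.
apply: (@squeeze_cvgr _ _ _ _ (fun n => c / (1 + c / n.+1%:R ^+ 2)) (cst c)).
- apply: nearW => n; have n0 : 0 < n.+1%:R ^+ 2 :> R by rewrite exprn_gt0.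
  set N := n.+1%:R ^+ 2 in n0 *; set y := c / N.
  have y0 : 0 <= y by rewrite divr_ge0// ltW.
  have -> : c = N * y by rewrite /y mulrCA divff ?mulr1// gt_eqF.
  rewrite -mulrA !ler_pM2l//; have h1 := expR_ge1Dx (- y); have h2 := expR_ge1Dx y.
  have ey : 0 < expR y by exact: expR_gt0.
  rewrite ler_pdivrMr; last by lra.
  have -> : expR (- y) = (expR y)^-1 by rewrite expRN.
  have iy : (expR y)^-1 * (1 + y) <= 1 by rewrite mulrC ler_pdivrMr// mul1r.
  apply/andP; split; last by rewrite -expRN; lra.
  by rewrite mulrBl mul1r; lra.
- rewrite -[X in _ --> X]divr1; apply: cvgM; first exact: cvg_cst.
  apply: cvgV => //; rewrite -[X in _ --> X]addr0; apply: cvgD; first exact: cvg_cst.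
  by rewrite -[X in _ --> X](mulr0 c); apply: cvgM; first exact: cvg_cst.
- exact: cvg_cst.
Qed.

Lemma normr_sin_le (x : R) : `|sin x| <= `|x|.
Proof.
have pos (y : R) : 0 <= y -> `|sin y| <= y.
  rewrite le_eqVlt => /predU1P[<-|y0]; first by rewrite sin0 normr0.
  have [y1|y1] := leP y 1.
    have /andP[s0 s1] : 0 < sin y < y by apply: sin_lt_id; rewrite y0.
    by rewrite ger0_norm ltW.
  by rewrite (le_trans (sin_max y))// ltW.
have [x0|x0] := leP 0 x; first by rewrite (ger0_norm x0) pos.
by rewrite -[X in _ <= X]normrN -[X in X <= _]normrN -sinN (@ger0_norm _ (- x)) ?pos ?oppr_ge0 ?ltW.
Qed.

(** Dominated convergence in [n * sin (X / n)], whose expectation tends to [E X]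
    and is also given by the cosine transform. *)
Lemma cos_law_mean (X : T -> R) m s : measurable_fun setT X -> cos_law X m s ->
  P.-integrable setT (EFin \o X) -> m = \int[P]_w X w.
Proof.
move=> mX cosX intX.
have lhs : n.+1%:R * \int[P]_w sin (X w / n.+1%:R) @[n --> \oo] --> \int[P]_w X w.
  have E n : n.+1%:R * \int[P]_w sin (X w / n.+1%:R) =
      \int[P]_w (n.+1%:R * sin (X w / n.+1%:R)).
    rewrite RintegralZl//.
    apply: (@bounded_measurable_integrable _ _ _ P _ (fun w => sin (X w / n.+1%:R))).
      exact: probability_setT_lty.
    split; last by exists 1 => w; exact: sin_max.
    apply: measurableT_comp; last exact: measurable_funM.
    exact: continuous_measurable_fun (@continuous_sin R).
  under eq_fun do rewrite E.
  apply: fine_cvg; rewrite fineK; last exact: integrable_fin_num.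
  apply: (@dominated_cvg _ _ _ P setT measurableT
    (fun n w => (n.+1%:R * sin (X w / n.+1%:R))%:E) _ (fun w => `|(X w)%:E|%E)).
  - move=> n; apply/measurable_EFinP; apply: measurable_funM => //.
    apply: measurableT_comp; last exact: measurable_funM.
    exact: continuous_measurable_fun (@continuous_sin R).
  - by move=> w _; apply: cvg_EFin; [exact: nearW|exact: cvg_scaled_sin].
  - by [].
  - exact: integrable_abse.
  - move=> n w _; rewrite lee_fin normrM normr_nat.
    rewrite (le_trans (ler_wpM2l _ (normr_sin_le _)))// normrM normfV normr_nat.
    by rewrite mulrC divfK.
have rhs : n.+1%:R * \int[P]_w sin (X w / n.+1%:R) @[n --> \oo] --> m.
  have E n : n.+1%:R * \int[P]_w sin (X w / n.+1%:R) =
      (n.+1%:R * sin (m / n.+1%:R)) * expR (- ((s ^+ 2 / 2) * (n.+1%:R^-1 * n.+1%:R^-1))).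
    rewrite -mulrA; congr (_ * _).
    under eq_Rintegral do rewrite -cosBpihalf mulrC.
    rewrite cosX (mulrC _ m) cosBpihalf; congr (_ * expR (- _)); rewrite exprVn; field; by rewrite nat1r pnatr_eq0.
  rewrite -[X in _ --> X]mulr1; under eq_fun do rewrite E.
  apply: cvgM; first exact: cvg_scaled_sin.
  rewrite -[X in _ --> X]expR0; apply: (@cvg_comp _ _ _ _ (@expR R)); last exact: continuous_expR.
  rewrite -oppr0; apply: cvgN; rewrite -[X in _ --> X](mulr0 (s ^+ 2 / 2)).
  apply: cvgM; first exact: cvg_cst.
  by rewrite -[X in _ --> X](mulr0 0); apply: cvgM; exact: cvg_harmonic.
exact: (cvg_unique _ rhs lhs).
Qed.

(** The same for [2 * n ^+ 2 * (1 - cos (X / n)) = (2 * n * sin (X / (2 * n))) ^+ 2],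
    which tends to [X ^+ 2] and is dominated by it. *)
Lemma cos_law_variance (X : T -> R) s : measurable_fun setT X -> cos_law X 0 s ->
  P.-integrable setT (fun w => (X w ^+ 2)%:E) -> s ^+ 2 = \int[P]_w (X w ^+ 2).
Proof.
move=> mX cosX intX.
pose f n w := (2 * (n.+1%:R * sin ((X w / 2) / n.+1%:R))) ^+ 2.
have fE n w : f n w = 2 * n.+1%:R ^+ 2 * (1 - cos (X w / n.+1%:R)).
  rewrite /f; have -> : X w / n.+1%:R = (X w / 2 / n.+1%:R) *+ 2.
    by rewrite -mulr_natr; field; rewrite nat1r pnatr_eq0.
  by rewrite cos_mulr2n cos2sin2; ring.
have mcos n : bounded_measurable (fun w => cos (X w / n.+1%:R)).
  split; last by exists 1 => w; exact: cos_max.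
  apply: measurableT_comp; last exact: measurable_funM.
  exact: continuous_measurable_fun (@continuous_cos R).
have lhs : \int[P]_w f n w @[n --> \oo] --> \int[P]_w (X w ^+ 2).
  apply: fine_cvg; rewrite fineK; last exact: integrable_fin_num.
  apply: (@dominated_cvg _ _ _ P setT measurableT
    (fun n w => (f n w)%:E) _ (fun w => (X w ^+ 2)%:E)).
  - move=> n; apply/measurable_EFinP; apply: measurable_funX; apply: measurable_funM => //.
    apply: measurable_funM => //.
    apply: measurableT_comp; first exact: continuous_measurable_fun (@continuous_sin R).
    by apply: measurable_funM => //; exact: measurable_funM.
  - move=> w _; apply: cvg_EFin; first exact: nearW.
    have -> : X w ^+ 2 = (2 * (X w / 2)) * (2 * (X w / 2)) by field.
    by apply: cvgM; apply: cvgM; (try exact: cvg_cst); exact: cvg_scaled_sin.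
  - by [].
  - exact: intX.
  - move=> n w _; rewrite lee_fin /f normrX -[leRHS]real_normK ?num_real//.
    rewrite lerXn2r ?nnegrE// !normrM !normr_nat.
    rewrite (le_trans (ler_wpM2l _ (ler_wpM2l _ (normr_sin_le _))))//.
    rewrite !normrM !normfV !normr_nat.
    rewrite (_ : 2 * _ = `|X w|)//; field; by rewrite nat1r pnatr_eq0.
have rhs : \int[P]_w f n w @[n --> \oo] --> s ^+ 2.
  have E n : \int[P]_w f n w = 2 * (n.+1%:R ^+ 2 * (1 - expR (- ((s ^+ 2 / 2) / n.+1%:R ^+ 2)))).
    under eq_Rintegral do rewrite fE.
    have i1 := bounded_measurable_integrable (probability_setT_lty P) (bounded_measurable_cst T (1 : R)).
    have i2 := bounded_measurable_integrable (probability_setT_lty P) (mcos n).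
    rewrite RintegralZl//; last by have := integrableB measurableT i1 i2; exact: eq_integrable.
    have H : \int[P]_w cos (X w / n.+1%:R) = expR (- ((s ^+ 2 / 2) / n.+1%:R ^+ 2)).
      have := cosX n.+1%:R^-1 0; rewrite mulr0 add0r cos0 mul1r exprVn mulrAC => <-.
      by apply: eq_Rintegral => w _; rewrite mulrC addr0.
    rewrite RintegralB// Rintegral_cst// [X in fine X](probability_setT P) H.
    by rewrite [fine _]/= mulr1 mulrA.
  rewrite -[X in _ --> X](divfK (_ : (2 : R) != 0) (s ^+ 2))// mulrC.
  under eq_fun do rewrite E.
  apply: cvgM; first exact: cvg_cst.
  by apply: cvg_scaled_onem_expR; rewrite divr_ge0// sqr_ge0.
exact: (cvg_unique _ rhs lhs).
Qed.

(** A Gaussian law comes with parameters unrelated to the moments of [X]. The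
    behaviour of its cosine transform near zero identifies them. *)
Lemma gaussian_law_charfun (X : T -> R) (t : R) :
  measurable_fun setT X -> gaussian_law P X ->
  P.-integrable setT (EFin \o X) -> P.-integrable setT (fun w => (X w ^+ 2)%:E) ->
  \int[P]_w X w = 0 ->
  \int[P]_w cos (X w + t) = cos t * expR (- ((\int[P]_w (X w ^+ 2)) / 2)).
Proof.
move=> mX gX i1 i2 mean0; have [m [s cosX]] := gaussian_law_cos mX gX.
have m0 : m = 0 by rewrite (cos_law_mean mX cosX i1).
rewrite m0 in cosX; rewrite -(cos_law_variance mX cosX i2).
have := cosX 1 t; rewrite mulr0 add0r expr1n mulr1 => <-.
by apply: eq_Rintegral => w _; rewrite mul1r.
Qed.

End gaussian_law_characteristic_function.

(** * A nonnegative band-limited function *)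

Section bounded_sections.
Context d1 d2 (T1 : measurableType d1) (T2 : measurableType d2) (R : realType).
Variables (m1 : probability T1 R) (m2 : probability T2 R).

Lemma normr_Rintegral_le (f : T2 -> R) (M : R) : measurable_fun setT f ->
  (forall y, `|f y| <= M) -> `|\int[m2]_y f y| <= M.
Proof.
move=> mf fM; have bf : bounded_measurable f by split => //; exists M.
have intf := bounded_measurable_integrable (probability_setT_lty m2) bf.
apply: (le_trans (le_normr_Rintegral measurableT intf)).
have <- : \int[m2]_y (cst M y) = M.
  by rewrite Rintegral_cst// [X in fine X](probability_setT m2) mulr1.
apply: le_Rintegral => //.
  by have := integrable_abse intf; exact: eq_integrable.
exact: (bounded_measurable_integrable (probability_setT_lty m2) (bounded_measurable_cst T2 M)).
Qed.

Lemma bounded_measurable_Rintegral (f : T1 * T2 -> R) : bounded_measurable f ->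
  bounded_measurable (fun x => \int[m2]_y f (x, y)).
Proof.
move=> bf; have [mf [M fM]] := bf.
split; last first.
  by exists M => x; apply: normr_Rintegral_le => // ; exact: measurableT_comp.
have intf := bounded_measurable_integrable (prod_probability_setT m1 m2) bf.
by have := measurable_fubini_F intf; exact: measurableT_comp.
Qed.

End bounded_sections.

Section sinc.
Variable R : realType.
Implicit Types (s t x : R).

Let U : probability (measurableTypeR R) R := uniform_prob (@ltr01 R).

(** The uniform law is a measure on the whole line; truncating its variable to the
    unit interval makes the bounds below hold everywhere, and not almost
    everywhere. *)
Let clip s : R := Num.max 0 (Num.min s 1).

Let clip_ge0 s : 0 <= clip s. Proof. by rewrite le_max lexx. Qed.

Let clip_le1 s : clip s <= 1.
Proof. by rewrite ge_max ler01/= ge_min lexx orbT. Qed.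

Let clip_id s : 0 <= s <= 1 -> clip s = s.
Proof. by move=> /andP[s0 s1]; rewrite /clip (min_idPl s1); exact/max_idPr. Qed.

Let measurable_clip : measurable_fun setT clip.
Proof. by apply: measurable_maxr => //; exact: measurable_minr. Qed.

(** [sin t / t], continuously extended, as a superposition of cosines of
    frequency at most one. *)
Definition sinc t := \int[U]_s cos (t * clip s).

Let measurable_cos_clip t : measurable_fun setT (fun s => cos (t * clip s)).
Proof.
apply: measurableT_comp; first exact: continuous_measurable_fun (@continuous_cos R).
exact: measurable_funM.
Qed.

Lemma normr_sinc_le1 t : `|sinc t| <= 1.
Proof.
apply: normr_Rintegral_le; first exact: measurable_cos_clip.
by move=> s; exact: cos_max.
Qed.

Lemma sincE t : t != 0 -> sinc t = sin t / t.
Proof.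
move=> t0.
have b : bounded_measurable (fun s => cos (t * clip s)).
  by split => //; exists 1 => s; exact: cos_max.
have i1 := bounded_measurable_integrable (probability_setT_lty U) (bounded_measurable_cst _ (1 : R)).
have i2 := bounded_measurable_integrable (probability_setT_lty U) b.
(* Adding 1 makes the integrand nonnegative, as [integral_uniform] asks. *)
have : \int[U]_s (1 + cos (t * clip s)) = 1 + sinc t.
  by rewrite RintegralD// Rintegral_cst// [X in fine X](probability_setT U) mul1r.
rewrite /Rintegral integral_uniform; last 2 first.
- by apply/measurable_EFinP; apply: measurable_funD => //; exact: measurable_cos_clip.
- by move=> s; rewrite lee_fin -lerBlDl sub0r cos_geN1.
rewrite subr0 invr1 mul1e.
have -> : (\int[lebesgue_measure]_(s in `[0%R, 1%R]) (1 + cos (t * clip s))%:E)%E =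
    (\int[lebesgue_measure]_(s in `[0%R, 1%R]) (1 + cos (t * s))%:E)%E.
  by apply: eq_integral => s; rewrite inE/= in_itv/= => s01; rewrite clip_id.
have ct : continuous (fun s => t * s) by move=> s; apply: cvgM; [exact: cvg_cst|exact: cvg_id].
pose F s := s + sin (t * s) / t.
have dF s : is_derive s 1 F (1 + cos (t * s)).
  by apply: is_derive_eq; rewrite /GRing.scale/=; field.
have cF s : F x @[x --> s] --> F s.
  by apply: differentiable_continuous; apply/derivable1_diffP; exact: ex_derive.
rewrite (@continuous_FTC2 R (fun s => 1 + cos (t * s)) F 0 1 ltr01).
- by rewrite -EFinB [fine _]/= /F mulr0 sin0 mul0r addr0 subr0 mulr1 => /addrI <-.
- apply: continuous_subspaceT => s; apply: cvgD; first exact: cvg_cst.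
  by apply: (@continuous_comp _ _ _ (fun s => t * s) cos); [exact: ct|exact: continuous_cos].
- split.
  + by move=> s _; exact: ex_derive.
  + by apply: cvg_at_right_filter; exact: cF.
  + by apply: cvg_at_left_filter; exact: cF.
- by move=> s _; rewrite derive1E; exact: derive_val.
Qed.

Lemma normr_sinc_decay t : `|t| * `|sinc t| <= 1.
Proof.
have [->|t0] := eqVneq t 0; first by rewrite normr0 mul0r.
by rewrite -normrM sincE// mulrC divfK// sin_max.
Qed.

Lemma cos_ge x : 1 - x ^+ 2 / 2 <= cos x.
Proof.
have -> : x = (x / 2) *+ 2 by rewrite -mulr_natr divfK.
rewrite cos_mulr2n cos2sin2 -mulr_natr.
have : sin (x / 2) ^+ 2 <= (x / 2) ^+ 2.
  by rewrite -(real_normK (num_real (sin _))) -(real_normK (num_real (x / 2))) lerXn2r ?nnegrE// normr_sin_le.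
lra.
Qed.

Lemma sinc_ge_half t : `|t| <= 1 -> 2^-1 <= sinc t.
Proof.
move=> t1.
have <- : \int[U]_s (cst 2^-1 s) = 2^-1 :> R.
  by rewrite Rintegral_cst// [X in fine X](probability_setT U) mulr1.
apply: le_Rintegral => //.
- exact: (bounded_measurable_integrable (probability_setT_lty U) (bounded_measurable_cst _ (2^-1 : R))).
- apply: (@bounded_measurable_integrable _ _ _ U _ (fun s => cos (t * clip s))).
    exact: probability_setT_lty.
  by split; [exact: measurable_cos_clip|exists 1 => s; exact: cos_max].
move=> s _; apply: le_trans (cos_ge _).
have : (t * clip s) ^+ 2 <= 1.
  rewrite -real_normK ?num_real// exprn_ile1// normrM mulr_ile1//.
  by rewrite ger0_norm.
rewrite /cst; lra.
Qed.

(** The Fourier transform of [b] is carried by [[- r, r]]. For a bounded [b] this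
    would involve distributions; multiplying [b] by a Gaussian density convolves
    its transform with a Gaussian, and the condition is the tail that remains at
    distance [`|x| - r] from the support. It behaves well under products with
    cosines and under averages. *)
Definition band_limited (r : R) (b : R -> R) := bounded_measurable b /\
  forall (s x t : R), 0 < s -> r <= `|x| ->
    `|\int[normal_prob 0 s]_y (b y * cos (x * y + t))| <=
      expR (- (s ^+ 2 * (`|x| - r) ^+ 2 / 2)).

Lemma band_limited1 : band_limited 0 (cst 1).
Proof.
split; first exact: bounded_measurable_cst.
move=> s x t s0 _; under eq_Rintegral do rewrite mul1r.
rewrite Rintegral_cos_normal_prob ?gt_eqF// mulr0 add0r subr0 real_normK ?num_real//.
by rewrite normrM (ger0_norm (expR_ge0 _)) ler_piMl ?cos_max ?expR_ge0.
Qed.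

(** Multiplication by [cos (l * v * y)] shifts the frequency [x] by [l * v] or by
    [- l * v], which moves it towards the support by at most [l], and [sinc (l y)]
    is an average of such cosines over [v] in the unit interval. *)
Lemma band_limited_sinc (r l : R) (b : R -> R) : 0 <= l -> band_limited r b ->
  band_limited (r + l) (fun y => b y * sinc (l * y)).
Proof.
move=> l0 [bb H]; have [mb [M bM]] := bb.
pose N s : probability (measurableTypeR R) R := normal_prob 0 s.
have b2 : bounded_measurable (fun z : measurableTypeR R * measurableTypeR R =>
    cos (l * z.1 * clip z.2)).
  split; last by exists 1 => z; exact: cos_max.
  apply: measurableT_comp; first exact: continuous_measurable_fun (@continuous_cos R).
  apply: measurable_funM; first exact: measurable_funM.
  exact: measurableT_comp.
split; first by apply: bounded_measurableM => //; exact: (bounded_measurable_Rintegral (N 1) U b2).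
move=> s x t s0 rx.
have b3 : bounded_measurable (fun z : measurableTypeR R * measurableTypeR R =>
    b z.1 * cos (x * z.1 + t) * cos (l * z.1 * clip z.2)).
  apply: bounded_measurableM => //.
  split; last first.
    by exists M => z; rewrite normrM (le_trans (ler_piMr _ (cos_max _)))//; exact: bM.
  apply: measurable_funM; first exact: measurableT_comp.
  apply: measurableT_comp; first exact: continuous_measurable_fun (@continuous_cos R).
  by apply: measurable_funD => //; exact: measurable_funM.
have -> : \int[normal_prob 0 s]_y (b y * sinc (l * y) * cos (x * y + t)) =
    \int[U]_v \int[N s]_y (b y * cos (x * y + t) * cos (l * y * clip v)).
  rewrite (bounded_Rintegral21 (N s) U b3) -(bounded_Rintegral12 (N s) U b3).
  apply: eq_Rintegral => y _; rewrite mulrAC -RintegralZl//.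
  apply: (@bounded_measurable_integrable _ _ _ U _ (fun v => cos (l * y * clip v))).
    exact: probability_setT_lty.
  by split; [exact: measurable_cos_clip|exists 1 => v; exact: cos_max].
apply: normr_Rintegral_le.
  have b3' : bounded_measurable (fun z : measurableTypeR R * measurableTypeR R =>
      b z.2 * cos (x * z.2 + t) * cos (l * z.2 * clip z.1)).
    have [m3 [M3 h3]] := b3; split; last by exists M3 => z; exact: (h3 (z.2, z.1)).
    exact: (measurableT_comp m3 (@measurable_swap _ _ _ _)).
  exact: (bounded_measurable_Rintegral U (N s) b3').1.
move=> v.
have bc x' t' : bounded_measurable (fun y => b y * cos (x' * y + t')).
  by apply: bounded_measurableM => //; exact: bounded_measurable_cos.
have ic x' t' := bounded_measurable_integrable (probability_setT_lty (N s)) (bc x' t').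
have -> : \int[N s]_y (b y * cos (x * y + t) * cos (l * y * clip v)) =
    2^-1 * \int[N s]_y (b y * cos ((x + l * clip v) * y + t)) +
    2^-1 * \int[N s]_y (b y * cos ((x - l * clip v) * y + t)).
  rewrite -!RintegralZl//; try exact: ic.
  rewrite -RintegralD//; last 2 first.
  - by have := integrableZl measurableT 2^-1 (ic (x + l * clip v) t); exact: eq_integrable.
  - by have := integrableZl measurableT 2^-1 (ic (x - l * clip v) t); exact: eq_integrable.
  apply: eq_Rintegral => y _; rewrite -mulrA cosMcos.
  have -> : x * y + t + l * y * clip v = (x + l * clip v) * y + t by ring.
  have -> : x * y + t - l * y * clip v = (x - l * clip v) * y + t by ring.
  by ring.
have lv0 : 0 <= l * clip v by rewrite mulr_ge0.
have lv1 : l * clip v <= l by rewrite ler_piMr.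
have bound x' : `|x| - l <= `|x'| -> `|\int[N s]_y (b y * cos (x' * y + t))| <=
    expR (- (s ^+ 2 * (`|x| - (r + l)) ^+ 2 / 2)).
  move=> xx'; apply: (le_trans (H s x' t s0 _)); first lra.
  rewrite ler_expR lerN2 ler_wpM2r ?invr_ge0// ler_wpM2l ?sqr_ge0//.
  by rewrite lerXn2r ?nnegrE//; lra.
rewrite (le_trans (ler_normD _ _))// !normrM ger0_norm ?invr_ge0//.
have h1 : `|x| - l <= `|x + l * clip v|.
  by have := lerB_normD x (l * clip v); rewrite (ger0_norm lv0); lra.
have h2 : `|x| - l <= `|x - l * clip v|.
  by have := lerB_dist x (l * clip v); rewrite (ger0_norm lv0); lra.
have := bound _ h1; have := bound _ h2; lra.
Qed.

Lemma cvg_harmonic_sqr (c : R) : c * (n.+1%:R^-1 * n.+1%:R^-1) @[n --> \oo] --> 0.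
Proof.
rewrite -[X in _ --> X](mulr0 c); apply: cvgM; first exact: cvg_cst.
by rewrite -[X in _ --> X](mulr0 0); apply: cvgM; exact: cvg_harmonic.
Qed.

(** Undo the regularization: as [s = n + 1] grows, [normal_fun 0 s] tends to 1
    while the exponential bound beats the normalization of order [s]. *)
Lemma band_limited_integral0 (r x t : R) (b : R -> R) : band_limited r b ->
  lebesgue_measure.-integrable setT (EFin \o b) -> r < `|x| ->
  \int[lebesgue_measure]_y (b y * cos (x * y + t)) = 0.
Proof.
move=> [[mb bB] H] ib rx.
have bc : bounded_measurable (fun y => b y * cos (x * y + t)).
  by apply: bounded_measurableM; [split|exact: bounded_measurable_cos].
have ibc : lebesgue_measure.-integrable setT (fun y => (b y * cos (x * y + t))%:E).
  apply: le_integrable ib => //; first by apply/measurable_EFinP; exact: bc.1.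
  by move=> y _; rewrite lee_fin normrM ler_piMr// cos_max.
pose I n := \int[lebesgue_measure]_y (b y * cos (x * y + t) * normal_fun 0 n.+1%:R y).
have lim1 : I n @[n --> \oo] --> \int[lebesgue_measure]_y (b y * cos (x * y + t)).
  apply: fine_cvg; rewrite fineK; last exact: integrable_fin_num.
  apply: (@dominated_cvg _ _ _ lebesgue_measure setT measurableT
    (fun n y => (b y * cos (x * y + t) * normal_fun 0 n.+1%:R y)%:E) _
    (fun y => `|(b y * cos (x * y + t))%:E|%E)).
  - move=> n; apply/measurable_EFinP; apply: measurable_funM; first exact: bc.1.
    exact: measurable_normal_fun.
  - move=> y _; apply: cvg_EFin; first exact: nearW.
    rewrite -[X in _ --> X]mulr1; apply: cvgM; first exact: cvg_cst.
    rewrite /normal_fun -[X in _ --> X]expR0.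
    apply: (@cvg_comp _ _ _ _ (@expR R)); last exact: continuous_expR.
    have E n : - (y - 0) ^+ 2 / (n.+1%:R ^+ 2 *+ 2) =
        (- y ^+ 2 / 2) * (n.+1%:R^-1 * n.+1%:R^-1) :> R.
      by rewrite -[_ *+ 2]mulr_natr; field; rewrite nat1r pnatr_eq0.
    rewrite (_ : (fun n => _) = (fun n => (- y ^+ 2 / 2) * (n.+1%:R^-1 * n.+1%:R^-1))).
      exact: cvg_harmonic_sqr.
    by apply/funext => n; exact: E.
  - by [].
  - exact: integrable_abse.
  - move=> n y _; rewrite lee_fin normrM ler_piMr//.
    rewrite ger0_norm ?normal_fun_ge0// -expR0 ler_expR mulNr oppr_le0.
    by rewrite divr_ge0 ?sqr_ge0// mulrn_wge0// sqr_ge0.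
have lim0 : I n @[n --> \oo] --> (0 : R).
  apply: norm_cvg0.
  pose e := (`|x| - r) ^+ 2 / 2.
  have e0 : 0 < e by rewrite divr_gt0// exprn_gt0// subr_gt0.
  pose c : R := Num.sqrt (pi *+ 2) / e.
  apply: (@squeeze_cvgr _ _ _ _ (cst 0) (fun n => c * n.+1%:R^-1)).
  - apply: nearW => n; rewrite normr_ge0/=.
    have n0 : (n.+1%:R : R) != 0 by rewrite pnatr_eq0.
    have p0 := normal_peak_gt0 n0.
    have -> : I n = (normal_peak n.+1%:R)^-1 *
        \int[normal_prob 0 n.+1%:R]_y (b y * cos (x * y + t)).
      by rewrite Rintegral_normal_prob// mulKf// gt_eqF.
    have p0' : 0 < (normal_peak (n.+1%:R : R))^-1 by rewrite invr_gt0.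
    rewrite normrM (gtr0_norm p0').
    have := H n.+1%:R x t _ (ltW rx); rewrite ltr0Sn => /(_ isT) Hn.
    apply: (le_trans (ler_wpM2l (ltW p0') Hn)).
    rewrite /normal_peak invrK -mulrnAr sqrtrM ?sqr_ge0// sqrtr_sqr normr_nat.
    have -> : n.+1%:R ^+ 2 * (`|x| - r) ^+ 2 / 2 = n.+1%:R ^+ 2 * e by rewrite /e mulrA.
    have N0 : (0 : R) < n.+1%:R by rewrite ltr0Sn.
    rewrite /c mulrAC -[leRHS]mulrA (mulrC _ (Num.sqrt _)) -!mulrA ler_wpM2l ?sqrtr_ge0//.
    have ne0 : 0 < n.+1%:R * (e * n.+1%:R) by rewrite mulr_gt0// mulr_gt0.
    rewrite expRN -ler_pdivlMl// -!invfM lef_pV2 ?posrE ?expR_gt0//.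
    by apply: le_trans (expR_ge1Dx _); rewrite (mulrC e) lerDr.
  - exact: cvg_cst.
  - by rewrite -[X in _ --> X](mulr0 c); apply: cvgM; [exact: cvg_cst|exact: cvg_harmonic].
exact: (cvg_unique _ lim1 lim0).
Qed.

(** Even powers are nonnegative, and high ones decay faster than the spectral
    density. *)
Definition sinc_power (l : R) (k : nat) (y : R) := sinc (l * y) ^+ k.*2.

Lemma sinc_power_ge0 l k y : 0 <= sinc_power l k y.
Proof. by rewrite /sinc_power -muln2 mulnC exprM exprn_ge0// sqr_ge0. Qed.

Lemma band_limited_sinc_power l k : 0 <= l -> band_limited (k.*2%:R * l) (sinc_power l k).
Proof.
move=> l0; rewrite /sinc_power; elim: k.*2 => [|n IH].
  by rewrite mul0r; under eq_fun do rewrite expr0; exact: band_limited1.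
rewrite -natr1 mulrDl mul1r; under eq_fun do rewrite exprSr.
exact: band_limited_sinc.
Qed.

Let sinc_sqr_le l y : (1 + (l * y) ^+ 2) * sinc (l * y) ^+ 2 <= 2.
Proof.
have h1 := normr_sinc_le1 (l * y); have h2 := normr_sinc_decay (l * y).
have <- := real_normK (num_real (sinc (l * y))).
have <- := real_normK (num_real (l * y)).
have a1 : `|sinc (l * y)| ^+ 2 <= 1 by rewrite exprn_ile1.
have a2 : (`|l * y| * `|sinc (l * y)|) ^+ 2 <= 1 by rewrite exprn_ile1// mulr_ge0.
rewrite mulrDl mul1r -exprMn; lra.
Qed.

Lemma sinc_power_decay l k y : sinc_power l k y * (1 + (l * y) ^+ 2) ^+ k <= 2 ^+ k.
Proof.
rewrite /sinc_power -muln2 mulnC exprM -exprMn lerXn2r ?nnegrE// mulrC.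
  by rewrite mulr_ge0 ?sqr_ge0// addr_ge0// sqr_ge0.
exact: sinc_sqr_le.
Qed.

Lemma integrable_oneDsqrV :
  lebesgue_measure.-integrable setT (fun y : R => ((1 + y ^+ 2)^-1)%:E).
Proof.
have c : continuous (fun y : R => (1 + y ^+ 2)^-1) by exact: (@continuous_oneDsqrV R).
have p (y : R) : 0 <= (1 + y ^+ 2)^-1 by rewrite invr_ge0 addr_ge0// sqr_ge0.
apply/integrableP; split; first by apply/measurable_EFinP; exact: continuous_measurable_fun.
under eq_integral do rewrite gee0_abs ?lee_fin ?p//.
rewrite (ge0_symfun_integralT p c); last by move=> y /=; rewrite sqrrN.
rewrite -set_itvcy (@integral0y_oneDsqr R).
by rewrite -EFinM ltry.
Qed.

(** Comparison with [1 / (1 + y ^+ 2)], using only one square of [sinc]. *)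
Lemma integrable_sinc_power l k : 0 < l -> (0 < k)%N ->
  lebesgue_measure.-integrable setT (EFin \o sinc_power l k).
Proof.
move=> l0 k0.
have := integrableZl measurableT (2 * (1 + (l ^+ 2)^-1)) integrable_oneDsqrV.
apply: le_integrable => //.
  by apply/measurable_EFinP; exact: (band_limited_sinc_power k (ltW l0)).1.1.
move=> y _; rewrite lee_fin ger0_norm ?sinc_power_ge0//.
have l2 : 0 < l ^+ 2 by rewrite exprn_gt0.
have y2 : 0 < 1 + y ^+ 2 by rewrite ltr_wpDr// sqr_ge0.
have h : 0 <= 2 * (1 + (l ^+ 2)^-1) / (1 + y ^+ 2).
  by rewrite divr_ge0// ltW// mulr_gt0// addr_gt0// invr_gt0.
rewrite ger0_norm// ler_pdivlMr//.
have s1 : sinc_power l k y <= sinc (l * y) ^+ 2.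
  have le1 : sinc (l * y) ^+ 2 <= 1.
    by rewrite -real_normK ?num_real// exprn_ile1// normr_sinc_le1.
  rewrite /sinc_power -muln2 mulnC exprM -(prednK k0) exprS ler_piMr ?sqr_ge0//.
  by rewrite exprn_ile1// sqr_ge0.
apply: (le_trans (ler_wpM2r (ltW y2) s1)).
have h2 := sinc_sqr_le l y.
have h3 : 1 + y ^+ 2 <= (1 + (l ^+ 2)^-1) * (1 + (l * y) ^+ 2).
  have -> : (1 + (l ^+ 2)^-1) * (1 + (l * y) ^+ 2) = 1 + y ^+ 2 + ((l ^+ 2)^-1 + (l * y) ^+ 2).
    by rewrite exprMn; field; rewrite gt_eqF.
  by rewrite lerDl addr_ge0 ?sqr_ge0// invr_ge0 ltW.
apply: (le_trans (ler_wpM2l (sqr_ge0 _) h3)).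
have -> : sinc (l * y) ^+ 2 * ((1 + l ^- 2) * (1 + (l * y) ^+ 2)) =
  ((1 + (l * y) ^+ 2) * sinc (l * y) ^+ 2) * (1 + l ^- 2) by ring.
by rewrite ler_wpM2r// addr_ge0// invr_ge0 ltW.
Qed.

(** On [[0, 1 / l]] the function [sinc (l y)] is at least one half. *)
Lemma Rintegral_sinc_power_ge l k : 0 < l -> (0 < k)%N ->
  (4 ^+ k)^-1 / l <= \int[lebesgue_measure]_y sinc_power l k y.
Proof.
move=> l0 k0.
have il : 0 < l^-1 by rewrite invr_gt0.
have -> : (4 ^+ k)^-1 / l =
    \int[lebesgue_measure]_(y in `[0, l^-1]) (cst (4 ^+ k)^-1 y) :> R.
  have muI : lebesgue_measure (`[0, l^-1]%classic : set R) = (l^-1)%:E.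
    by rewrite lebesgue_measure_itv/= lte_fin il oppr0 adde0.
  by rewrite Rintegral_cst// [X in fine X]muI.
rewrite Rintegral_mkcond; apply: le_Rintegral => //.
- have iI : lebesgue_measure.-integrable (`[0, l^-1]%classic : set (measurableTypeR R))
      (EFin \o cst ((4 ^+ k)^-1 : R)).
    by apply: continuous_compact_integrable;
      [exact: segment_compact|apply: continuous_subspaceT => y; exact: cst_continuous].
  have mI : measurable (`[0, l^-1]%classic : set (measurableTypeR R)) by exact: measurable_itv.
  move: iI => /(integrable_mkcond _ mI); apply: eq_integrable => // y _.
  by rewrite /= !patchE; case: ifP.
- exact: integrable_sinc_power.
move=> y _; rewrite patchE; case: ifPn => [|_]; last exact: sinc_power_ge0.
rewrite inE/= in_itv/= => /andP[y0 yl].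
have ly : `|l * y| <= 1.
  by rewrite ger0_norm ?mulr_ge0 ?(ltW l0)// mulrC -ler_pdivlMr// div1r.
rewrite /cst /sinc_power -muln2 mulnC exprM -exprVn lerXn2r ?nnegrE ?invr_ge0 ?sqr_ge0//.
have := sinc_ge_half ly; nra.
Qed.

End sinc.

(** * Products of functions of one coordinate *)

(** [lebesgue_tuple] is a bare measure, while Fubini's theorem takes measures
    bundled with their sigma-finiteness. *)
Definition sigma_finite_pack d (T : measurableType d) (R : realType)
    (mu : {measure set T -> \bar R}) (sf : sigma_finite setT mu) :
    {sigma_finite_measure set T -> \bar R} :=
  HB.pack_for (SigmaFiniteMeasure.type T R) (Measure.sort mu)
    (isSFinite.Build _ _ _ _ (sfinite_measure_sigma_finite sf))
    (isSigmaFinite.Build _ _ _ _ sf).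

Lemma sigma_finite_packE d (T : measurableType d) (R : realType)
    (mu : {measure set T -> \bar R}) (sf : sigma_finite setT mu) :
  sigma_finite_pack sf = mu :> {measure set T -> \bar R}.
Proof. by case: mu sf => s [c1 c2] sf. Qed.

Section lebesgue_tuple_fubini.
Variable R : realType.

Lemma measurable_tuple_thead n :
  measurable_fun setT (fun t : n.+1.-tuple (measurableTypeR R) => thead t).
Proof. exact: measurable_tnth. Qed.

Lemma measurable_tuple_behead n :
  measurable_fun setT (fun t : n.+1.-tuple (measurableTypeR R) => [tuple of behead t]).
Proof.
apply/measurable_fun_tnthP => i.
rewrite (_ : _ \o _ = fun t => tnth t (lift ord0 i)); first exact: measurable_tnth.
by apply/funext => t /=; rewrite tnth_behead; congr tnth; apply/val_inj; rewrite /= inordK// ltnS.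
Qed.

Lemma lebesgue_tuple_sigma_finite n : sigma_finite setT (lebesgue_tuple R n).
Proof.
elim: n => [|n IH].
  exists (fun=> setT); first by rewrite bigcup_const.
  by move=> k; split => //=; rewrite diracT ltry.
have /sigma_finiteP[F [FT Fhomo Ffin]] := IH.
pose I k : set (measurableTypeR R) := `[- k%:R, k%:R]%classic.
exists (fun k => [set t | I k (thead t) /\ F k [tuple of behead t]]).
  apply/esym; rewrite -subTset => t _.
  have : setT [tuple of behead t] by [].
  rewrite FT => -[k _ Fk].
  pose j := maxn k (Num.truncn `|thead t|).+1.
  exists j => //; split.
    rewrite /I/= in_itv/= -ler_norml (le_trans (ltW (truncnS_gt _)))// ler_nat.
    exact: leq_maxr.
  have /subsetPset := Fhomo k j (leq_maxl _ _); exact.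
move=> k; have [mF finF] := Ffin k.
have mI : measurable (I k) by exact: measurable_itv.
split.
  have m1 := @measurable_tuple_thead n measurableT _ mI.
  have m2 := @measurable_tuple_behead n measurableT _ mF.
  by have := measurableI _ _ m1 m2; rewrite !setTI.
rewrite lebesgue_tuple_cylinder//; apply: lte_mul_pinfty => //.
  by rewrite lebesgue_measure_itv/=; case: ifP.
Qed.

Let mu n : {sigma_finite_measure set (n.-tuple (measurableTypeR R)) -> \bar R} :=
  sigma_finite_pack (lebesgue_tuple_sigma_finite n).

Let muE n : mu n = lebesgue_tuple R n :> {measure set _ -> \bar R}.
Proof. exact: sigma_finite_packE. Qed.

Let lambda : {sigma_finite_measure set (measurableTypeR R) -> \bar R} := @lebesgue_measure R.

Let ge0_integral_tupleS n (F : n.+1.-tuple (measurableTypeR R) -> \bar R) :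
  measurable_fun setT F -> (forall t, (0 <= F t)%E) ->
  (\int[lebesgue_tuple R n.+1]_t F t = \int[(mu n \x lambda)%E]_p F (tuple_cons p))%E.
Proof.
move=> mF F0.
exact: (ge0_integral_pushforward (@measurable_tuple_cons R n) _ measurableT mF (in1W F0)).
Qed.

Let integral_tupleS n (F : n.+1.-tuple (measurableTypeR R) -> \bar R) :
  measurable_fun setT F -> (lebesgue_tuple R n.+1).-integrable setT F ->
  (\int[lebesgue_tuple R n.+1]_t F t = \int[(mu n \x lambda)%E]_p F (tuple_cons p))%E /\
  (mu n \x lambda)%E.-integrable setT (F \o @tuple_cons R n).
Proof.
move=> mF intF.
have intF' : (mu n \x lambda)%E.-integrable setT (F \o @tuple_cons R n).
  apply/integrableP; split; first exact: measurableT_comp mF (@measurable_tuple_cons R n).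
  rewrite -(ge0_integral_tupleS (F := fun t => `|F t|%E))//; last exact: measurableT_comp.
  by case/integrableP: intF.
split => //.
exact: (integral_pushforward (@measurable_tuple_cons R n) mF intF' measurableT).
Qed.

Variables (b : R -> R).
Hypothesis b0 : forall y, 0 <= b y.
Hypothesis mb : measurable_fun setT b.
Hypothesis intb : (@lebesgue_measure R).-integrable setT (EFin \o b).

Definition tuple_prod n (t : n.-tuple (measurableTypeR R)) : R := \prod_(i < n) b (tnth t i).

Definition tuple_dot n (t : n.-tuple (measurableTypeR R)) (z : 'I_n -> R) : R :=
  \sum_(i < n) tnth t i * z i.

Lemma measurable_tuple_prod n : measurable_fun setT (@tuple_prod n).
Proof.
apply: measurable_prod => i _.
by apply: (measurableT_comp (f := b)) => //; exact: measurable_tnth.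
Qed.

Lemma measurable_tuple_dot n (z : 'I_n -> R) : measurable_fun setT (fun t => tuple_dot t z).
Proof. by apply: measurable_sum => i; apply: measurable_funM => //; exact: measurable_tnth. Qed.

Lemma tuple_prod_ge0 n (t : n.-tuple (measurableTypeR R)) : 0 <= tuple_prod t.
Proof. exact: prodr_ge0. Qed.

Lemma tuple_prod_cons n (p : n.-tuple (measurableTypeR R) * measurableTypeR R) :
  tuple_prod (tuple_cons p) = b p.2 * tuple_prod p.1.
Proof.
rewrite /tuple_prod big_ord_recl; congr (b _ * _).
by apply: eq_bigr => i _; congr b; rewrite (tnth_nth 0) /= (tnth_nth 0).
Qed.

Lemma tuple_dot_cons n (p : n.-tuple (measurableTypeR R) * measurableTypeR R) z :
  tuple_dot (tuple_cons p) z = p.2 * z ord0 + tuple_dot p.1 (z \o lift ord0).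
Proof.
rewrite /tuple_dot big_ord_recl; congr (_ * _ + _).
by apply: eq_bigr => i _; congr (_ * _); rewrite (tnth_nth 0) /= (tnth_nth 0).
Qed.

Let integral_b_fin : (\int[lambda]_y (b y)%:E)%E = (\int[lebesgue_measure]_y b y)%:E.
Proof. by rewrite fineK//; exact: (integrable_fin_num _ intb). Qed.

Lemma integral_tuple_prod n :
  (\int[lebesgue_tuple R n]_t (tuple_prod t)%:E)%E =
  ((\int[lebesgue_measure]_y b y) ^+ n)%:E.
Proof.
elim: n => [|n IH].
  rewrite integral_dirac//; last by apply/measurable_EFinP; exact: measurable_tuple_prod.
  by rewrite diracT mul1e /tuple_prod big_ord0.
rewrite ge0_integral_tupleS; last 2 first.
- by apply/measurable_EFinP; exact: measurable_tuple_prod.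
- by move=> t; rewrite lee_fin tuple_prod_ge0.
have mf : measurable_fun setT (fun p : n.-tuple (measurableTypeR R) * measurableTypeR R =>
    (tuple_prod (tuple_cons p))%:E).
  apply/measurable_EFinP; apply: measurableT_comp; first exact: measurable_tuple_prod.
  exact: measurable_tuple_cons.
rewrite fubini_tonelli1//; last by move=> p; rewrite lee_fin tuple_prod_ge0.
rewrite /fubini_F.
have inner t : (\int[lambda]_y (tuple_prod (tuple_cons (t, y)))%:E)%E =
    ((tuple_prod t)%:E * (\int[lebesgue_measure]_y b y)%:E)%E.
  under eq_integral do rewrite tuple_prod_cons mulrC EFinM.
  have mEb : measurable_fun setT (EFin \o b) by exact/measurable_EFinP.
  have b0' y : setT y -> (0 <= (EFin \o b) y)%E by rewrite lee_fin.
  have := ge0_integralZl_EFin lambda measurableT b0' mEb (tuple_prod_ge0 t).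
  by rewrite /= integral_b_fin.
under eq_integral do rewrite inner muleC.
have mP : measurable_fun setT (EFin \o @tuple_prod n).
  by apply/measurable_EFinP; exact: measurable_tuple_prod.
have P0 t : setT t -> (0 <= (EFin \o @tuple_prod n) t)%E by rewrite lee_fin tuple_prod_ge0.
have B0 : 0 <= \int[lebesgue_measure]_y b y by exact: Rintegral_ge0.
rewrite (ge0_integralZl_EFin (mu n) measurableT P0 mP B0) muE.
by rewrite [X in (_ * X)%E]IH -EFinM exprS.
Qed.

Lemma integrable_tuple_prod n : (lebesgue_tuple R n).-integrable setT (EFin \o @tuple_prod n).
Proof.
apply/integrableP; split; first by apply/measurable_EFinP; exact: measurable_tuple_prod.
under eq_integral do rewrite gee0_abs ?lee_fin ?tuple_prod_ge0//.
by rewrite integral_tuple_prod ltry.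
Qed.

Lemma integrable_tuple_prod_cos n z (a : R) : (lebesgue_tuple R n).-integrable setT
  (fun t => (tuple_prod t * cos (tuple_dot t z + a))%:E).
Proof.
apply: le_integrable (integrable_tuple_prod n) => //.
  apply/measurable_EFinP/measurable_funM; first exact: measurable_tuple_prod.
  apply: measurableT_comp; first exact: continuous_measurable_fun (@continuous_cos R).
  by apply: measurable_funD => //; exact: measurable_tuple_dot.
by move=> t _; rewrite lee_fin normrM ler_piMr// cos_max.
Qed.

(** One vanishing coordinate transform makes the whole transform vanish: the
    integral may be taken in that coordinate first. *)
Lemma Rintegral_tuple_prod_cos0 n (z : 'I_n -> R) (D : R) (a : R) :
  (forall x c, D <= `|x| -> \int[lebesgue_measure]_y (b y * cos (x * y + c)) = 0) ->
  (exists i, D <= `|z i|) ->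
  \int[lebesgue_tuple R n]_t (tuple_prod t * cos (tuple_dot t z + a)) = 0.
Proof.
move=> vanish; elim: n z a => [|n IH] z a [i Di]; first by case: i Di.
have mF : measurable_fun setT (fun t : n.+1.-tuple (measurableTypeR R) =>
    (tuple_prod t * cos (tuple_dot t z + a))%:E).
  by have /integrableP[] := integrable_tuple_prod_cos z a.
have [E intE] := integral_tupleS mF (integrable_tuple_prod_cos z a).
rewrite /Rintegral E -[LHS]/(\int[(mu n \x lambda)%E]_p
  (tuple_prod (tuple_cons p) * cos (tuple_dot (tuple_cons p) z + a))).
have FE t y : tuple_prod (tuple_cons (t, y)) * cos (tuple_dot (tuple_cons (t, y)) z + a) =
    tuple_prod t * (b y * cos (z ord0 * y + (tuple_dot t (z \o lift ord0) + a))).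
  rewrite tuple_prod_cons tuple_dot_cons /=.
  have -> : y * z ord0 + tuple_dot t (z \o lift ord0) + a =
    z ord0 * y + (tuple_dot t (z \o lift ord0) + a) by ring.
  by ring.
have int1 x c : lambda.-integrable setT (fun y => (b y * cos (x * y + c))%:E).
  apply: le_integrable intb => //.
    by apply/measurable_EFinP/measurable_funM => //; exact: measurable_cos_affine.
  by move=> y _; rewrite lee_fin normrM ler_piMr// cos_max.
have sect1 t : lambda.-integrable setT (fun y =>
    (tuple_prod (tuple_cons (t, y)) * cos (tuple_dot (tuple_cons (t, y)) z + a))%:E).
  have := integrableZl measurableT (tuple_prod t) (int1 (z ord0) (tuple_dot t (z \o lift ord0) + a)).
  by apply: eq_integrable => // y _; rewrite FE.
have sect2 y : (mu n).-integrable setT (fun t =>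
    (tuple_prod (tuple_cons (t, y)) * cos (tuple_dot (tuple_cons (t, y)) z + a))%:E).
  have h := integrableZl measurableT (b y) (integrable_tuple_prod_cos (z \o lift ord0) (z ord0 * y + a)).
  apply: eq_integrable h => // t _; rewrite FE -EFinM; congr EFin.
  rewrite mulrCA; congr (_ * (_ * cos _)); ring.
have [z0|z0] := leP D `|z ord0|.
  rewrite -(Rintegral12_prod intE sect1).
  under eq_Rintegral do under eq_Rintegral do rewrite FE.
  rewrite -[RHS](_ : \int[mu n]_t (cst 0 t) = 0); last by rewrite /Rintegral integral0.
  apply: eq_Rintegral => t _; rewrite RintegralZl//; last exact: int1.
  by rewrite [X in _ * X](vanish _ _ z0) mulr0.
rewrite -(Rintegral21_prod intE sect2).
rewrite -[RHS](_ : \int[lambda]_y (cst 0 y) = 0); last by rewrite /Rintegral integral0.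
apply: eq_Rintegral => y _.
transitivity (b y * \int[lebesgue_tuple R n]_t (tuple_prod t *
      cos (tuple_dot t (z \o lift ord0) + (z ord0 * y + a)))).
  rewrite -RintegralZl//; last exact: integrable_tuple_prod_cos.
  apply: eq_Rintegral => t _; rewrite FE mulrCA; congr (_ * (_ * cos _)); ring.
rewrite IH ?mulr0//.
case: (unliftP ord0 i) Di => [j ->|->] Dj; first by exists j.
by move: z0; rewrite ltNge Dj.
Qed.

End lebesgue_tuple_fubini.

(** * Variance of a combination with an isolated node *)

Section spectral_quadratic_form.
Context d (T : measurableType d) (R : realType) (mu : {measure set T -> \bar R}).
Variables (g : T -> R) (m : nat) (p : 'I_m -> T -> R).
Hypothesis ig : mu.-integrable setT (EFin \o g).
Hypothesis mp : forall j, measurable_fun setT (p j).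

Let energy (u : 'I_m -> R) t :=
  (\sum_j u j * cos (p j t)) ^+ 2 + (\sum_j u j * sin (p j t)) ^+ 2.

Let icos j k : mu.-integrable setT (fun t => (g t * cos (p j t - p k t))%:E).
Proof.
have mg : measurable_fun setT g by apply/measurable_EFinP; exact: (measurable_int mu).
apply: le_integrable ig => //.
  apply/measurable_EFinP/measurable_funM => //.
  apply: measurableT_comp; first exact: continuous_measurable_fun (@continuous_cos R).
  exact: measurable_funB.
by move=> t _; rewrite lee_fin normrM ler_piMr// cos_max.
Qed.

(** The energy is the squared modulus of the sum of the [u j * exp (i p_j t)]. *)
Lemma spectral_form_energy (u : 'I_m -> R) :
  mu.-integrable setT (fun t => (g t * energy u t)%:E) /\
  \int[mu]_t (g t * energy u t) =
  \sum_j \sum_k u j * u k * \int[mu]_t (g t * cos (p j t - p k t)).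
Proof.
have E t : g t * energy u t = \sum_j \sum_k u j * u k * (g t * cos (p j t - p k t)).
  rewrite /energy !expr2 !mulr_suml -big_split/= mulr_sumr; apply: eq_bigr => j _.
  rewrite !mulr_sumr -big_split/= mulr_sumr; apply: eq_bigr => k _.
  by rewrite cosB; ring.
have i1 j k : mu.-integrable setT (EFin \o (fun t => u j * u k * (g t * cos (p j t - p k t)))).
  by have := integrableZl measurableT (u j * u k) (icos j k); exact: eq_integrable.
have i2 j := Rintegral_sum (index_enum 'I_m) (i1 j).
have [i3 e3] := Rintegral_sum (index_enum 'I_m) (fun j => (i2 j).1).
split; first by apply: eq_integrable i3 => // t _; rewrite /= E.
under eq_Rintegral do rewrite E.
rewrite e3; apply: eq_bigr => j _; rewrite (i2 j).2; apply: eq_bigr => k _.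
by rewrite RintegralZl//; exact: icos.
Qed.

End spectral_quadratic_form.

Section euclidean_norm.
Context (R : realType) (d : nat).
Implicit Types x y z : 'rV[R]_d.

Lemma edotBr (w x y : 'rV[R]_d) : edot w (x - y) = edot w x - edot w y.
Proof. by rewrite /edot -sumrB; apply: eq_bigr => i _; rewrite !mxE mulrBr. Qed.

Lemma edot_ge0 (x : 'rV[R]_d) : 0 <= edot x x.
Proof. by apply: sumr_ge0 => i _; rewrite -expr2 sqr_ge0. Qed.

Lemma enorm_sqr (x : 'rV[R]_d) : enorm x ^+ 2 = \sum_i x ord0 i ^+ 2.
Proof. by rewrite sqr_sqrtr ?edot_ge0//; apply: eq_bigr => i _; rewrite expr2. Qed.

Lemma edotC x y : edot x y = edot y x.
Proof. by apply: eq_bigr => i _; rewrite mulrC. Qed.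

Lemma edotDl x y z : edot (x + y) z = edot x z + edot y z.
Proof. by rewrite /edot -big_split/=; apply: eq_bigr => i _; rewrite !mxE mulrDl. Qed.

Lemma edotZl (a : R) x y : edot (a *: x) y = a * edot x y.
Proof. by rewrite /edot mulr_sumr; apply: eq_bigr => i _; rewrite !mxE mulrA. Qed.

Lemma enorm_ge0 x : 0 <= enorm x. Proof. exact: sqrtr_ge0. Qed.

Lemma enormE x : enorm x ^+ 2 = edot x x.
Proof. by rewrite sqr_sqrtr// edot_ge0. Qed.

Lemma enormZ (a : R) x : enorm (a *: x) = `|a| * enorm x.
Proof.
by rewrite /enorm edotZl edotC edotZl mulrA -expr2 sqrtrM ?sqr_ge0// sqrtr_sqr.
Qed.

Lemma enormN x : enorm (- x) = enorm x.
Proof. by rewrite -scaleN1r enormZ normrN1 mul1r. Qed.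

(** The Cauchy-Schwarz inequality. *)
Lemma edot_le_enorm x y : `|edot x y| <= enorm x * enorm y.
Proof.
have key : edot x y ^+ 2 <= edot x x * edot y y.
  have H (a b : R) : 0 <= a ^+ 2 * edot x x + 2 * (a * b) * edot x y + b ^+ 2 * edot y y.
    have := edot_ge0 (a *: x + b *: y).
    by rewrite edotDl !edotZl ![edot _ (_ + _)]edotC !edotDl !edotZl (edotC y x); congr (0 <= _); ring.
  have x0 := edot_ge0 x; have y0 := edot_ge0 y.
  have [yy|yy] := eqVneq (edot y y) 0; last first.
    have yp : 0 < edot y y by rewrite lt_def yy.
    have := H (edot y y) (- edot x y); set a := edot x y; set b := edot y y => h.
    rewrite -subr_ge0 -(pmulr_rge0 _ yp) -/b; apply: le_trans h _.
    by rewrite le_eqVlt; apply/orP; left; apply/eqP; rewrite -/b; ring.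
  rewrite yy mulr0 leNgt; apply/negP => xy0.
  have := H 1 (- (edot x x + 1) / edot x y ^+ 2 * edot x y).
  have -> : 1 ^+ 2 * edot x x + 2 * (1 * (- (edot x x + 1) / edot x y ^+ 2 * edot x y)) * edot x y
     = edot x x - 2 * (edot x x + 1).
    by field; move: xy0; rewrite lt_def sqrf_eq0 => /andP[].
  rewrite yy mulr0 addr0; lra.
rewrite -(ler_pXn2r (ltn0Sn 1)) ?nnegrE ?mulr_ge0 ?enorm_ge0//.
by rewrite real_normK ?num_real// exprMn !enormE.
Qed.

Lemma ler_enormD x y : enorm (x + y) <= enorm x + enorm y.
Proof.
rewrite -(ler_pXn2r (ltn0Sn 1)) ?nnegrE ?addr_ge0 ?enorm_ge0//.
rewrite sqrrD !enormE edotDl ![edot _ (_ + _)]edotC !edotDl (edotC y x).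
have := edot_le_enorm x y; rewrite ler_norml => /andP[_ h]; lra.
Qed.

Lemma ler_coord_enorm x i : `|x ord0 i| <= enorm x.
Proof.
rewrite -(ler_pXn2r (ltn0Sn 1)) ?nnegrE ?enorm_ge0// enorm_sqr real_normK ?num_real//.
by rewrite (bigD1 i)//= lerDl sumr_ge0// => j _; rewrite sqr_ge0.
Qed.

Lemma enorm_le_coord x (e : R) : 0 <= e -> (forall i, `|x ord0 i| <= e) ->
  enorm x <= d%:R * e.
Proof.
move=> e0 xe; rewrite -(ler_pXn2r (ltn0Sn 1)) ?nnegrE ?mulr_ge0 ?enorm_ge0// enorm_sqr.
apply: (@le_trans _ _ (\sum_(i < d) e ^+ 2)).
  apply: ler_sum => i _; rewrite -real_normK ?num_real//.
  by rewrite lerXn2r ?nnegrE.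
rewrite sumr_const card_ord -[leLHS]mulr_natl exprMn ler_wpM2r ?sqr_ge0// -natrX ler_nat.
by case: (d) => // n; rewrite leq_pmulr.
Qed.

Lemma enorm_eq0_coord x : enorm x = 0 -> x = 0.
Proof.
move=> x0; apply/rowP => i; rewrite mxE; apply/eqP; rewrite -normr_le0 -x0.
exact: ler_coord_enorm.
Qed.

End euclidean_norm.

Section variance_lower_bound.
Context (R : realType) (d : nat).

Lemma edot_row_of_tuple (t : d.-tuple (measurableTypeR R)) (z : 'rV[R]_d) :
  edot (row_of_tuple t) z = tuple_dot t (z ord0).
Proof. by apply: eq_bigr => i _; rewrite mxE. Qed.

Lemma le_sum_prod1D (s : seq R) : all (fun x => 0 <= x) s ->
  1 + \sum_(x <- s) x <= \prod_(x <- s) (1 + x).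
Proof.
elim: s => [|x s IH] /=; first by rewrite !big_nil addr0.
move=> /andP[x0 s0]; have {}IH := IH s0; rewrite !big_cons.
have : 0 <= \sum_(y <- s) y by rewrite big_seq; apply: sumr_ge0 => y ys; exact: (allP s0).
nra.
Qed.

Section smoothness.
Variables (nu0 c1 : R).
Hypotheses (nu0_gt0 : 0 < nu0) (c1_gt0 : 0 < c1).

Let s := nu0 + d%:R / 2.
Let k := (Num.truncn s).+1.

Let s_gt0 : 0 < s. Proof. by rewrite ltr_pwDl// divr_ge0. Qed.

Let s_le_k : s <= k%:R. Proof. by rewrite ltW// truncnS_gt. Qed.

Let weight (l : R) := c1 / 2 ^+ (k * d) * l `^ (2 * s).

(** Each factor is at most [(2 / (1 + (l t_i) ^ 2)) ^ k], and the product of the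
    [1 + (l t_i) ^ 2] is at least [1 + l ^ 2 |t| ^ 2 >= l ^ 2 (1 + |t| ^ 2)]. *)
Lemma sinc_power_tuple_le (l : R) (t : d.-tuple (measurableTypeR R)) : 0 < l -> l <= 1 ->
  weight l * tuple_prod (sinc_power l k) t <=
  c1 * (1 + enorm (row_of_tuple t) ^+ 2) `^ (- s).
Proof.
move=> l0 l1; set q := 1 + enorm (row_of_tuple t) ^+ 2.
have q1 : 1 <= q by rewrite lerDl sqr_ge0.
have q0 : 0 < q by exact: lt_le_trans q1.
pose a i := (l * tnth t i) ^+ 2.
have a0 i : 0 <= a i by exact: sqr_ge0.
pose Q := 1 + \sum_i a i.
have Q1 : 1 <= Q by rewrite lerDl sumr_ge0.
have Q0 : 0 < Q by exact: lt_le_trans Q1.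
have lq : l ^+ 2 * q <= Q.
  rewrite /q /Q enorm_sqr mulrDr mulr1 mulr_sumr lerD//.
    by rewrite exprn_ile1// ltW.
  by apply: ler_sum => i _; rewrite mxE /a exprMn.
have QP : Q <= \prod_i (1 + a i).
  have := @le_sum_prod1D [seq a i | i <- index_enum 'I_d] _.
  rewrite !big_map; apply; apply/allP => _ /mapP[i _ ->]; exact: a0.
have prod_le : tuple_prod (sinc_power l k) t * Q ^+ k <= 2 ^+ (k * d).
  apply: (@le_trans _ _ (\prod_i (sinc_power l k (tnth t i) * (1 + a i) ^+ k))).
    rewrite big_split/= ler_wpM2l ?prodrXl ?lerXn2r ?nnegrE ?(ltW Q0)//.
    - by apply: prodr_ge0 => i _; exact: sinc_power_ge0.
    - by apply: prodr_ge0 => i _; rewrite addr_ge0.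
  rewrite exprM -[X in _ <= _ ^+ X]card_ord -prodr_const; apply: ler_prod => i _.
  rewrite mulr_ge0 ?sinc_power_ge0 ?exprn_ge0 ?addr_ge0//=.
  exact: sinc_power_decay.
have Qs : l `^ (2 * s) * q `^ s <= Q ^+ k.
  rewrite powRrM powR_mulrn ?(ltW l0)// -powRM ?sqr_ge0 ?(ltW q0)//.
  apply: (@le_trans _ _ (Q `^ s)).
    by apply: ge0_ler_powR => //; rewrite ?nnegrE ?mulr_ge0 ?sqr_ge0 ?(ltW q0) ?(ltW Q0)// ltW.
  by rewrite -powR_mulrn ?(ltW Q0)// ler_powR.
have P0 : 0 <= tuple_prod (sinc_power l k) t by apply: prodr_ge0 => i _; exact: sinc_power_ge0.
have qs0 : 0 < q `^ s by rewrite powR_gt0.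
rewrite powRN -ler_pdivrMr ?invr_gt0// invrK /weight.
have k20 : 0 < 2 ^+ (k * d) :> R by rewrite exprn_gt0.
have -> : c1 / 2 ^+ (k * d) * l `^ (2 * s) * tuple_prod (sinc_power l k) t * q `^ s =
    c1 * (tuple_prod (sinc_power l k) t * (l `^ (2 * s) * q `^ s) / 2 ^+ (k * d)) by ring.
rewrite ler_piMr ?(ltW c1_gt0)// ler_pdivrMr// mul1r.
by apply: le_trans prod_le; rewrite ler_wpM2l.
Qed.

(** [variance_const * delta `^ (2 * nu0)] is the product of [weight l] and of the
    lower bound [((4 ^+ k)^-1 / l) ^+ d] for the integral of the sinc powers, with
    [l = delta / (4 * k)]. *)
Definition variance_const : R := c1 / 8 ^+ (k * d) * (4 * k%:R) `^ (- (2 * nu0)).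

Lemma variance_const_gt0 : 0 < variance_const.
Proof. by rewrite mulr_gt0 ?divr_gt0 ?exprn_gt0 ?powR_gt0// mulr_gt0// ltr0n. Qed.

(** By [sinc_power_tuple_le] the spectral density dominates a density whose
    covariance [M] vanishes at distance [delta]. For [M] the isolated node is
    uncorrelated with the other ones, so that the form for [M] is [M i i] plus a
    nonnegative form in the other coefficients. *)
Lemma variance_lower_bound (Psi f : 'rV[R]_d -> R) (m : nat) (z : 'I_m -> 'rV[R]_d)
    (u : 'I_m -> R) (i : 'I_m) (delta : R) :
  spectral_density Psi f ->
  (forall w, c1 * (1 + enorm w ^+ 2) `^ (- s) <= f w) ->
  0 < delta -> delta <= 1 -> u i = 1 ->
  (forall j, j != i -> exists e, delta <= `|z i ord0 e - z j ord0 e|) ->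
  variance_const * delta `^ (2 * nu0) <= \sum_j \sum_k0 u j * u k0 * Psi (z j - z k0).
Proof.
move=> [intf spec] fge delta0 delta1 ui sep.
have k0 : 0 < 4 * k%:R :> R by rewrite mulr_gt0// ltr0n.
(* The band of [sinc_power l k] is [2 * k * l], here [delta / 2]. *)
pose l := delta / (4 * k%:R).
have l0 : 0 < l by rewrite divr_gt0.
have l1 : l <= 1.
  rewrite ler_pdivrMr// mul1r (le_trans delta1)// -natrM ler1n.
  by rewrite muln_gt0.
pose b := sinc_power l k.
have b0 y : 0 <= b y by exact: sinc_power_ge0.
have bl : band_limited (k.*2%:R * l) b by exact: band_limited_sinc_power (ltW l0).
have mb : measurable_fun setT b := bl.1.1.
have ib : (@lebesgue_measure R).-integrable setT (EFin \o b) by exact: integrable_sinc_power.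
have vanish x c : delta <= `|x| -> \int[lebesgue_measure]_y (b y * cos (x * y + c)) = 0.
  move=> dx; apply: (band_limited_integral0 _ bl ib); apply: lt_le_trans dx.
  rewrite /l -muln2 natrM.
  have -> : k%:R * 2 * (delta / (4 * k%:R)) = delta / 2 :> R.
    by field; rewrite pnatr_eq0.
  by rewrite ltr_pdivrMr// ltr_pMr// ltr1n.
pose mu := lebesgue_tuple R d.
pose w := weight l.
have w0 : 0 < w by rewrite /w /weight mulr_gt0 ?powR_gt0// divr_gt0// exprn_gt0.
pose p j t := tuple_dot t (z j ord0).
have mp j : measurable_fun setT (p j) by exact: measurable_tuple_dot.
pose E (v : 'I_m -> R) t := (\sum_j v j * cos (p j t)) ^+ 2 + (\sum_j v j * sin (p j t)) ^+ 2.
have E0 v t : 0 <= E v t by rewrite addr_ge0// sqr_ge0.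
have iP := integrable_tuple_prod b0 mb ib d.
have [iEf EfE] := spectral_form_energy intf mp u.
have EfE' : \int[mu]_t (f (row_of_tuple t) * E u t) =
    \sum_j \sum_k0 u j * u k0 * Psi (z j - z k0).
  rewrite EfE; apply: eq_bigr => j _; apply: eq_bigr => h _; congr (_ * _).
  rewrite -(spec (z j - z h)).1; apply: eq_Rintegral => t _.
  by rewrite edotBr !edot_row_of_tuple mulrC.
pose M j h := \int[mu]_t (tuple_prod b t * cos (p j t - p h t)).
have [iEp EpE] := spectral_form_energy iP mp u.
have low : w * \int[mu]_t (tuple_prod b t * E u t) <=
    \sum_j \sum_k0 u j * u k0 * Psi (z j - z k0).
  rewrite -EfE' -RintegralZl//; apply: le_Rintegral => //.
    by have := integrableZl measurableT w iEp; exact: eq_integrable.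
  move=> t _; rewrite mulrA; apply: ler_wpM2r => //.
  by apply: le_trans (fge _); exact: sinc_power_tuple_le.
apply: le_trans low; rewrite EpE -/M.
have M0 j : j != i -> M i j = 0 /\ M j i = 0.
  move=> ji; have [e he] := sep j ji.
  split.
    rewrite -[RHS](Rintegral_tuple_prod_cos0 b0 mb ib (z := fun e => z i ord0 e - z j ord0 e) 0 vanish); last by exists e.
    apply: eq_Rintegral => t _; congr (_ * cos _); rewrite addr0 /p /tuple_dot -sumrB.
    by apply: eq_bigr => e' _; rewrite mulrBr.
  rewrite -[RHS](Rintegral_tuple_prod_cos0 b0 mb ib (z := fun e => z j ord0 e - z i ord0 e) 0 vanish); last first.
    by exists e; rewrite distrC.
  apply: eq_Rintegral => t _; congr (_ * cos _); rewrite addr0 /p /tuple_dot -sumrB.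
  by apply: eq_bigr => e' _; rewrite mulrBr.
pose B := \int[lebesgue_measure]_y b y.
have Mii : M i i = B ^+ d.
  rewrite /M; under eq_Rintegral do rewrite subrr cos0 mulr1.
  by rewrite /Rintegral (integral_tuple_prod b0 mb ib).
(* The part of the form carried by the other nodes is again an energy. *)
pose v j := if j == i then 0 else u j.
have split_sum : \sum_j \sum_k0 u j * u k0 * M j k0 =
    M i i + \sum_j \sum_k0 v j * v k0 * M j k0.
  have vE j : j != i -> v j = u j by rewrite /v => /negbTE ->.
  have vi : v i = 0 by rewrite /v eqxx.
  rewrite (bigD1 i)//= (bigD1 i)//= ui !mul1r big1 ?addr0 => [|j ji]; last first.
    by rewrite (M0 j ji).1 mulr0.
  congr (_ + _); rewrite [RHS](bigD1 i)//= [X in _ = X + _]big1 ?add0r => [|j _]; last first.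
    by rewrite vi !mul0r.
  apply: eq_bigr => j ji; rewrite (bigD1 i)//= [RHS](bigD1 i)//= (M0 j ji).2 !mulr0.
  by congr (_ + _); apply: eq_bigr => h hi; rewrite !vE.
have [_ EvE] := spectral_form_energy iP mp v.
rewrite split_sum -EvE.
have Ev0 : 0 <= \int[mu]_t (tuple_prod b t * E v t).
  by apply: Rintegral_ge0 => t _; rewrite mulr_ge0// tuple_prod_ge0.
apply: (@le_trans _ _ (w * M i i)); last by rewrite ler_wpM2l ?(ltW w0)// lerDl.
have Bge : (4 ^+ k)^-1 / l <= B by exact: Rintegral_sinc_power_ge.
have Bd : ((4 ^+ k)^-1 / l) ^+ d <= B ^+ d.
  have h0 : 0 <= (4 ^+ k)^-1 / l by rewrite divr_ge0 ?invr_ge0 ?exprn_ge0// ltW.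
  by rewrite lerXn2r// nnegrE (le_trans h0).
rewrite Mii; apply: (le_trans _ (ler_wpM2l (ltW w0) Bd)).
rewrite /w /weight exprMn exprVn -exprM /variance_const.
have -> : l `^ (2 * s) = l `^ (2 * nu0) * l ^+ d.
  rewrite -powR_mulrn ?(ltW l0)// -powRD; last by rewrite (gt_eqF l0) implybT.
  by congr (_ `^ _); rewrite /s; field.
have -> : l `^ (2 * nu0) = delta `^ (2 * nu0) * (4 * k%:R) `^ (- (2 * nu0)).
  rewrite /l powRM ?(ltW delta0) ?invr_ge0 ?(ltW k0)//.
  by rewrite -powR_inv1 ?(ltW k0)// -powRrM mulN1r.
have ld : l ^+ d != 0 by rewrite expf_neq0// gt_eqF.
have -> : 8 ^+ (k * d) = 2 ^+ (k * d) * 4 ^+ (k * d) :> R by rewrite -exprMn; congr (_ ^+ _); ring.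
have h2 : 2 ^+ (k * d) != 0 :> R by rewrite expf_neq0.
have h4 : 4 ^+ (k * d) != 0 :> R by rewrite expf_neq0.
rewrite le_eqVlt; apply/orP; left; apply/eqP.
by rewrite exprVn; field; rewrite ld h2 h4.
Qed.

End smoothness.
End variance_lower_bound.

(** * Points and distances in the domain *)

Section domain_geometry.
Context (R : realType) (d : nat) (Omega : set 'rV[R]_d).

Lemma compact_enorm_bounded : compact Omega ->
  exists D : R, forall x y, Omega x -> Omega y -> enorm (x - y) <= D.
Proof.
move=> cO.
have B i : exists B : R, 0 <= B /\ forall x, Omega x -> `|x ord0 i| <= B.
  have cc : {within Omega, continuous (fun x : 'rV[R]_d => x ord0 i)}.
    by apply: continuous_subspaceT => x; exact: coord_continuous.
  have /compact_bounded[M [_ HM]] := continuous_compact cc cO.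
  exists (`|M| + 1); split; first by rewrite addr_ge0.
  move=> x Ox; apply: (HM (`|M| + 1)); last by exists x.
  by rewrite (le_lt_trans (ler_norm M))// ltrDl.
have [B' HB] := choice B.
exists (d%:R * (\sum_i 2 * B' i)) => x y Ox Oy.
apply: enorm_le_coord => [|i].
  by apply: sumr_ge0 => i _; rewrite mulr_ge0// (HB i).1.
rewrite !mxE (bigD1 i)//= (le_trans (ler_normB _ _))//.
have := (HB i).2 _ Ox; have := (HB i).2 _ Oy.
have : 0 <= \sum_(j | j != i) 2 * B' j.
  by apply: sumr_ge0 => j _; rewrite mulr_ge0// (HB j).1.
lra.
Qed.

(** A ball centred on the axis of the cone, at half its height, lies in the cone:
    if [e] has norm at most [k = (r / 2) * (1 - c) / 2], where [c] is the cosine of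
    the angle, then [v = (r / 2) xi + e] satisfies [v . xi >= r / 2 - k], which is
    at least [c * (r / 2 + k) >= c * |v|]. *)
Lemma cone_contains_cube (hd : (0 < d)%N) : interior_cone_condition Omega -> Omega !=set0 ->
  exists (p : 'rV[R]_d) (l : R), 0 < l /\
    forall y : 'rV[R]_d, (forall i, p ord0 i <= y ord0 i <= p ord0 i + l) -> Omega y.
Proof.
move=> [alpha [r [a0 ap r0 cone]]] [x0 Ox0].
have [xi [xi1 Hxi]] := cone _ Ox0.
pose c := cos alpha.
have c0 : 0 <= c.
  by rewrite cos_ge0_pihalf// (ltW ap) andbT (le_trans _ (ltW a0))// oppr_le0 divr_ge0// pi_ge0.
have c1 : c < 1.
  rewrite /c -[X in _ < X]cos0 ltr_cos//; first by rewrite in_itv/= lexx pi_ge0.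
  by rewrite in_itv/= (ltW a0) (le_trans (ltW ap))// ler_pdivrMr// ler_peMr ?pi_ge0// ler1n.
pose k := (r / 2) * ((1 - c) / 2).
have k0 : 0 < k by rewrite !mulr_gt0 ?subr_gt0 ?invr_gt0.
have dp : (0 : R) < d%:R by rewrite ltr0n.
pose h := k / d%:R.
have h0 : 0 < h by rewrite divr_gt0.
exists (\row_i ((x0 + (r / 2) *: xi) ord0 i - h)), (2 * h); split; first by rewrite mulr_gt0.
move=> y Hy.
pose e := y - (x0 + (r / 2) *: xi).
have ek : enorm e <= k.
  have -> : k = d%:R * h by rewrite /h mulrC divfK// gt_eqF.
  apply: enorm_le_coord => [|i]; first exact: ltW.
  have := Hy i; rewrite !mxE => /andP[h1 h2]; rewrite ler_norml; apply/andP; split; lra.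
pose v := (r / 2) *: xi + e.
have xiv : edot xi xi = 1 by rewrite -enormE xi1 expr1n.
have exi : `|edot e xi| <= k.
  by rewrite (le_trans (edot_le_enorm _ _))// xi1 mulr1.
have vxi : edot v xi = r / 2 + edot e xi by rewrite /v edotDl edotZl xiv mulr1.
have v_le : enorm v <= r / 2 + k.
  rewrite (le_trans (ler_enormD _ _))// lerD// enormZ xi1 mulr1 ger0_norm//.
  by rewrite divr_ge0// ltW.
have k_lt : k < r / 2.
  by rewrite /k gtr_pMr ?divr_gt0// ltr_pdivrMr// mul1r; lra.
have v_ge : r / 2 - k <= edot v xi by move: exi; rewrite ler_norml vxi => /andP[? ?]; lra.
have v0 : 0 < enorm v.
  have := edot_le_enorm v xi; rewrite xi1 mulr1 ler_norml => /andP[_ h1].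
  by apply: lt_le_trans h1; apply: lt_le_trans v_ge; rewrite subr_gt0.
have -> : y = x0 + enorm v *: ((enorm v)^-1 *: v).
  by rewrite scalerA divff ?gt_eqF// scale1r /v /e addrA addrC subrK.
apply: Hxi.
- by rewrite enormZ normfV gtr0_norm// mulVf// gt_eqF.
- rewrite edotZl mulrC ler_pdivlMr// -/c.
  apply: le_trans v_ge; apply: (le_trans (ler_wpM2l c0 v_le)).
  rewrite /k; have : 0 <= (1 - c) ^+ 2 by exact: sqr_ge0.
  nra.
- rewrite enorm_ge0/= (le_trans v_le)//; lra.
Qed.

End domain_geometry.

Lemma finite_pos_lower_bound (R : realType) (I : finType) (F : I -> R) :
  (forall i, 0 < F i) -> exists e : R, 0 < e /\ forall i, e <= F i.
Proof.
move=> F0; have s0 : 0 <= \sum_i (F i)^-1.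
  by apply: sumr_ge0 => i _; rewrite invr_ge0 ltW.
exists (1 + \sum_i (F i)^-1)^-1; split; first by rewrite invr_gt0 ltr_pwDl.
move=> i; rewrite -[leRHS]invrK lef_pV2 ?posrE ?invr_gt0 ?ltr_pwDl//.
rewrite (bigD1 i)//= addrCA lerDl addr_ge0// sumr_ge0// => j _.
by rewrite invr_ge0 ltW.
Qed.

(** Each design point can spoil at most one node of a grid of mesh [l / m], since
    two nodes less than half a mesh away from the same point would be less than a
    mesh apart. Of the [m ^ d >= 2 n] nodes at least [n] remain. *)
Lemma separated_points (R : realType) (d n m : nat) (p : 'rV[R]_d) (l : R)
    (x : 'I_n -> 'rV[R]_d) :
  (0 < d)%N -> 0 < l -> (0 < n)%N -> (2 * n <= m ^ d)%N ->
  exists y : 'I_n -> 'rV[R]_d,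
    [/\ forall i e, p ord0 e <= y i ord0 e <= p ord0 e + l,
        forall i j, j != i -> exists e, l / (2 * m%:R) <= `|y i ord0 e - y j ord0 e| &
        forall i j, exists e, l / (2 * m%:R) <= `|y i ord0 e - x j ord0 e|].
Proof.
move=> hd l0 n0 hm.
have m0 : (0 < m)%N.
  by case: m hm => //; rewrite exp0n// leqn0 muln_eq0/= (gtn_eqF n0).
have mR : (0 : R) < m%:R by rewrite ltr0n.
pose s := l / m%:R.
have s0 : 0 < s by rewrite divr_gt0.
have sE : l / (2 * m%:R) = s / 2 by rewrite /s; field; rewrite gt_eqF.
pose g (f : {ffun 'I_d -> 'I_m}) : 'rV[R]_d := \row_e (p ord0 e + s * (f e)%:R).
have g_sep f f' : f != f' -> exists e, s <= `|g f ord0 e - g f' ord0 e|.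
  move=> ff'; have [e fe] : exists e, f e != f' e.
    apply/existsP; rewrite -[X in is_true X]negbK negb_exists; apply/negP => /forallP h.
    by move/eqP: ff'; apply; apply/ffunP => e; apply/eqP; have := h e; rewrite negbK.
  exists e; rewrite !mxE.
  have -> : p ord0 e + s * (f e)%:R - (p ord0 e + s * (f' e)%:R) = s * ((f e)%:R - (f' e)%:R) by ring.
  rewrite normrM (gtr0_norm s0) ler_peMr ?(ltW s0)//.
  have : (f e : nat) != f' e by [].
  rewrite neq_ltn => /orP[|] h.
    by rewrite distrC ger0_norm -?natrB ?(ltnW h)// ?ler0n// ler1n subn_gt0.
  by rewrite ger0_norm -?natrB ?(ltnW h)// ?ler0n// ler1n subn_gt0.
pose near f j := [forall e, `|g f ord0 e - x j ord0 e| < s / 2].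
pose bad := finset (fun f => [exists j, near f j]).
pose j0 := Ordinal n0.
pose c f := odflt j0 [pick j | near f j].
have cP f : f \in bad -> near f (c f).
  rewrite inE /c => /existsP[j nj]; case: pickP => //= h.
  by rewrite h in nj.
have c_inj : {in bad &, injective c}.
  move=> f f' fb f'b ccE; apply/eqP; apply/negPn/negP => /g_sep[e].
  apply/negP; rewrite -ltNge.
  have /forallP/(_ e) h1 := cP _ fb; have /forallP/(_ e) := cP _ f'b.
  rewrite -ccE => h2; rewrite [ltRHS](splitr s).
  by rewrite (le_lt_trans (ler_distD (x (c f) ord0 e) _ _))// ltrD// distrC.
have bad_n : (#|bad| <= n)%N.
  by rewrite -(card_in_imset c_inj) -[n in (_ <= n)%N]card_ord max_card.
have good_n : (n <= #|(~: bad)%SET|)%N.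
  have := cardsC bad; rewrite card_ffun !card_ord => h.
  by move: hm; rewrite -h mul2n -addnn => h'; lia.
pose y i := g (enum_val (widen_ord good_n i)).
exists y; rewrite sE; split.
- move=> i e; rewrite /y; set f := enum_val _; rewrite mxE lerDl lerD2l.
  rewrite mulr_ge0 ?(ltW s0)//= /s mulrAC ler_pdivrMr// ler_wpM2l ?(ltW l0)//.
  by rewrite ler_nat ltnW.
- move=> i j ji; have [|e he] := @g_sep (enum_val (widen_ord good_n i)) (enum_val (widen_ord good_n j)).
    by apply: contra ji => /eqP/enum_val_inj/(congr1 val)/= ij; apply/eqP/val_inj.
  by exists e; rewrite (le_trans _ he)// ler_pdivrMr// ler_peMr ?(ltW s0)// ler1n.
- move=> i j; have := enum_valP (widen_ord good_n i); rewrite !inE negb_exists => /forallP/(_ j).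
  by rewrite negb_forall => /existsP[e]; rewrite -leNgt => he; exists e.
Qed.

Section fill_and_mesh.
Context (R : realType) (d n : nat) (Omega : set 'rV[R]_d) (x : 'I_n -> 'rV[R]_d).
Hypotheses (n2 : (2 <= n)%N) (x_inj : injective x) (xO : forall j, Omega (x j)).
Hypothesis cO : compact Omega.

Let j0 : 'I_n := Ordinal (ltnW n2).
Let j1 : 'I_n := Ordinal n2.

Lemma has_inf_dist (y : 'rV[R]_d) : has_inf [set enorm (y - x j) | j in setT].
Proof.
split; first by exists (enorm (y - x j0)), j0.
by exists 0 => _ [j _ <-]; exact: enorm_ge0.
Qed.

Lemma inf_dist_le_fill_distance y : Omega y ->
  inf [set enorm (y - x j) | j in setT] <= fill_distance Omega x.
Proof.
move=> Oy; apply: ub_le_sup; last by exists y.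
have [D HD] := compact_enorm_bounded cO.
exists D => _ [z Oz <-]; apply: le_trans (HD _ _ Oz (xO j0)).
by apply: ge_inf; [exact: (has_inf_dist z).2|exists j0].
Qed.

Lemma le_fill_distance (y : 'rV[R]_d) (delta : R) : Omega y ->
  (forall j, delta <= enorm (y - x j)) -> delta <= fill_distance Omega x.
Proof.
move=> Oy h; apply: le_trans (inf_dist_le_fill_distance Oy).
by apply: lb_le_inf => [|_ [j _ <-]//]; exact: (has_inf_dist y).1.
Qed.

Lemma separation_radius_gt0 : 0 < separation_radius x.
Proof.
have [|e [e0 he]] := @finite_pos_lower_bound R {jk : 'I_n * 'I_n | jk.1 != jk.2}
  (fun jk => enorm (x (val jk).1 - x (val jk).2) / 2).
  move=> [[j k]/= jk]; rewrite divr_gt0// lt_def enorm_ge0 andbT.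
  by apply: contra jk => /eqP/enorm_eq0_coord/subr0_eq/x_inj/eqP.
apply: (lt_le_trans e0); apply: lb_le_inf.
  by exists (enorm (x j0 - x j1) / 2), (j0, j1).
by move=> _ [jk jkn <-]; exact: (he (Sub jk jkn)).
Qed.

Lemma separation_radius_le j k : j != k ->
  separation_radius x <= enorm (x j - x k) / 2.
Proof.
move=> jk; apply: ge_inf; last by exists (j, k).
by exists 0 => _ [? _ <-]; rewrite divr_ge0// enorm_ge0.
Qed.

(** If [2 h <= r], the point at distance [2 h] from [x_0] on a segment contained in
    [Omega] is at distance less than [2 h] from some design point, which is not
    [x_0] but is at distance at most [4 h] from it. If [2 h > r], then [h] is
    bounded below while the separation radius is at most [D / 2]. *)
Lemma separation_radius_le_fill (D r : R) : 0 < r ->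
  (forall y z, Omega y -> Omega z -> enorm (y - z) <= D) ->
  (forall y, Omega y -> exists xi : 'rV[R]_d, enorm xi = 1 /\
     forall t, 0 <= t <= r -> Omega (y + t *: xi)) ->
  0 < fill_distance Omega x ->
  separation_radius x <= (2 + D / r) * fill_distance Omega x.
Proof.
move=> r0 HD seg h0; set h := fill_distance Omega x in h0 *.
have D0 : 0 <= D by rewrite (le_trans (enorm_ge0 _) (HD _ _ (xO j0) (xO j0))).
have [hr|rh] := leP (2 * h) r; last first.
  apply: (le_trans (separation_radius_le (_ : j0 != j1))) => //.
  apply: (@le_trans _ _ (D / 2)).
    by rewrite ler_pM2r ?invr_gt0//; exact: HD.
  apply: (@le_trans _ _ (D / r * h)); last by rewrite mulrDl lerDr mulr_ge0// ltW.
  rewrite -mulrA ler_wpM2l// [leRHS]mulrC ler_pdivlMr// mulrC ler_pdivrMr// mulrC.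
  exact: ltW.
have [xi [xi1 Hxi]] := seg _ (xO j0).
have Ou : Omega (x j0 + (2 * h) *: xi) by apply: Hxi; rewrite mulr_ge0 ?(ltW h0).
have h2 : 0 < 2 * h - h by lra.
have [_ [j _ <-] hj] := inf_adherent h2 (has_inf_dist (x j0 + (2 * h) *: xi)).
have {}hj : enorm (x j0 + (2 * h) *: xi - x j) < 2 * h.
  by apply: (lt_le_trans hj); have := inf_dist_le_fill_distance Ou; rewrite -/h; lra.
have jj0 : j0 != j.
  apply: contraTN hj => /eqP <-; rewrite -leNgt addrAC subrr add0r enormZ xi1 mulr1.
  exact: ler_norm.
apply: (le_trans (separation_radius_le jj0)).
have := ler_enormD (x j0 + (2 * h) *: xi - x j) (- ((2 * h) *: xi)).
rewrite addrAC addrK enormN enormZ xi1 mulr1 ger0_norm; last by rewrite mulr_ge0// ltW.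
have : 0 <= D / r * h by rewrite !mulr_ge0 ?invr_ge0// ltW.
lra.
Qed.

(** For [nu <= nu0] the smaller exponent only helps because [h < 1]; otherwise the
    mesh ratio is at least [(2 + D / r)^-1] by [separation_radius_le_fill]. *)
Lemma variance_rate_ge (D r nu nu0 delta : R) : 0 < r -> 0 < nu0 -> 0 < delta ->
  (forall y z, Omega y -> Omega z -> enorm (y - z) <= D) ->
  (forall y, Omega y -> exists xi : 'rV[R]_d, enorm xi = 1 /\
     forall t, 0 <= t <= r -> Omega (y + t *: xi)) ->
  delta <= fill_distance Omega x -> fill_distance Omega x < 1 ->
  Num.min 1 ((2 + D / r)^-1 `^ (2 * (nu - nu0))) * delta `^ (2 * nu0)
    <= variance_rate Omega x nu nu0.
Proof.
move=> r0 nu00 delta0 HD seg dh h1.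
have h0 := lt_le_trans delta0 dh.
have D0 : 0 <= D by rewrite (le_trans (enorm_ge0 _) (HD _ _ (xO j0) (xO j0))).
have c0 : 0 < 2 + D / r by rewrite ltr_wpDr// divr_ge0// ltW.
have dh0 : delta `^ (2 * nu0) <= fill_distance Omega x `^ (2 * nu0).
  by rewrite ge0_ler_powR// ?nnegrE ?mulr_ge0 ?ltW.
rewrite /variance_rate; case: ifPn => [nn|]; last rewrite -ltNge => nn.
  apply: (@le_trans _ _ (delta `^ (2 * nu0))).
    by rewrite ler_piMl ?powR_ge0// ge_min lexx.
  by apply: (le_trans dh0); rewrite ger_powR ?ler_pM2l// h0 ltW.
rewrite mulrC ler_pM ?powR_ge0// ?le_min ?ler01 ?powR_ge0// ge_min; apply/orP; right.
have q0 := separation_radius_gt0.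
rewrite ge0_ler_powR// ?nnegrE.
- by rewrite mulr_ge0// subr_ge0 ltW.
- by rewrite invr_ge0 ltW.
- by rewrite divr_ge0// ltW.
- rewrite /mesh_ratio ler_pdivlMr// mulrC ler_pdivrMr// mulrC.
  exact: separation_radius_le_fill.
Qed.

End fill_and_mesh.

(** * Small balls of the interpolation error *)

Section dual_vectors.
Context (R : realType) (m : nat) (K : 'M[R]_m).
Hypothesis Kpos : forall u, u != 0 -> 0 < cov_form K u u.

Lemma posdef_unitmx : K \in unitmx.
Proof.
rewrite unitmxE unitfE; apply/negP => /det0P[u u0 uK].
by have := Kpos u0; rewrite /cov_form uK mul0mx mxE ltxx.
Qed.

(** The normalized [i]-th row of the inverse of [K]. *)
Lemma dual_vector (i : 'I_m) : exists g : 'rV[R]_m,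
  g ord0 i = 1 /\ forall u, cov_form K g u = cov_form K g g * u ord0 i.
Proof.
pose h := row i (invmx K).
have hK : h *m K = row i 1%:M by rewrite -row_mul mulVmx// posdef_unitmx.
have hu u : cov_form K h u = u ord0 i.
  rewrite /cov_form hK mxE (bigD1 i)//= big1 ?addr0 => [|j ji].
    by rewrite !mxE eqxx mul1r.
  by rewrite !mxE eq_sym (negbTE ji) mul0r.
have h0 : h != 0.
  apply/eqP => h0; move: hK; rewrite h0 mul0mx => /rowP/(_ i)/eqP.
  by rewrite !mxE eqxx eq_sym oner_eq0.
have c0 : 0 < h ord0 i by rewrite -hu Kpos.
have gu u : cov_form K ((h ord0 i)^-1 *: h) u = (h ord0 i)^-1 * u ord0 i.
  by rewrite -hu /cov_form -!scalemxAl mxE.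
have gi : ((h ord0 i)^-1 *: h) ord0 i = 1 by rewrite mxE mulVf// gt_eqF.
by exists ((h ord0 i)^-1 *: h); split=> // u; rewrite !gu gi mulr1.
Qed.

End dual_vectors.

Section small_ball_probability.
Context d (T : measurableType d) (R : realType) (P : probability T R).
Variables (m N : nat) (Z : 'I_m -> T -> R) (K : 'M[R]_m).
Hypothesis mZ : forall k, measurable_fun setT (Z k).
Hypothesis Ksym : K^T = K.
Hypothesis Kpos : forall u, u != 0 -> 0 < cov_form K u u.
Hypothesis charfun : forall u t,
  \int[P]_w cos (lin_comb Z u w + t) = cos t * expR (- (cov_form K u u / 2)).
Variables (s : 'I_N -> 'I_m) (w_ : 'I_N -> 'rV[R]_m) (a v : R).
Hypothesis ws : forall i j, w_ i ord0 (s j) = (i == j)%:R.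
Hypotheses (a0 : 0 < a) (v0 : 0 < v) (N0 : (0 < N)%N).
Hypothesis Kv : forall i (u : 'rV[R]_m), u ord0 (s i) = 1 -> v <= cov_form K u u.

Let cube := [set w | forall i, `|lin_comb Z (w_ i) w| <= a].

Lemma measurable_cube : measurable cube.
Proof.
have -> : cube = \bigcap_(i in [set: 'I_N]) (lin_comb Z (w_ i) @^-1` `[- a, a]%classic).
  apply/seteqP; split => w h.
    by move=> i _; rewrite /preimage/= in_itv/= -ler_norml.
  by move=> i; have := h i I; rewrite /preimage/= in_itv/= -ler_norml.
apply: fin_bigcap_measurable => // i _; rewrite -[X in measurable X]setTI.
by apply: (measurable_lin_comb mZ (w_ i)) => //; exact: measurable_itv.
Qed.

(** [small_ball] with [g_ i] the dual vector of the coordinate [s i]: as [w_ i] has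
    coordinate 1 at [s i] and the other [w_ j] have coordinate 0 there, [g_ i] has
    the covariances required. *)
Lemma small_ball_probability :
  (P cube <= (expR (9 * a ^+ 2 / (2 * v)) / (2 * N%:R))%:E)%E.
Proof.
have [g gP] := choice (fun i => dual_vector Kpos (s i)).
have := small_ball mZ Ksym charfun (w_ := w_) (g_ := g) a0 v0.
have cubeE : \int[P]_w (\prod_(i < N) \1_`[0 - a, 0 + a] (lin_comb Z (w_ i) w) : R) = fine (P cube).
  rewrite /Rintegral -(setIT cube) -(integral_indic P measurableT measurable_cube).
  congr fine; apply: eq_integral => w _; congr EFin.
  rewrite sub0r add0r indicE.
  have [/set_mem wc|wc] := boolP (w \in cube).
    rewrite big1// => i _; rewrite indicE mem_set//=.
    by rewrite in_itv/= -ler_norml; exact: wc.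
  have [i hi] : exists i, a < `|lin_comb Z (w_ i) w|.
    apply: contrapT => h; move/negP: wc; apply; apply/mem_set => i.
    by rewrite leNgt; apply/negP => hi; apply: h; exists i.
  rewrite (bigD1 i)//= indicE memNset ?mul0r//=.
  by rewrite in_itv/= -ler_norml; apply/negP; rewrite -ltNge.
rewrite cubeE -(fineK (fin_num_measure P _ measurable_cube)) lee_fin => h.
rewrite ler_pdivlMr ?mulr_gt0 ?ltr0n// mulrC -[leRHS]mulr1 -ler_pdivrMl ?expR_gt0// -expRN mulrCA mulrA.
apply: h.
- by move=> i; exact: (Kv (gP i).1).
- move=> i j ji; rewrite (gP i).2 ws.
  by rewrite (negbTE ji) mulr0.
- move=> i; rewrite (gP i).2 !mxE (gP i).1 ws eqxx subrr mulr0.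
  by [].
Qed.

End small_ball_probability.

Section gaussian_field.
Context dT (T : measurableType dT) (R : realType) (P : probability T R) (d : nat).
Variables (Z : 'rV[R]_d -> {RV P >-> R}) (Psi : 'rV[R]_d -> R) (sigma : R).
Hypothesis gZ : gaussian_process Z.
Hypothesis EZ : forall x, expectation P (Z x) = 0%E.
Hypothesis covZ : forall x x',
  covariance P (Z x) (Z x') = (sigma ^+ 2 * Psi (x - x'))%:E.

Lemma integral_mul_field x x' :
  (\int[P]_w (Z x w * Z x' w)%:E = (sigma ^+ 2 * Psi (x - x'))%:E)%E.
Proof.
rewrite -covZ; rewrite covariance.unlock !EZ/= expectation.unlock.
by apply: eq_integral => w _; rewrite mulrfctE/= !subr0.
Qed.

Lemma integrable_sqr_field x : P.-integrable setT (fun w => (Z x w ^+ 2)%:E).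
Proof.
apply/integrableP; split.
  by apply/measurable_EFinP; apply: measurable_funX; exact: measurable_funPT.
have := integral_mul_field x x; under eq_integral do rewrite -expr2.
move=> h; under eq_integral do rewrite /= ger0_norm ?sqr_ge0//.
by rewrite h ltry.
Qed.

Lemma integrable_mul_field x x' : P.-integrable setT (EFin \o (fun w => Z x w * Z x' w)).
Proof.
apply: (le_integrable measurableT _ _ (integrableD measurableT (integrable_sqr_field x) (integrable_sqr_field x'))).
  by apply/measurable_EFinP; apply: measurable_funM; exact: measurable_funPT.
move=> w _; rewrite /= lee_fin.
have := sqr_ge0 (Z x w); have := sqr_ge0 (Z x' w); set p := Z x w; set q := Z x' w => q0 p0.
rewrite (ger0_norm (addr_ge0 p0 q0)) ler_norml; apply/andP; split.
  by have := sqr_ge0 (p + q); nra.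
by have := sqr_ge0 (p - q); nra.
Qed.

Lemma integrable_field x : P.-integrable setT (EFin \o Z x).
Proof.
have i1 : P.-integrable setT (EFin \o (fun=> 1 : R)).
  by apply: (bounded_measurable_integrable (probability_setT_lty P)); exact: bounded_measurable_cst.
apply: (le_integrable measurableT _ _ (integrableD measurableT i1 (integrable_sqr_field x))).
  by apply/measurable_EFinP; exact: measurable_funPT.
move=> w _; rewrite /= lee_fin; set p := Z x w.
have p0 := sqr_ge0 p.
rewrite (ger0_norm (addr_ge0 ler01 p0)) ler_norml; apply/andP; split.
  by have := sqr_ge0 (p + 1); nra.
by have := sqr_ge0 (p - 1); nra.
Qed.

Variables (m : nat) (z : 'I_m -> 'rV[R]_d).

Definition field_cov := \matrix_(j, k) (sigma ^+ 2 * Psi (z j - z k)).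

Lemma field_cov_form u :
  cov_form field_cov u u = sigma ^+ 2 * \sum_j \sum_k u ord0 j * u ord0 k * Psi (z j - z k).
Proof.
rewrite /cov_form mxE exchange_big/= mulr_sumr; apply: eq_bigr => k _.
rewrite !mxE mulr_suml mulr_sumr; apply: eq_bigr => j _; rewrite !mxE; ring.
Qed.

Lemma field_charfun (u : 'rV[R]_m) t :
  \int[P]_w cos (lin_comb (fun k => Z (z k)) u w + t) =
  cos t * expR (- (cov_form field_cov u u / 2)).
Proof.
have mZ k : measurable_fun setT (Z (z k)) by exact: measurable_funPT.
pose X := lin_comb (fun k => Z (z k) : T -> R) u.
have i1 k : P.-integrable setT (EFin \o (fun w => u ord0 k * Z (z k) w)).
  exact: (integrableZl measurableT (u ord0 k) (integrable_field (z k))).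
have [iX EX] := Rintegral_sum (index_enum 'I_m) i1.
have i2 (p : 'I_m * 'I_m) : P.-integrable setT
   (EFin \o (fun w => u ord0 p.1 * u ord0 p.2 * (Z (z p.1) w * Z (z p.2) w))).
  exact: (integrableZl measurableT _ (integrable_mul_field (z p.1) (z p.2))).
have [iX2 EX2] := Rintegral_sum (index_enum _) i2.
have XX w : X w ^+ 2 = \sum_p u ord0 p.1 * u ord0 p.2 * (Z (z p.1) w * Z (z p.2) w).
  rewrite expr2 /X /lin_comb mulr_suml.
  rewrite -(pair_bigA _ (fun j k => u ord0 j * u ord0 k * (Z (z j) w * Z (z k) w)))/=.
  by apply: eq_bigr => j _; rewrite mulr_sumr; apply: eq_bigr => k _; ring.
rewrite (@gaussian_law_charfun _ _ _ P X t) //.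
- congr (cos t * expR (- (_ / 2))).
  under eq_Rintegral do rewrite XX.
  rewrite EX2 field_cov_form mulr_sumr -(pair_bigA _ (fun j k => \int[P]_w (u ord0 j * u ord0 k * (Z (z j) w * Z (z k) w))))/=.
  apply: eq_bigr => j _; rewrite mulr_sumr; apply: eq_bigr => k _.
  rewrite RintegralZl//; last exact: integrable_mul_field.
  by rewrite /Rintegral integral_mul_field/=; ring.
- exact: measurable_lin_comb.
- exact: gZ.
- by under eq_fun do rewrite XX.
- rewrite EX big1// => k _; rewrite RintegralZl//; last exact: integrable_field.
  have := EZ (z k); rewrite expectation.unlock /Rintegral => ->.
  by rewrite mulr0.
Qed.

End gaussian_field.

Lemma kriging_interpolant_sum (R : realType) (d n : nat) (Phi : 'rV[R]_d -> R)
    (x : 'I_n -> 'rV[R]_d) (y : 'rV[R]_d) :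
  exists c : 'rV[R]_n, forall f,
    kriging_interpolant Phi x f y = \sum_k c ord0 k * f (x k).
Proof.
exists ((\row_(j < n) Phi (y - x j)) *m invmx (\matrix_(j < n, k < n) Phi (x j - x k))).
by move=> f; rewrite /kriging_interpolant mxE; apply: eq_bigr => k _; rewrite [in X in _ * X]mxE.
Qed.

Section kriging_error.
Context dT (T : measurableType dT) (R : realType) (P : probability T R) (d : nat).
Variables (Z : 'rV[R]_d -> {RV P >-> R}) (Psi Phi f : 'rV[R]_d -> R) (sigma nu0 c1 : R).
Hypothesis gZ : gaussian_process Z.
Hypothesis EZ : forall x, expectation P (Z x) = 0%E.
Hypothesis covZ : forall x x',
  covariance P (Z x) (Z x') = (sigma ^+ 2 * Psi (x - x'))%:E.
Hypotheses (sigma0 : 0 < sigma) (nu00 : 0 < nu0) (c10 : 0 < c1).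
Hypothesis PsiN : forall x, Psi (- x) = Psi x.
Hypothesis Psif : spectral_density Psi f.
Hypothesis f_ge : forall w, c1 * (1 + enorm w ^+ 2) `^ (- (nu0 + d%:R / 2)) <= f w.

Lemma field_cov_lower_bound m (z : 'I_m -> 'rV[R]_d) (u : 'rV[R]_m) i (delta : R) :
  0 < delta -> delta <= 1 -> u ord0 i = 1 ->
  (forall j, j != i -> exists e, delta <= `|z i ord0 e - z j ord0 e|) ->
  sigma ^+ 2 * (variance_const d nu0 c1 * delta `^ (2 * nu0))
    <= cov_form (field_cov Psi sigma z) u u.
Proof.
move=> d0 d1 ui sep; rewrite field_cov_form ler_wpM2l ?sqr_ge0//.
exact: (variance_lower_bound nu00 c10 Psif f_ge d0 d1 ui sep).
Qed.

(** Finitely many distinct points are separated by some positive distance, so that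
    [field_cov_lower_bound] applies to the vector scaled to have a coordinate
    equal to one. *)
Lemma field_cov_posdef m (z : 'I_m -> 'rV[R]_d) (u : 'rV[R]_m) :
  injective z -> u != 0 -> 0 < cov_form (field_cov Psi sigma z) u u.
Proof.
move=> zi /rV0Pn[i ui].
have sep j : exists b : R, 0 < b /\
    (j != i -> exists e, b <= `|z i ord0 e - z j ord0 e|).
  have [->|ji] := eqVneq j i; first by exists 1.
  have /rV0Pn[e he] : z i - z j != 0.
    by rewrite subr_eq0; apply: contra ji => /eqP/zi ->.
  exists `|z i ord0 e - z j ord0 e|; split; last by move=> _; exists e.
  by rewrite normr_gt0; move: he; rewrite !mxE.
have [b_ Hb] := choice sep.
have [e [e0 he]] := finite_pos_lower_bound (fun j => (Hb j).1).
have -> : u = u ord0 i *: ((u ord0 i)^-1 *: u) by rewrite scalerA divff// scale1r.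
set g := _^-1 *: u.
have formZ (c : R) : cov_form (field_cov Psi sigma z) (c *: g) (c *: g) =
    c ^+ 2 * cov_form (field_cov Psi sigma z) g g.
  move: g => g; rewrite /cov_form [(_ *: _)^T]linearZ/= -!scalemxAl -scalemxAr.
  by rewrite scalerA -expr2 mxE.
rewrite formZ.
rewrite mulr_gt0 ?exprn_even_gt0//.
have me : 0 < Num.min 1 e by rewrite lt_min ltr01.
have gi : g ord0 i = 1 by rewrite mxE mulVf.
apply: lt_le_trans (field_cov_lower_bound me _ gi _).
- by rewrite !mulr_gt0 ?exprn_gt0 ?variance_const_gt0 ?powR_gt0.
- by rewrite ge_min lexx.
- move=> j ji; have [k hk] := (Hb j).2 ji; exists k.
  by rewrite ge_min (le_trans (he j) hk) orbT.
Qed.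

Variables (n : nat) (x y : 'I_n -> 'rV[R]_d) (delta a : R).
Hypotheses (n0 : (0 < n)%N) (x_inj : injective x) (delta0 : 0 < delta) (delta1 : delta <= 1).
Hypothesis y_sep : forall i j, j != i -> exists e, delta <= `|y i ord0 e - y j ord0 e|.
Hypothesis xy_sep : forall i j, exists e, delta <= `|y i ord0 e - x j ord0 e|.
Hypothesis a0 : 0 < a.

Let v := sigma ^+ 2 * (variance_const d nu0 c1 * delta `^ (2 * nu0)).
Let error i w := Z (y i) w - kriging_interpolant Phi x (fun p => Z p w) (y i).

(** The family consists of the [Z y_i] followed by the [Z x_j]. The error at [y_i]
    is [Z y_i] minus a combination of the [Z x_j], so that its coordinates at the
    [Z y_j] are those of a unit vector. *)
Lemma kriging_error_small_ball :
  let E := [set w | forall i, `|error i w| <= a] in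
  measurable E /\ (P E <= (expR (9 * a ^+ 2 / (2 * v)) / (2 * n%:R))%:E)%E.
Proof.
pose z (k : 'I_(n + n)) := match fintype.split k with inl i => y i | inr j => x j end.
have zl i : z (lshift n i) = y i by rewrite /z -[lshift n i]/(unsplit (inl i)) unsplitK.
have zr i : z (rshift n i) = x i by rewrite /z -[rshift n i]/(unsplit (inr i)) unsplitK.
have sep_ne (p q : 'rV[R]_d) : (exists e, delta <= `|p ord0 e - q ord0 e|) -> p <> q.
  by move=> [e he] pq; move: he; rewrite pq subrr normr0 leNgt delta0.
have z_inj : injective z.
  move=> k k'; case: (split_ordP k) => i ->; case: (split_ordP k') => j ->; rewrite ?zl ?zr.
  - move=> h; have [->//|ij] := eqVneq j i.
    by have := sep_ne _ _ (y_sep ij).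
  - by move=> h; have := sep_ne _ _ (xy_sep i j).
  - by move=> /esym h; have := sep_ne _ _ (xy_sep j i).
  - by move=> /x_inj ->.
have [c_ Hc] := choice (fun i => kriging_interpolant_sum Phi x (y i)).
pose w_ i : 'rV[R]_(n + n) := row_mx (delta_mx ord0 i) (- c_ i).
pose Zz k : T -> R := Z (z k).
have errorE i w : lin_comb Zz (w_ i) w = error i w.
  rewrite /error Hc /lin_comb big_split_ord/=; congr (_ + _).
    rewrite (bigD1 i)//= big1 ?addr0 => [|j ji].
      by rewrite row_mxEl mxE !eqxx mul1r /Zz zl.
    by rewrite row_mxEl mxE (negbTE ji) andbF mul0r.
  by rewrite -sumrN; apply: eq_bigr => j _; rewrite row_mxEr mxE /Zz zr mulNr.
have mZ k : measurable_fun setT (Zz k) by exact: measurable_funPT.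
have Ksym : (field_cov Psi sigma z)^T = field_cov Psi sigma z.
  by apply/matrixP => j k; rewrite !mxE -PsiN opprB.
have Kpos u : u != 0 -> 0 < cov_form (field_cov Psi sigma z) u u by exact: field_cov_posdef.
have charfun u t := field_charfun gZ EZ covZ z u t.
have ws i j : w_ i ord0 (lshift n j) = (i == j)%:R by rewrite row_mxEl mxE eqxx eq_sym.
have v0 : 0 < v by rewrite !mulr_gt0 ?exprn_gt0 ?variance_const_gt0 ?powR_gt0.
have Kv i (u : 'rV[R]_(n + n)) : u ord0 (lshift n i) = 1 -> v <= cov_form (field_cov Psi sigma z) u u.
  move=> ui; apply: (field_cov_lower_bound delta0 delta1 ui) => k.
  case: (split_ordP k) => j -> ji; rewrite zl ?zl ?zr; last exact: xy_sep.
  by apply: y_sep; apply: contra ji => /eqP ->.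
have EE : [set w | forall i, `|error i w| <= a] = [set w | forall i, `|lin_comb Zz (w_ i) w| <= a].
  by apply/seteqP; split => w /= h i; have := h i; rewrite errorE.
rewrite /= EE; split; first exact: measurable_cube.
exact: (small_ball_probability mZ Ksym Kpos charfun ws a0 v0 n0 Kv).
Qed.

End kriging_error.

(** * Choice of the constants *)

(** The least integer above [(2 n) ^ (1 / d)] will do, since
    [2 ^ (1 / d) + 1 <= 3]. *)
Lemma grid_resolution (R : realType) (d n : nat) : (0 < d)%N -> (0 < n)%N ->
  exists m : nat, [/\ (0 < m)%N, (2 * n <= m ^ d)%N &
    m%:R <= 3 * n%:R `^ (d%:R^-1) :> R].
Proof.
move=> d0 n0; pose b : R := (2 * n%:R) `^ (d%:R^-1).
have dR : (0 : R) < d%:R by rewrite ltr0n.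
have b0 : 0 <= b by exact: powR_ge0.
have n1 : (1 : R) <= n%:R by rewrite ler1n.
have dn : 0 <= (d%:R^-1 : R) by rewrite invr_ge0 ltW.
have d1 : (d%:R^-1 : R) <= 1 by rewrite invf_le1// ler1n.
have hb : b < (Num.trunc b).+1%:R by rewrite truncnS_gt.
exists (Num.trunc b).+1; split => //.
  rewrite -(ler_nat R) natrX natrM; apply: (@le_trans _ _ (b ^+ d)).
    by rewrite -powR_mulrn// -powRrM mulVf ?gt_eqF// powRr1// mulr_ge0.
  by rewrite lerXn2r ?nnegrE// ltW.
have -> : (Num.trunc b).+1%:R = (Num.trunc b)%:R + 1 :> R by rewrite -natr1.
have h1 : (Num.trunc b)%:R <= b by rewrite truncn_le.
have h2 : b <= 2 * n%:R `^ (d%:R^-1).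
  rewrite /b powRM// ?(le_trans ler01)// ler_wpM2r ?powR_ge0//.
  by rewrite ler1_powR// ler1n.
have h3 : 1 <= n%:R `^ (d%:R^-1) :> R.
  by rewrite -[leLHS](powRr0 n%:R) ler_powR.
lra.
Qed.

(** The equation for [C2] turns the small ball exponent into [ln n / 2], so that
    the left side is [n ^ (- 1 / 2) / 2]. On the right, the bounds on [t] and [A]
    make the exponent at least [- ln n / 2]. Here [s] stands for
    [n ^ (- nu0 / d)]. *)
Lemma small_ball_le_tail (R : realType) (n : nat) (sigma s V kappa cA A C2 t : R) :
  (1 < n)%N -> 0 < sigma -> 0 < s -> 0 < V -> 0 < kappa -> 0 < cA -> 0 < t ->
  0 < C2 -> C2 ^+ 2 = V * kappa / 9 ->
  t < C2 * sigma * s * Num.sqrt (ln n%:R) -> cA * (kappa * s ^+ 2) <= A ->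
  expR (9 * (C2 * sigma * s * Num.sqrt (ln n%:R)) ^+ 2 /
    (2 * (sigma ^+ 2 * (V * (kappa * s ^+ 2))))) / (2 * n%:R)
  <= expR (- (t ^+ 2 / (2 * (C2 ^+ 2 / (cA * kappa)) * sigma ^+ 2 * A))).
Proof.
move=> n1 sg0 s0 V0 k0 cA0 t0 C20 C2E ta hA.
have nR : (0 : R) < n%:R by rewrite ltr0n ltnW.
have L0 : 0 <= ln (n%:R : R) by rewrite ln_ge0// ler1n ltnW.
have aE : (C2 * sigma * s * Num.sqrt (ln n%:R)) ^+ 2 = C2 ^+ 2 * (sigma ^+ 2 * s ^+ 2) * ln n%:R.
  by rewrite !exprMn sqr_sqrtr//; ring.
have t2 : t ^+ 2 < (C2 * sigma * s * Num.sqrt (ln n%:R)) ^+ 2.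
  by rewrite ltrXn2r// ?nnegrE ltW// (lt_trans t0).
rewrite aE in t2 *.
have -> : 9 * (C2 ^+ 2 * (sigma ^+ 2 * s ^+ 2) * ln n%:R) /
    (2 * (sigma ^+ 2 * (V * (kappa * s ^+ 2)))) = ln n%:R / 2.
  by rewrite C2E; field; rewrite !gt_eqF.
rewrite ler_pdivrMr; last by rewrite mulr_gt0.
apply: (@le_trans _ _ (expR (- (ln n%:R / 2)) * n%:R)).
  by rewrite -[X in _ <= _ * X]lnK ?posrE// -expRD ler_expR; lra.
apply: (@le_trans _ _ (expR (- (ln n%:R / 2)) * (2 * n%:R))).
  by rewrite ler_wpM2l ?expR_ge0// ler_peMl ?(ltW nR)// ler1n.
rewrite ler_wpM2r//.
rewrite ler_expR lerN2.
have A0 : 0 < A by apply: lt_le_trans hA; rewrite !mulr_gt0 ?exprn_gt0.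
have den0 : 0 < 2 * (C2 ^+ 2 / (cA * kappa)) * sigma ^+ 2 * A.
  by rewrite !mulr_gt0 ?exprn_gt0 ?invr_gt0// mulr_gt0.
rewrite ler_pdivrMr//.
apply: (le_trans (ltW t2)).
have -> : ln n%:R / 2 * (2 * (C2 ^+ 2 / (cA * kappa)) * sigma ^+ 2 * A) =
   C2 ^+ 2 * sigma ^+ 2 * ln n%:R * (A / (cA * kappa)).
  by field; rewrite !gt_eqF.
have -> : C2 ^+ 2 * (sigma ^+ 2 * s ^+ 2) * ln n%:R = C2 ^+ 2 * sigma ^+ 2 * ln n%:R * s ^+ 2 by ring.
rewrite ler_wpM2l ?mulr_ge0 ?(ltW C20) ?(ltW sg0)//.
by rewrite ler_pdivlMr ?mulr_gt0// mulrC -mulrA.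
Qed.

Theorem theorem3p3 (R : realType) (d : nat) (hd : (0 < d)%N)
    (Omega : set 'rV[R]_d)
    (hOmega_compact : compact Omega)
    (hOmega_lipschitz : lipschitz_boundary Omega)
    (hOmega_cone : interior_cone_condition Omega)
    (Psi Phi f_Psi f_Phi : 'rV[R]_d -> R)
    (hPsi : correlation_function Psi) (hPhi : correlation_function Phi)
    (hf_Psi : spectral_density Psi f_Psi)
    (hf_Phi : spectral_density Phi f_Phi)
    (c1 c2 c3 c4 nu0 nu : R)
    (hc1 : 0 < c1) (hc12 : c1 <= c2) (hc3 : 0 < c3) (hc34 : c3 <= c4)
    (hnu0 : 0 < nu0) (hnu : 0 < nu)
    (hdecay_Psi : spectral_decay f_Psi nu0 c1 c2)
    (hdecay_Phi : spectral_decay f_Phi nu c3 c4) :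
  exists C1 C2 : R, [/\ 0 < C1, 0 < C2 &
    forall (dT : measure_display) (T : measurableType dT)
      (P : probability T R) (Z : 'rV[R]_d -> {RV P >-> R}) (sigma : R),
      0 < sigma ->
      gaussian_process Z ->
      (forall x, expectation P (Z x) = 0%E) ->
      (forall x x',
        covariance P (Z x) (Z x') = (sigma ^+ 2 * Psi (x - x'))%:E) ->
      {ae P, forall w, continuous (fun x => Z x w : R)} ->
    forall (n : nat) (x : 'I_n -> 'rV[R]_d),
      (2 <= n)%N -> injective x -> (forall j, Omega (x j)) ->
      fill_distance Omega x < 1 ->
    forall t : R, 0 < t ->
    exists E : set T, [/\ measurable E,
      ((1 - expR (- (t ^+ 2 /
          (2 * C1 * sigma ^+ 2 * variance_rate Omega x nu nu0))))%:E
        <= P E)%E &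
      forall w, E w ->
        ((C2 * sigma * n%:R `^ (- (nu0 / d%:R)) * Num.sqrt (ln n%:R) - t)%:E
          <= ereal_sup [set `|Z y w -
               kriging_interpolant Phi x (fun u => Z u w) y|%:E
             | y in Omega])%E]].
Proof.
have [Om0|/set0P/negP/negPn/eqP Om0] := pselect (Omega !=set0); last first.
  exists 1, 1; split => // dT T P Z sigma _ _ _ _ _ n x n2 _ xO.
  by have := xO (Ordinal n2); rewrite Om0.
have [D HD] := compact_enorm_bounded hOmega_compact.
have [p [l [l0 cube]]] := cone_contains_cube hd hOmega_cone Om0.
have [alpha [r [alpha0 alphapi r0 cone]]] := hOmega_cone.
have seg y : Omega y -> exists xi : 'rV[R]_d, enorm xi = 1 /\
    forall t, 0 <= t <= r -> Omega (y + t *: xi).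
  move=> /cone[xi [xi1 hxi]]; exists xi; split => // t tr.
  by apply: hxi => //; rewrite -enormE xi1 expr1n cos_le1.
have D0 : 0 <= D by have [y Oy] := Om0; rewrite (le_trans (enorm_ge0 _) (HD _ _ Oy Oy)).
(* [k / n ^ (1 / d)] is at most half the mesh [l / m] of a grid with [m <= 3 n ^ (1 / d)]. *)
pose k := Num.min 1 l / 6.
have k0 : 0 < k by rewrite divr_gt0// lt_min ltr01.
pose kappa := k `^ (2 * nu0).
have kappa0 : 0 < kappa by exact: powR_gt0.
pose V := variance_const d nu0 c1.
have V0 : 0 < V by exact: variance_const_gt0.
pose cA := Num.min 1 ((2 + D / r)^-1 `^ (2 * (nu - nu0))).
have cA0 : 0 < cA.
  by rewrite lt_min ltr01 powR_gt0// invr_gt0 ltr_wpDr// divr_ge0// ltW.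
pose C2 := Num.sqrt (V * kappa / 9).
have C20 : 0 < C2 by rewrite sqrtr_gt0 !mulr_gt0// invr_gt0.
have C2E : C2 ^+ 2 = V * kappa / 9 by rewrite sqr_sqrtr// ltW// !mulr_gt0 ?invr_gt0.
exists (C2 ^+ 2 / (cA * kappa)), C2; split => //.
  by rewrite divr_gt0 ?mulr_gt0 ?exprn_gt0.
move=> dT T P Z sigma sg0 gZ EZ covZ _ n x n2 x_inj xO h1 t t0.
have n0 : (0 < n)%N by exact: ltnW.
have nR : (0 : R) < n%:R by rewrite ltr0n.
set A := variance_rate Omega x nu nu0.
set s := n%:R `^ (- (nu0 / d%:R)).
have s0 : 0 < s by exact: powR_gt0.
set a := C2 * sigma * s * Num.sqrt (ln n%:R).
have [at_|ta] := leP a t.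
  exists setT; split; first exact: measurableT.
    rewrite probability_setT lee_fin gerBl expR_ge0//.
  move=> w _; apply: (@le_trans _ _ 0%E); first by rewrite lee_fin subr_le0.
  apply: (@le_trans _ _ (`|Z (x (Ordinal n0)) w - kriging_interpolant Phi x (fun u => Z u w) (x (Ordinal n0))|%:E)).
    by rewrite lee_fin.
  by apply: ereal_sup_ubound; exists (x (Ordinal n0)).
have a0 : 0 < a by exact: lt_trans ta.
have [m [m0 mn m_le]] := grid_resolution R hd n0.
have [y [yO yy yx]] := separated_points p x hd l0 n0 mn.
pose delta := k * n%:R `^ (- d%:R^-1).
have delta0 : 0 < delta by rewrite mulr_gt0 ?powR_gt0.
have mR : (0 : R) < m%:R by rewrite ltr0n.
have n1 : 1 <= n%:R `^ (d%:R^-1) :> R.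
  by rewrite -[leLHS](powRr0 n%:R) ler_powR ?invr_ge0 ?ler0n// ler1n.
have [k6l k1] : k * 6 <= l /\ k <= 1.
  by split; rewrite /k ?divfK// ?ler_pdivrMr// ge_min ?lexx ?orbT//; lra.
have delta_m : delta <= l / (2 * m%:R).
  rewrite /delta powRN ler_pdivlMr ?mulr_gt0//; apply: le_trans k6l.
  rewrite -mulrA ler_wpM2l ?(ltW k0)// mulrC ler_pdivrMr ?(lt_le_trans _ n1)//.
  lra.
have delta1 : delta <= 1.
  by rewrite mulr_ile1 ?powR_ge0 ?(ltW k0)// powRN invf_le1// (lt_le_trans _ n1).
have deltaE : delta `^ (2 * nu0) = kappa * s ^+ 2.
  rewrite /delta powRM ?powR_ge0 ?(ltW k0)// -powRrM; congr (_ * _).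
  rewrite -powR_mulrn ?powR_ge0// -powRrM; congr (_ `^ _); field.
  by rewrite pnatr_eq0 -lt0n.
have dh : delta <= fill_distance Omega x.
  apply: (le_fill_distance n2 xO hOmega_compact (cube _ (yO (Ordinal n0)))) => j.
  have [e he] := yx (Ordinal n0) j; apply: (le_trans delta_m); apply: (le_trans he).
  by have := ler_coord_enorm (y (Ordinal n0) - x j) e; rewrite !mxE.
have hA : cA * (kappa * s ^+ 2) <= A.
  by rewrite -deltaE; exact: (variance_rate_ge n2 x_inj xO hOmega_compact nu r0 hnu0 delta0 HD seg dh h1).
have [_ PsiN _ _] := hPsi.
have ysep i j : j != i -> exists e, delta <= `|y i ord0 e - y j ord0 e|.
  by move=> /yy[e he]; exists e; exact: le_trans he.
have xysep i j : exists e, delta <= `|y i ord0 e - x j ord0 e|.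
  by have [e he] := yx i j; exists e; exact: le_trans he.
have [mE PE] := kriging_error_small_ball Phi gZ EZ covZ sg0 hnu0 hc1 PsiN hf_Psi
  (fun w => (hdecay_Psi w).1) n0 x_inj delta0 delta1 ysep xysep a0.
exists (~` [set w | forall i, `|Z (y i) w - kriging_interpolant Phi x (fun u => Z u w) (y i)| <= a]).
split; first exact: measurableC.
  rewrite probability_setC// EFinB leeB//; apply: (le_trans PE).
  rewrite lee_fin deltaE; exact: small_ball_le_tail.
move=> w /existsNP[i /negP]; rewrite -ltNge => hi.
apply: (@le_trans _ _ (`|Z (y i) w - kriging_interpolant Phi x (fun u => Z u w) (y i)|%:E)).
  by rewrite lee_fin lerBlDr (le_trans (ltW hi))// lerDl ltW.
by apply: ereal_sup_ubound; exists (y i) => //; apply: cube; exact: yO.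
Qed.
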